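(* Let $d\geq 1$ be an integer and $\varepsilon>0$. There is a constant $c=c(d,\varepsilon)$, depending only on $d$ and $\varepsilon$, such that for every irreducible curve $C\subset\mathbb{P}^3$ of degree $d$ (defined over $\overline{\mathbb{Q}}$, not necessarily defined over the rationals) and every $B\geq 1$, the curve $C$ has at most $c\,B^{2/d+\varepsilon}$ points $\mathbf{x}\in Z_4$ in the cube $\max_i|x_i|\leq B$.
   Context: $Z_4$ denotes the set of all nonzero $\mathbf{x}=(x_1,x_2,x_3,x_4)\in\mathbb{Z}^4$ with $\gcd(x_1,x_2,x_3,x_4)=1$ and such that $x_i>0$ for the smallest index $i$ with $x_i\neq 0$; such a vector is identified with the point of $\mathbb{P}^3$ it represents. ''Irreducible'' for curves means irreducible over $\overline{\mathbb{Q}}$. *)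

(* Defs.v *)
From mathcomp Require Import all_boot all_order all_algebra all_field.
From mathcomp Require Import mpoly.
From mathcomp Require Import boolp classical_sets cardinality.

Set Implicit Arguments.
Unset Strict Implicit.
Unset Printing Implicit Defensive.

Import Order.TTheory GRing.Theory Num.Theory.

Local Open Scope classical_set_scope.
Local Open Scope ring_scope.

(* The base field is [algC], the field of algebraic numbers.  A subset of
   projective n-space is encoded as the set of all homogeneous coordinate
   vectors of its points: a set of nonzero row vectors stable under nonzero
   scaling.  Stability need not be imposed on Zariski closed sets, since they
   are zero loci of forms. *)

Definition zero_locus n (E : set {mpoly algC[n.+1]}) : set 'rV[algC]_n.+1 :=
  [set v : 'rV[algC]_n.+1 | v != 0 /\ forall p, E p -> p.@[v ord0] = 0].

Definition zariski_closed n (X : set 'rV[algC]_n.+1) : Prop :=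
  exists E : set {mpoly algC[n.+1]},
    (forall p, E p -> exists e : nat, p \is e.-homog) /\ X = zero_locus E.

Definition irreducible_closed n (X : set 'rV[algC]_n.+1) : Prop :=
  [/\ zariski_closed X, X !=set0 &
      forall Y Z : set 'rV[algC]_n.+1,
        zariski_closed Y -> zariski_closed Z ->
        X = Y `|` Z -> X = Y \/ X = Z].

Definition irreducible_chain n (X : set 'rV[algC]_n.+1) (r : nat) : Prop :=
  exists Z : nat -> set 'rV[algC]_n.+1,
    (forall i, (i <= r)%N -> irreducible_closed (Z i) /\ Z i `<=` X) /\
    (forall i, (i < r)%N -> Z i `<` Z i.+1).

(* Excluding chains of length r + 1 excludes all longer ones, by truncation. *)
Definition has_dimension n (X : set 'rV[algC]_n.+1) (r : nat) : Prop :=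
  irreducible_chain X r /\ ~ irreducible_chain X r.+1.

(* [U] is the degree t part of the homogeneous ideal of [X]. *)
Definition ideal_part n (X : set 'rV[algC]_n.+1) (t : nat)
    (U : {vspace dhomog n.+1 algC t}) : Prop :=
  forall p : dhomog n.+1 algC t,
    p \in U <-> (forall v : 'rV[algC]_n.+1,
                    X v -> (p : {mpoly algC[n.+1]}).@[v ord0] = 0).

(* The Hilbert function of [X] at t is the codimension of the degree t part of
   the ideal of [X] in the space of all forms of degree t. *)
Definition hilbert_polynomial n (X : set 'rV[algC]_n.+1)
    (P : {poly rat}) : Prop :=
  exists t0 : nat, forall t : nat, (t0 <= t)%N ->
    exists2 U : {vspace dhomog n.+1 algC t}, ideal_part X U &
      P.[t%:R] = (\dim {:dhomog n.+1 algC t})%:R - (\dim U)%:R.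

(* The degree of X is r! times the leading coefficient of its Hilbert
   polynomial, where r = dim X. *)
Definition has_degree n (X : set 'rV[algC]_n.+1) (d : nat) : Prop :=
  exists (r : nat) (P : {poly rat}),
    [/\ has_dimension X r, hilbert_polynomial X P &
        (r`!)%:R * lead_coef P = d%:R].

Definition irreducible_curve n (C : set 'rV[algC]_n.+1) (d : nat) : Prop :=
  [/\ irreducible_closed C, has_dimension C 1 & has_degree C d].

(* Representatives of the rational points of projective space: primitive
   integer vectors whose first nonzero coordinate is positive. *)
Definition Zprim n : set 'rV[int]_n :=
  [set x : 'rV[int]_n | [/\ x != 0,
               \big[gcdz/0]_(i < n) x ord0 i = 1 &
               forall i : 'I_n, x ord0 i != 0 ->
                 (forall j : 'I_n, (j < i)%N -> x ord0 j = 0) ->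
                 0 < x ord0 i]].

Definition max_height n (x : 'rV[int]_n) : nat := \max_(i < n) `|x ord0 i|%N.

Definition int_point n (x : 'rV[int]_n) : 'rV[algC]_n := map_mx intr x.

(* Main.v *)
(* Heath-Brown's p-adic method, run directly on the space curve and with the
   determinants replaced by the pigeonhole principle.

   The ideal J of C is prime, its Hilbert function is eventually d t + const, and
   hence a form of degree g outside J has at most d g zeros on C.  Macaulay's
   bound makes the growth uniform: the Hilbert function is at least d (t - d)
   for every t, so h = d (t - d) monomials of degree t are independent on C.

   Let C have more than 4 d^2 points of height at most N.  Siegel's lemma gives
   forms with small integer coefficients, in J, in the variables x_i0, x_i1, x_j
   only; with minimal degree, the derivative in x_j is not in J.  So at all but
   O(1) points these derivatives and x_i0 are nonzero integers bounded by a power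
   of N, and some prime p <= N^delta divides none of them.  For q = p^k, Hensel's
   lemma writes all coordinates of the points in a given residue class as p-adic
   power series in one parameter divisible by q.  A combination of the h monomials
   whose expansion has its k-th coefficient divisible by q^(h-k) takes values
   divisible by q^h at these points; the pigeonhole principle gives one with
   coefficients about q^((h+1)/2), so that its values vanish once q^(h-1) exceeds
   h^2 N^(2t).  Each class thus has at most d t points, and there are about
   q N^(O(delta)) = N^(2t/(h-1) + O(delta)) classes. *)

Require Import Defs.
From HB Require Import structures.
From mathcomp Require Import all_boot all_order all_algebra all_field.
From mathcomp Require Import finmap.
From mathcomp Require Import boolp classical_sets cardinality reals exp.
From mathcomp Require Import mpoly.
From mathcomp Require Import zify ring lra.

Set Implicit Arguments.
Unset Strict Implicit.
Unset Printing Implicit Defensive.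

Import Order.TTheory GRing.Theory Num.Theory.

Local Open Scope ring_scope.

(** * Graded ideals *)

(** The constant may not depend on [C], and [C] need not be defined over the rationals: its
    equations have algebraic coefficients of unknown size. Integer equations therefore come from the
    linear system of vanishing at the given points, and [C] enters the estimates only through its
    Hilbert function, which has a lower bound uniform in [C]. Projecting to the planes of x_i0,
    x_i1, x_j lets each coordinate be solved for separately by the one-variable Hensel lemma. The
    modulus q is a power of a small prime because it should pass its threshold by a factor of at
    most N^delta. Only the parameter is fixed modulo q; the other coordinates are fixed modulo p, at
    a cost of one factor p each. As h = d (t - d), the exponent 2 t / (h - 1) tends to 2 / d when t
    grows. A fixed large t uses up one half of eps, the factors p the other half. *)

Lemma vspace_of_pred (K : fieldType) (vT : vectType K) (Q : vT -> Prop) :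
    Q 0 -> (forall a u v, Q u -> Q v -> Q (a *: u + v)) ->
  exists U : {vspace vT}, forall v, v \in U <-> Q v.
Proof.
move=> Q0 QL.
(* [U] will be a subspace of largest dimension inside [Q]; together with a vector of [Q] outside it,
   it would span a larger one. *)
pose P k := `[< exists2 U : {vspace vT}, (forall v, v \in U -> Q v) & \dim U = k >].
have exP : exists k, P k.
  exists 0%N; apply/asboolP; exists 0%VS; last by rewrite dimv0.
  by move=> v; rewrite memv0 => /eqP ->.
have ubP k : P k -> (k <= \dim {:vT})%N.
  by move=> /asboolP[U _ <-]; apply/dimvS/subvf.
case: (ex_maxnP exP ubP) => k /asboolP[U UQ dimU] maxk.
exists U => v; split=> [/UQ //|Qv]; apply/negP => /negP vU.
suff : P k.+1 by move=> /maxk; rewrite ltnn.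
apply/asboolP; exists (U + <[v]>)%VS.
  by move=> w /memv_addP[u /UQ Qu [_ /vlineP[a ->] ->]]; rewrite addrC; apply: QL.
rewrite dimv_disjoint_sum ?dim_vline ?dimU.
  by case: eqP vU => [->|_]; rewrite ?mem0v ?addn1.
apply/eqP; rewrite -subv0; apply/subvP => w /memv_capP[wU /vlineP[a wE]].
have [a0|a0] := eqVneq a 0; first by rewrite wE a0 scale0r mem0v.
by case/negP: vU; rewrite -[v](scalerK a0) -wE memvZ.
Qed.

Section GradedIdeals.
Variables (n : nat) (K : fieldType).
Local Notation form := {mpoly K[n.+1]}.
Local Notation S := (dhomog n.+1 K).
Implicit Type J : set form.

(* [J] is the set of homogeneous elements of a homogeneous ideal. *)
Record gideal J : Prop := Gideal {
  gid_homog : forall p : form, J p -> exists e, p \is e.-homog;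
  gid0 : J 0;
  gidD : forall e (p q : form),
    p \is e.-homog -> q \is e.-homog -> J p -> J q -> J (p + q);
  gidM : forall e (p q : form), q \is e.-homog -> J p -> J (q * p) }.

Definition gprime J := [/\ gideal J, ~ J 1 &
  forall d e (p q : form), p \is d.-homog -> q \is e.-homog -> J (p * q) -> J p \/ J q].

Lemma gidZ J (a : K) (p : form) : gideal J -> J p -> J (a *: p).
Proof.
move=> gJ Jp; rewrite -mul_mpolyC; apply: (@gidM _ gJ 0%N) => //.
by rewrite -[a%:MP]mulr1 mul_mpolyC; apply/rpredZ/dhomog1.
Qed.

(* The degree [t] piece of [J]; it is junk unless [J] is a [gideal]. *)
Definition part J t : {vspace S t} :=
  xget 0%VS [set U : {vspace S t} | forall p : S t, p \in U <-> J p]%classic.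

Lemma partP J t (p : S t) : gideal J -> p \in part J t <-> J p.
Proof.
move=> gJ; rewrite /part.
have [|a u v Ju Jv|U UJ] := @vspace_of_pred K (S t) (fun r => J (r : form)).
- exact: gid0 gJ.
- rewrite linearP /=; apply: (gidD gJ (e := t)) => //.
  + exact/rpredZ/dhomog_is_dhomog.
  + exact: dhomog_is_dhomog.
  + exact: gidZ.
by case: xgetP => [V _|/(_ U)] //; apply.
Qed.

Definition hmul g s (G : S g) (p : S s) : S (g + s) :=
  DHomog (dhomogM (dhomog_is_dhomog G) (dhomog_is_dhomog p)).

Lemma hmul_is_linear g s (G : S g) : linear (@hmul g s G).
Proof.
by move=> a p q; apply: val_inj; rewrite /= mulrDr scalerAr.
Qed.

HB.instance Definition _ g s (G : S g) :=
  GRing.isLinear.Build K (S s) (S (g + s)) _ (@hmul g s G) (@hmul_is_linear g s G).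

Lemma lker_hmul g s (G : S g) : (G : form) != 0 ->
  lker (linfun (@hmul g s G)) = 0%VS.
Proof.
move=> G0; apply/eqP; rewrite -subv0; apply/subvP => p.
rewrite memv_ker lfunE memv0 => /eqP/(congr1 val)/eqP /=.
by rewrite mulf_eq0 (negPf G0).
Qed.

Definition part_adjoin J g s (G : S g) : {vspace S (g + s)} :=
  (part J (g + s) + linfun (@hmul g s G) @: fullv)%VS.

Lemma part_adjoinP J g s (G : S g) (p : S (g + s)) : gideal J ->
  p \in part_adjoin J s G <->
  exists q (r : S s), [/\ J (q : form), q \is (g + s).-homog &
                      (p : form) = q + (G : form) * r].
Proof.
move=> gJ; split.
  case/memv_addP => q /(partP _ gJ) Jq [_ /memv_imgP[r _ ->] ->].
  exists q, r; split; [exact: Jq | exact: dhomog_is_dhomog | by rewrite lfunE].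
case=> q [r [Jq hq pE]]; apply/memv_addP.
exists (DHomog hq); first exact/(partP _ gJ).
exists (linfun (@hmul g s G) r); first exact/memv_img/memvf.
by apply: val_inj; rewrite /= lfunE.
Qed.

(** Multiplication by [G] is injective and, [J] being prime, pulls [J] back to [J]. This is
    exactness of 0 -> (S/J)_s -> (S/J)_(g+s) -> (S/(J,G))_(g+s) -> 0, stated without truncated
    subtraction. *)
Lemma dim_part_adjoin J g s (G : S g) : gprime J -> ~ J G ->
  (\dim (part_adjoin J s G) + \dim (part J s) =
   \dim (part J (g + s)) + \dim {: S s})%N.
Proof.
move=> [gJ _ Jpr] JG.
have G0 : (G : form) != 0 by apply: contra_notN JG => /eqP ->; exact: gid0 gJ.
have kG U : (U :&: lker (linfun (@hmul g s G)))%VS = 0%VS.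
  by rewrite lker_hmul // capv0.
rewrite -(limg_dim_eq (kG (part J s))) -(limg_dim_eq (kG fullv)).
rewrite -[in RHS]dimv_sum_cap; congr (_ + _)%N; congr (\dim _).
apply/eqP; rewrite eqEsubv; apply/andP; split; apply/subvP => p.
  case/memv_imgP => q /(partP _ gJ) Jq ->; rewrite memv_cap memv_img ?memvf // andbT.
  by apply/(partP _ gJ); rewrite lfunE /=; apply: gidM Jq => //; exact: dhomog_is_dhomog.
rewrite memv_cap => /andP[/(partP _ gJ) Jp /memv_imgP[q _ pE]].
rewrite pE; apply: memv_img; apply/(partP _ gJ); move: Jp; rewrite pE lfunE /=.
by case/(Jpr _ _ _ _ (dhomog_is_dhomog G) (dhomog_is_dhomog q)).
Qed.

End GradedIdeals.

(** * Leading monomials and Macaulay's bound *)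

Section Leads.
Variables (n : nat) (K : fieldType).
Local Notation form := {mpoly K[n.+1]}.
Local Notation S := (dhomog n.+1 K).

Definition mons t : {set 'X_{1..n.+1 < t.+1}} := [set m : 'X_{1..n.+1 < t.+1} | mdeg m == t].

Definition leads t (U : {vspace S t}) : {set 'X_{1..n.+1 < t.+1}} :=
  [set m : 'X_{1..n.+1 < t.+1} |
     `[< exists2 p : S t, p \in U & (p : form) != 0 /\ mlead p = m >]].

Lemma mlead_dhomog t (p : form) : p != 0 -> p \is t.-homog -> mdeg (mlead p) = t.
Proof. by move=> p0 /dhomogP; apply; apply: mlead_supp. Qed.

Lemma leadsS t (U : {vspace S t}) : leads U \subset mons t.
Proof.
apply/fintype.subsetP => m; rewrite !finset.inE => /asboolP[p _ [p0 <-]].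
by rewrite (mlead_dhomog p0 (dhomog_is_dhomog p)).
Qed.

(** An element of [U] whose coefficients at all of [leads U] vanish has no leading monomial, so it
    is 0. *)
Lemma card_leads_ge t (U : {vspace S t}) : (\dim U <= #|leads U|)%N.
Proof.
pose f (p : S t) : 'rV[K]_#|leads U| := \row_i (p : form)@_(bmnm (enum_val i)).
have f_lin : linear f.
  by move=> a p q; apply/rowP => i; rewrite !mxE /= linearP.
pose fl : {linear S t -> 'rV[K]_#|leads U|} :=
  HB.pack f (GRing.isLinear.Build K (S t) 'rV[K]_#|leads U| _ f f_lin).
have kU : (U :&: lker (linfun fl))%VS = 0%VS.
  apply/eqP; rewrite -subv0; apply/subvP => p; rewrite memv_cap memv_ker memv0 lfunE.
  move=> /andP[pU /eqP/rowP fp0]; apply/eqP/val_inj/eqP => /=.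
  apply/contraT => p0.
  have lt : (mdeg (mlead (p : form)) < t.+1)%N.
    by rewrite (mlead_dhomog p0 (dhomog_is_dhomog p)).
  have lU : BMultinom lt \in leads U by rewrite finset.inE; apply/asboolP; exists p.
  have := fp0 (enum_rank_in lU (BMultinom lt)).
  rewrite !mxE /= enum_rankK_in //= => /eqP.
  by rewrite mleadc_eq0 (negPf p0).
rewrite -(limg_dim_eq kU).
by rewrite (leq_trans (dimvS (subvf _))) // dimvf /dim /= mul1n.
Qed.

(** Elements with distinct leading monomials are independent: the largest one in a relation cannot
    cancel. *)
Lemma card_leads_le t (U : {vspace S t}) : (#|leads U| <= \dim U)%N.
Proof.
have hP i : exists p : S t, [/\ p \in U, (p : form) != 0 &
                                mlead p = @enum_val _ (mem (leads U)) i].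
  by have := enum_valP i; rewrite finset.inE => /asboolP[p pU [p0 lp]]; exists p.
pose F i := projT1 (cid (hP i)).
have FP i : [/\ F i \in U, (F i : form) != 0 & mlead (F i) = enum_val i].
  by rewrite /F; case: cid.
have frF : free [tuple F i | i < #|leads U|].
  apply/freeP => k; under eq_bigr => i _ do rewrite (nth_map i) ?size_enum_ord // nth_ord_enum.
  move=> sum0 i0; apply/eqP/contraT => k0.
  have [i ki imax] := @arg_maxP _ _ _ i0 (fun i => k i != 0)
     (fun i => mlead (F i : form)) k0.
  have [_ Fi0 Fil] := FP i.
  move/(congr1 (fun p : S t => (p : form)@_(mlead (F i)))): sum0.
  rewrite mcoeff0 !linear_sum /= (bigD1 i) //= big1 ?addr0.
    move/eqP; rewrite linearZ /= mulf_eq0 (negPf ki) /=.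
    by rewrite mleadc_eq0 (negPf Fi0).
  move=> j ji; rewrite linearZ /=.
  have [->|kj] := eqVneq (k j) 0; first by rewrite mul0r.
  rewrite mcoeff_gt_mlead ?mulr0 //.
  have /= le_ji := imax j kj; rewrite lt_neqAle le_ji andbT.
  apply: contraNN ji => /eqP; have [_ _ ->] := FP j; rewrite Fil => /val_inj/enum_val_inj ->.
  by [].
move: frF; rewrite /free size_tuple => /eqP <-; apply: dimvS.
apply/span_subvP => _ /mapP[i _ ->]; by have [] := FP i.
Qed.

Lemma card_leads t (U : {vspace S t}) : #|leads U| = \dim U.
Proof. by apply/eqP; rewrite eqn_leq card_leads_le card_leads_ge. Qed.

Lemma leadsf t : leads {: S t} = mons t.
Proof.
apply/eqP; rewrite finset.eqEsubset leadsS; apply/fintype.subsetP => m; rewrite !finset.inE => /eqP dm.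
have hm : ('X_[m] : form) \is t.-homog by rewrite dhomogX /= dm.
apply/asboolP; exists (DHomog hm); first exact: memvf.
by rewrite /= mleadXm -msupp_eq0 msuppX.
Qed.

Lemma card_mons t : #|mons t| = \dim {: S t}.
Proof. by rewrite -leadsf card_leads. Qed.

Lemma card_stds t (U : {vspace S t}) :
  #|mons t :\: leads U| = (\dim {: S t} - \dim U)%N.
Proof. by rewrite cardsD (finset.setIidPr (leadsS U)) card_leads card_mons. Qed.

End Leads.

(** [a j] and [b j] stand for the layers of two sets of monomials, of degrees t + 1 and t, in which
    the first variable has exponent j. The first hypothesis comes from lowering that exponent, the
    second from induction on the other variables. *)
Lemma layer_count (t : nat) (a b : nat -> nat) :
    (forall j, (j <= t)%N -> (a j.+1 <= b j)%N) ->
    (forall j, (j <= t)%N -> (minn (a j) (t.+1 - j) <= b j)%N) ->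
  (minn (\sum_(j < t.+2) a j) t.+1 <= \sum_(j < t.+1) b j)%N.
Proof.
move=> hS hm.
have [/existsP[/= j1 hj1]|/existsPn/= noj] :=
    boolP [exists j : 'I_t.+2, (t.+1 - j < a j)%N]; last first.
  rewrite big_ord_recr /=.
  have -> : a t.+1 = 0%N by have := noj ord_max; rewrite /= subnn -leqNgt leqn0 => /eqP.
  rewrite addn0 geq_min; apply/orP; left; apply: leq_sum => j _.
  have := noj (widen_ord (leqnSn _) j); rewrite /= -leqNgt => aj.
  by apply: leq_trans (hm j _); rewrite ?leq_min ?leqnn // -ltnS.
(* Let [j0] be the first layer above its bound. If some layer up to [j0] is empty, compare without a
   shift below it and with a shift above it. Otherwise the layers of [b] below [j0] count at least 1
   each and layer [j0] at least t + 1 - j0. *)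
have exj : exists j, (j <= t.+1)%N && (t.+1 - j < a j)%N.
  by exists j1; rewrite hj1 andbT -ltnS.
case: (ex_minnP exj) => j0 /andP[j0t aj0] j0min.
have below j : (j < j0)%N -> (a j <= t.+1 - j)%N.
  move=> jj0; rewrite leqNgt; apply/negP => aj.
  have := j0min j; rewrite aj andbT => h.
  have /h : (j <= t.+1)%N by lia.
  lia.
have [/existsP[/= k /andP[kj0 /eqP ak]]|/existsPn/= nok] :=
    boolP [exists k : 'I_t.+2, (k <= j0)%N && (a k == 0)%N].
  rewrite geq_min; apply/orP; left.
  have kt : (k <= t.+1)%N by rewrite -ltnS.
  rewrite -!(big_mkord xpredT) (big_cat_nat (n := k)) //=; last exact: leqW.
  rewrite [X in (_ + X <= _)%N]big_ltn // ak add0n big_add1 /=.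
  rewrite [X in (_ <= X)%N](big_cat_nat (n := k)) //=.
  apply: leq_add; rewrite big_nat [X in (_ <= X)%N]big_nat; apply: leq_sum => j /andP[j1' j2].
    have jt : (j <= t)%N by lia.
    by apply: leq_trans (hm j jt); rewrite leq_min leqnn below //; lia.
  by apply: hS; rewrite -ltnS.
have pos j : (j < j0)%N -> (0 < b j)%N.
  move=> jj0; have jt : (j <= t)%N by lia.
  have jt2 : (j.+1 < t.+2)%N by lia.
  apply: leq_trans (hS j jt); rewrite lt0n.
  by have := nok (Ordinal jt2); rewrite /= jj0.
rewrite geq_min; apply/orP; right.
rewrite -(big_mkord xpredT) (big_cat_nat (n := j0)) //=.
have s1 : (j0 <= \sum_(0 <= j < j0) b j)%N.
  rewrite big_mkord -[X in (X <= _)%N]card_ord -sum1_card; apply: leq_sum => j _.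
  exact: pos.
have s2 : (t.+1 - j0 <= \sum_(j0 <= j < t.+1) b j)%N.
  have [j0t'|] := leqP j0 t; last by move=> ?; have -> : (t.+1 - j0 = 0)%N by lia.
  rewrite big_ltn // (leq_trans _ (leq_addr _ _)) //.
  by apply: leq_trans (hm j0 j0t'); rewrite leq_min leqnn andbT ltnW.
lia.
Qed.

(* Macaulay's theorem in the range where it says that the dimension cannot grow:
   induction on the number of variables, slicing by the first exponent. *)
Lemma shadow_card n t (A B : seq (seq nat)) : uniq A ->
    {in A, forall s, size s = n /\ sumn s = t.+1} ->
    (forall s i, s \in A -> (0 < nth 0 s i)%N ->
       set_nth 0%N s i (nth 0 s i).-1 \in B) ->
  (minn (size A) t.+1 <= size B)%N.
Proof.
elim: n t A B => [|n IHn] t A B uA hA hB.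
  case: A uA hA {hB} => [|s A] _ hA; first by rewrite min0n.
  by have [/size0nil -> ] := hA s (mem_head _ _).
(* The empty list also lands in layer 0, hence the alternative in [layer_mem]: nothing is assumed
   about the lengths of the lists in [B]. *)
pose layer (C : seq (seq nat)) j := [seq behead s | s <- C & head 0%N s == j].
have layer_mem C j s : (s \in layer C j) -> j :: s \in C \/ [::] \in C.
  case/mapP => r; rewrite mem_filter => /andP[/eqP rj rC] ->.
  by case: r rj rC => [|x r] /= => [|->]; [right|left].
have memA j s : s \in layer A j -> j :: s \in A.
  by case/layer_mem => // /hA[].
have size_layers C (m : nat) : (\sum_(j < m) size (layer C j) <= size C)%N.
  under eq_bigr => j _ do rewrite size_map size_filter.
  elim: C => [|s C IHC]; first by rewrite big1.
  rewrite /= big_split /= -[X in (_ <= X)%N]add1n leq_add //.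
  have [hm|hm] := ltnP (head 0%N s) m; last first.
    rewrite big1 // => j _; case: eqP => // hj; have := ltn_ord j; lia.
  rewrite (bigD1 (Ordinal hm)) //= eqxx big1 ?addn0 // => j.
  by rewrite -val_eqE /= eq_sym => /negPf ->.
have size_layersA : size A = (\sum_(j < t.+2) size (layer A j))%N.
  under eq_bigr => j _ do rewrite size_map size_filter.
  elim: (A) hA => [|s C IHC] hC; first by rewrite big1.
  rewrite /= big_split /= -IHC; last by move=> r rC; apply: hC; rewrite in_cons rC orbT.
  have [ss su] := hC s (mem_head _ _).
  have hm : (head 0%N s < t.+2)%N by case: (s) su => //= x r <-; lia.
  rewrite (bigD1 (Ordinal hm)) //= eqxx big1 // => j.
  by rewrite -val_eqE /= eq_sym => /negPf ->.
have uniq_layer j : uniq (layer A j).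
  rewrite map_inj_in_uniq ?filter_uniq // => r s.
  rewrite !mem_filter => /andP[/eqP rj /hA[rn _]] /andP[/eqP sj /hA[sn _]].
  by case: r s rn sn rj sj => [|x r] // [|y s] //= _ _ -> -> ->.
rewrite size_layersA (leq_trans _ (size_layers B t.+1)) //.
apply: (@layer_count t (fun j => size (layer A j)) (fun j => size (layer B j))) => j jt.
  apply: uniq_leq_size => // s /memA sA; have /= sB := hB _ 0%N sA isT.
  by apply/mapP; exists (j :: s) => //; rewrite mem_filter /= eqxx.
rewrite subSn //; apply: (IHn (t - j)%N) => //.
  by move=> s /memA /hA /= [[->]]; split=> //; lia.
move=> s i /memA sA si; have /= sB := hB _ i.+1 sA si.
by apply/mapP; exists (j :: set_nth 0%N s i (nth 0%N s i).-1) => //; rewrite mem_filter /= eqxx.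
Qed.

Section Macaulay.
Variables (n : nat) (K : fieldType).
Local Notation form := {mpoly K[n.+1]}.
Local Notation S := (dhomog n.+1 K).

(** Count the monomials that lead no element of [V]. Dividing one by a variable gives a monomial
    leading no element of [U], since x_i times an element of [U] is in [V]. The bound by t decides
    the minimum in [shadow_card]. *)
Lemma codim_antitone t (U : {vspace S t}) (V : {vspace S t.+1}) :
    (forall (p : S t) (q : S t.+1) i, p \in U ->
       (q : form) = 'X_i * (p : form) -> q \in V) ->
    (\dim {: S t} - \dim U <= t)%N ->
  (\dim {: S t.+1} - \dim V <= \dim {: S t} - \dim U)%N.
Proof.
move=> hUV; rewrite -!card_stds.
set A := mons _ _ :\: leads V; set B := mons _ _ :\: leads U => cB.
pose sA := [seq (m : seq nat) | m : 'X_{1..n.+1 < t.+2} <- enum A].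
pose sB := [seq (m : seq nat) | m : 'X_{1..n.+1 < t.+1} <- enum B].
have szA : size sA = #|A| by rewrite size_map -cardE.
have szB : size sB = #|B| by rewrite size_map -cardE.
suff : (minn (size sA) t.+1 <= size sB)%N.
  rewrite szA szB; lia.
apply: (@shadow_card n.+1).
- rewrite map_inj_uniq ?enum_uniq // => m1 m2 /= m12.
  by apply/val_inj/val_inj/val_inj.
- move=> s /mapP[m]; rewrite mem_enum !finset.inE => /andP[_ /eqP dm] ->.
  by rewrite size_tuple; split=> //; apply: etrans dm; rewrite mdegE sumnE big_tuple.
move=> s i /mapP[m]; rewrite mem_enum !finset.inE => /andP[mV /eqP dm] -> mi0.
have lt_i : (i < n.+1)%N.
  by rewrite ltnNge; apply: contraTN mi0 => le_i; rewrite nth_default ?size_tuple.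
pose i' := Ordinal lt_i; have miE : nth 0%N (m : seq nat) i = bmnm m i'.
  by rewrite /fun_of_multinom (tnth_nth 0%N).
have mi : (0 < bmnm m i')%N by rewrite -miE.
have U_le : (U_(i') <= m)%MM.
  by apply/mnm_lepP => j; rewrite mnm1E; case: eqP => // <-.
have dm' : mdeg (m - U_(i'))%MM = t by have := congr1 mdeg (submK U_le); rewrite mdegD mdeg1 dm; lia.
have lt' : (mdeg (m - U_(i'))%MM < t.+1)%N by rewrite dm'.
apply/mapP; exists (BMultinom lt').
  rewrite mem_enum !finset.inE /= dm' eqxx andbT.
  apply: contraNN mV => /asboolP[p pU [p0 pl]].
  have hX : ('X_i' : form) * p \is t.+1.-homog.
    have h1 : ('X_i' : form) \is 1.-homog by rewrite dhomogX /= mdeg1.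
    exact: dhomogM h1 (dhomog_is_dhomog p).
  have X0 : ('X_i' : form) != 0 by rewrite -msupp_eq0 msuppX.
  apply/asboolP; exists (DHomog hX); first exact: hUV pU _.
  rewrite /= mulf_neq0 //; split=> //.
  by rewrite mleadM // mleadXm pl /= addmC submK.
apply: (@eq_from_nth _ 0%N).
  by rewrite size_set_nth !size_tuple; lia.
move=> j; rewrite size_set_nth size_tuple => hj.
have lt_j : (j < n.+1)%N by lia.
rewrite nth_set_nth /= miE.
have -> : nth 0%N (multinom_val (m - U_(i'))%MM) j = (m - U_(i'))%MM (Ordinal lt_j).
  by rewrite [RHS](tnth_nth 0%N).
rewrite mnmBE mnm1E -val_eqE /= eq_sym; case: eqP => [jE|_].
  by rewrite subn1; congr (_ .-1); congr (bmnm m _); apply: val_inj.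
by rewrite subn0 /fun_of_multinom (tnth_nth 0%N).
Qed.

End Macaulay.

(** * The projective Nullstellensatz *)

Lemma dependent_mod (K : fieldType) (vT : vectType K) (U : {vspace vT}) k
    (w : 'I_k -> vT) : (\dim {: vT} - \dim U < k)%N ->
  exists2 c : 'I_k -> K, (exists i, c i != 0) & \sum_i c i *: w i \in U.
Proof.
move=> ltk; apply: contrapT => H.
have hind (c : 'I_k -> K) : \sum_i c i *: w i \in U -> forall i, c i = 0.
  by move=> cU i; apply/eqP/contraT => ci; case: H; exists c => //; exists i.
pose X := [tuple w i | i < k].
have XE (c : 'I_k -> K) : \sum_(i < k) c i *: X`_i = \sum_i c i *: w i.
  by apply: eq_bigr => i _; rewrite (nth_map i) ?size_enum_ord // nth_ord_enum.
have frX : free X.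
  by apply/freeP => c; rewrite XE => c0; apply: hind; rewrite c0 mem0v.
have XU : (<<X>> :&: U)%VS = 0%VS.
  apply/eqP; rewrite -subv0; apply/subvP => v /memv_capP[vX vU]; rewrite memv0.
  have vE : v = \sum_i coord X i v *: w i by rewrite [LHS](coord_span vX) XE.
  have c0 : forall i, coord X i v = 0 by apply: hind; rewrite -vE.
  by rewrite vE big1 // => i _; rewrite c0 scale0r.
have := dimvS (subvf (<<X>> + U)%VS).
rewrite dimv_disjoint_sum //; move: frX; rewrite /free size_tuple => /eqP ->.
by move: ltk; lia.
Qed.

Section Nullstellensatz.
Variables (n : nat) (K : fieldType).
Local Notation form := {mpoly K[n.+1]}.
Implicit Type J : set form.

Lemma gid_sum J e (I : eqType) (r : seq I) (F : I -> form) : gideal J ->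
    (forall i, i \in r -> F i \is e.-homog /\ J (F i)) ->
  J (\sum_(i <- r) F i).
Proof.
move=> gJ; elim: r => [|i r IHr] h; first by rewrite big_nil; apply: gid0 gJ.
have [hi Ji] := h i (mem_head _ _).
have h' j : j \in r -> F j \is e.-homog /\ J (F j) by move=> jr; apply: h; rewrite in_cons jr orbT.
rewrite big_cons; apply: (gidD gJ (e := e)) => //; last exact: IHr.
by rewrite big_seq; apply: rpred_sum => j /h' [].
Qed.

Lemma gid_monomials J t (p : form) : gideal J ->
    (forall m : 'X_{1..n.+1}, mdeg m = t -> J 'X_[m]) ->
  p \is t.-homog -> J p.
Proof.
move=> gJ hm /dhomogP hp; rewrite [p]mpolyE; apply: (gid_sum (e := t)) => // m /hp mt.
by split; [apply: rpredZ; rewrite dhomogX mt | apply: gidZ gJ (hm _ mt)].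
Qed.

Lemma mnm_split (m : 'X_{1..n.+1}) s t : mdeg m = (s + t)%N ->
  exists m1 m2 : 'X_{1..n.+1}, [/\ m = (m1 + m2)%MM, mdeg m1 = s & mdeg m2 = t].
Proof.
elim: s m => [|s IHs] m dm.
  by exists 0%MM, m; rewrite add0m mdeg0; split.
have [i mi] : exists i, (0 < m i)%N.
  apply: contrapT => h; move: dm; rewrite mdegE big1 // => i _.
  by apply/eqP; rewrite -leqn0 leqNgt; apply/negP => mi; apply: h; exists i.
have U_le : (U_(i) <= m)%MM by apply/mnm_lepP => j; rewrite mnm1E; case: eqP => // <-.
have [|m1 [m2 [mE d1 d2]]] := IHs (m - U_(i))%MM.
  by have := congr1 mdeg (submK U_le); rewrite mdegD mdeg1 dm; lia.
exists (U_(i) + m1)%MM, m2; split=> //; last by rewrite mdegD mdeg1 d1.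
by rewrite -addmA -mE addmC submK.
Qed.

(* The homogeneous elements of the ideal generated by [J] and the form [f] of
   degree [k]. *)
Definition adjoin J k (f : form) : set form := [set p : form | J p \/
  exists e (q r : form), [/\ J q, (q \is (e + k)%N.-homog), r \is e.-homog & p = q + r * f]]%classic.

Lemma adjoin_homog J k f e p : gideal J -> f \is k.-homog -> p \is e.-homog ->
    adjoin J k f p ->
  J p \/ exists e' (q r : form),
    [/\ e = (e' + k)%N, J q, q \is e.-homog, r \is e'.-homog & p = q + r * f].
Proof.
move=> gJ hf hp [?|[e' [q [r [Jq hq hr pE]]]]]; first by left.
have [p0|p0] := eqVneq p 0; first by left; rewrite p0; apply: gid0 gJ.
have eE : e = (e' + k)%N.
  by apply: dhomog_uniq p0 hp _; rewrite pE; apply: rpredD => //; apply: dhomogM.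
by right; exists e', q, r; split; rewrite ?eE.
Qed.

Lemma adjoin_gideal J k f : gideal J -> f \is k.-homog -> gideal (adjoin J k f).
Proof.
move=> gJ hf; split.
- move=> p [/(gid_homog gJ)//|[e [q [r [_ hq hr ->]]]]].
  by exists (e + k)%N; apply: rpredD => //; apply: dhomogM.
- by left; apply: gid0 gJ.
- move=> e p q hp hq /(adjoin_homog gJ hf hp) Jp /(adjoin_homog gJ hf hq) Jq.
  case: Jp => [Jp|[e1 [q1 [r1 [e1E Jq1 hq1 hr1 pE]]]]];
  case: Jq => [Jq|[e2 [q2 [r2 [e2E Jq2 hq2 hr2 qE]]]]].
  + by left; apply: (gidD gJ (e := e)).
  + right; exists e2, (p + q2), r2; rewrite -e2E qE addrA; split=> //; last exact: rpredD.
    exact: (gidD gJ (e := e)).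
  + right; exists e1, (q1 + q), r1; rewrite -e1E pE addrAC; split=> //; last exact: rpredD.
    exact: (gidD gJ (e := e)).
  + have ? : e1 = e2 by apply/eqP; rewrite -(eqn_add2r k) -e1E -e2E.
    subst e2; right; exists e1, (q1 + q2), (r1 + r2).
    rewrite -e1E pE qE mulrDl addrACA; split=> //; try exact: rpredD.
    exact: (gidD gJ (e := e)).
- move=> e p q hq [Jp|[e1 [q1 [r1 [Jq1 hq1 hr1 pE]]]]]; first by left; apply: gidM hq Jp.
  right; exists (e + e1)%N, (q * q1), (q * r1); split.
  + exact: gidM hq Jq1.
  + by rewrite -addnA; apply: dhomogM.
  + exact: dhomogM.
  + by rewrite pE mulrDr mulrA.
Qed.

(** [J] contains no power of the irrelevant ideal. *)
Definition proper_forms J := forall t, exists2 m : 'X_{1..n.+1}, mdeg m = t & ~ J 'X_[m].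

Lemma exists_maximal J0 : gideal J0 -> proper_forms J0 ->
  exists M : set form, [/\ gideal M, (J0 `<=` M)%classic, proper_forms M &
    forall M' : set form, gideal M' -> proper_forms M' -> (M `<=` M')%classic -> M' = M].
Proof.
move=> gJ0 pJ0.
pose T := {J : set form | [/\ gideal J, (J0 `<=` J)%classic & proper_forms J]}.
pose R (A B : T) : bool := `[< (sval A `<=` sval B)%classic >].
have T0 : [/\ gideal J0, (J0 `<=` J0)%classic & proper_forms J0] by split.
have [||||M Mmax] := @Zorn T R.
- by move=> A; apply/asboolP.
- by move=> A B C /asboolP h1 /asboolP h2; apply/asboolP; apply: subset_trans h2.
- move=> [A PA] [B PB] /asboolP /= h1 /asboolP /= h2; apply: eq_exist.
  exact/seteqP.
- move=> A totA.
  have [[M0 AM0]|nA] := pselect (exists M0, A M0); last first.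
    by exists (exist _ J0 T0) => s As; case: nA; exists s.
  pose U : set form := [set p | exists2 B, A B & sval B p]%classic.
  have leU B C : A B -> A C -> exists2 D, A D & (sval B `<=` sval D)%classic /\ (sval C `<=` sval D)%classic.
    move=> BA CA; case: (totA B C BA CA) => /asboolP h; first by exists C => //; split.
    by exists B => //; split.
  have gB (B : T) : gideal (sval B) by case: (svalP B).
  have PU : [/\ gideal U, (J0 `<=` U)%classic & proper_forms U].
    split.
    + split.
      * by move=> p [B _ Bp]; apply: (gid_homog (gB B)).
      * by exists M0 => //; apply: gid0 (gB M0).
      * move=> e p q hp hq [B BA Bp] [C CA Cq].
        have [D DA [BD CD]] := leU B C BA CA; exists D => //.
        by apply: (gidD (gB D) hp hq); [apply: BD|apply: CD].
      * by move=> e p q hq [B BA Bp]; exists B => //; apply: (gidM (gB B) hq).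
    + by move=> p Jp; exists M0 => //; case: (svalP M0) => _ /(_ p Jp).
    + move=> t; apply: contrapT => H.
      have allU (m : 'X_{1..n.+1}) : mdeg m = t -> U 'X_[m].
        by move=> dm; apply: contrapT => Um; apply: H; exists m.
      (* There are finitely many monomials of degree t, so if the union of the chain contains them
         all, one member does. *)
      have [B BA hB] : exists2 B, A B &
          forall m : 'X_{1..n.+1 < t.+1}, m \in enum (mons n t) -> sval B 'X_[m].
        have : forall m : 'X_{1..n.+1 < t.+1}, m \in enum (mons n t) -> U 'X_[m].
          by move=> m; rewrite mem_enum !finset.inE => /eqP; apply: allU.
        elim: (enum (mons n t)) => [|m s IHs] hs; first by exists M0.
        have [B BA hB] := IHs (fun m' ms => hs m' (mem_behead (s := m :: s) ms)).
        have [C CA hC] := hs m (mem_head _ _).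
        have [D DA [BD CD]] := leU B C BA CA; exists D => // m'.
        by rewrite in_cons => /orP[/eqP ->|/hB]; [apply: CD | apply: BD].
      have [_ _ /(_ t) [m dm]] := svalP B; apply.
      have lt : (mdeg m < t.+1)%N by rewrite dm.
      by apply: (hB (BMultinom lt)); rewrite mem_enum !finset.inE /= dm.
  exists (exist _ U PU) => B BA; apply/asboolP => p Bp /=; by exists B.
case: M Mmax => M [gM J0M pM] /= Mmax; exists M; split=> // M' gM' pM' MM'.
have PM' : [/\ gideal M', (J0 `<=` M')%classic & proper_forms M'].
  by split=> //; apply: subset_trans MM'.
by have /= [] := Mmax (exist _ M' PM') (asboolT MM').
Qed.

Lemma adjoin_not_proper M k f : gideal M -> f \is k.-homog -> ~ M f ->
    (forall M' : set form, gideal M' -> proper_forms M' -> (M `<=` M')%classic -> M' = M) ->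
  exists t, forall p, p \is t.-homog -> adjoin M k f p.
Proof.
move=> gM hf Mf Mmax; have gA := adjoin_gideal gM hf.
apply: contrapT => H.
have pA : proper_forms (adjoin M k f).
  move=> t; apply: contrapT => H'; apply: H; exists t => p hp.
  apply: gid_monomials hp => // m dm; apply: contrapT => Hm.
  by apply: H'; exists m.
have AM := Mmax _ gA pA (fun p Mp => or_introl Mp); apply: Mf; rewrite -AM; right.
exists 0%N, 0, 1; rewrite add0r mul1r; split=> //.
- exact: gid0 gM.
- exact: rpred0.
- exact: dhomog1.
Qed.

(** If neither f nor g is in [M], then M + (f) contains all forms of some degree s and M + (g) all
    those of some degree t. If fg were in [M], multiplying would put all monomials of degree s + t
    in [M]. *)
Lemma maximal_gprime M : gideal M -> proper_forms M ->
    (forall M' : set form, gideal M' -> proper_forms M' -> (M `<=` M')%classic -> M' = M) ->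
  gprime M.
Proof.
move=> gM pM Mmax; split=> //.
  by move=> M1; have [m _] := pM 0%N; apply; rewrite -[X in M X]mulr1; apply: (gidM gM (e := mdeg m)); rewrite ?dhomogX.
move=> k1 k2 f g hf hg Mfg; apply: contrapT => /not_orP[Mf Mg].
have [s hs] := adjoin_not_proper gM hf Mf Mmax.
have [t ht] := adjoin_not_proper gM hg Mg Mmax.
have [m dm] := pM (s + t)%N; apply.
have [m1 [m2 [-> d1 d2]]] := mnm_split dm; rewrite mpolyXD.
have h1 : ('X_[m1] : form) \is s.-homog by rewrite dhomogX /= d1.
have h2 : ('X_[m2] : form) \is t.-homog by rewrite dhomogX /= d2.
have [M1|[e1 [q1 [r1 [sE Mq1 hq1 hr1 E1]]]]] := adjoin_homog gM hf h1 (hs _ h1).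
  by rewrite mulrC; apply: gidM h2 M1.
have [M2|[e2 [q2 [r2 [tE Mq2 hq2 hr2 E2]]]]] := adjoin_homog gM hg h2 (ht _ h2).
  exact: gidM h1 M2.
have -> : 'X_[m1] * 'X_[m2] =
    ('X_[m2] * q1 + (r1 * f) * q2) + (r1 * r2) * (f * g) :> form.
  by rewrite E1 E2; ring.
have hrf : r1 * f \is s.-homog by rewrite sE; apply: dhomogM.
have hX1 : 'X_[m2] * q1 \is (s + t).-homog by rewrite addnC; apply: dhomogM.
have hX2 : (r1 * f) * q2 \is (s + t).-homog by apply: dhomogM.
have hX3 : (r1 * r2) * (f * g) \is (s + t).-homog.
  by rewrite sE tE addnACA; apply: dhomogM; apply: dhomogM.
apply: (gidD gM (e := (s + t)%N)) => //; first exact: rpredD.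
  apply: (gidD gM (e := (s + t)%N)) => //; [exact: gidM h2 Mq1 | exact: gidM hrf Mq2].
by apply: (gidM gM (e := (e1 + e2)%N)) => //; apply: dhomogM.
Qed.

End Nullstellensatz.

(** * Binary forms modulo a prime ideal, and the common zero *)

Section BinaryForms.
Variables (n : nat) (K : closedFieldType).
Local Notation form := {mpoly K[n.+1]}.
Implicit Type J : set form.

Definition homogenize e (f : {poly K}) (x y : form) : form :=
  \sum_(k < e.+1) f`_k *: (x ^+ k * y ^+ (e - k)).

Lemma exp_homog1 (x : form) k : x \is 1.-homog -> x ^+ k \is k.-homog.
Proof. by move=> /(dhomogMn k); rewrite mul1n. Qed.

Lemma binary_monomial_homog e k (x y : form) : (k <= e)%N ->
  x \is 1.-homog -> y \is 1.-homog -> x ^+ k * y ^+ (e - k) \is e.-homog.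
Proof.
move=> ke /(exp_homog1 k) hx /(exp_homog1 (e - k)) hy.
by have := dhomogM hx hy; rewrite subnKC.
Qed.

Lemma homogenize_homog e f x y : x \is 1.-homog -> y \is 1.-homog ->
  homogenize e f x y \is e.-homog.
Proof.
move=> hx hy; apply: rpred_sum => k _; apply: rpredZ.
by apply: binary_monomial_homog; rewrite // -ltnS.
Qed.

Lemma homogenize_factor e (g : {poly K}) r x y : (size g <= e.+1)%N ->
  homogenize e.+1 (('X - r%:P) * g) x y = (x - r *: y) * homogenize e g x y.
Proof.
move=> sg; rewrite /homogenize [RHS]mulrBl !mulr_sumr.
transitivity (\sum_(k < e.+2) ('X * g)`_k *: (x ^+ k * y ^+ (e.+1 - k)) -
              \sum_(k < e.+2) (r * g`_k) *: (x ^+ k * y ^+ (e.+1 - k))).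
  rewrite -sumrB; apply: eq_bigr => k _.
  by rewrite mulrBl coefB mul_polyC coefZ scalerBl.
congr (_ - _).
  rewrite big_ord_recl /= coefXM eqxx scale0r add0r; apply: eq_bigr => k _.
  by rewrite /bump /= coefXM /= add1n subSS exprS -scalerAr mulrA.
rewrite big_ord_recr /= (nth_default _ sg) mulr0 scale0r addr0.
apply: eq_bigr => k _; rewrite subSn ?exprS; last by rewrite -ltnS.
by rewrite -scalerAl -!scalerAr scalerA mulrCA.
Qed.

Lemma gprime_exp J e k (f : form) : gprime J -> f \is k.-homog -> J (f ^+ e) -> J f.
Proof.
move=> [_ J1 Jp] hf; elim: e => [|e IHe]; first by rewrite expr0.
by rewrite exprS => /(Jp _ _ _ _ hf (dhomogMn e hf))[].
Qed.

(* Binary forms over an algebraically closed field split into linear factors. *)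
Lemma gprime_binary J e (f : {poly K}) x y : gprime J ->
    x \is 1.-homog -> y \is 1.-homog -> f != 0 -> (size f <= e.+1)%N ->
  J (homogenize e f x y) -> J y \/ exists r, J (x - r *: y).
Proof.
move=> pJ hx hy; have [gJ J1 Jp] := pJ; elim: e f => [|e IHe] f f0 sf JH.
  have fE : f = (f`_0)%:P by apply: size1_polyC.
  have c0 : f`_0 != 0 by apply: contraNN f0 => /eqP c0; rewrite fE c0.
  case: J1; move: JH; rewrite /homogenize big_ord1 /= expr0 mulr1 => /(gidZ (f`_0)^-1 gJ).
  by rewrite scalerA mulVf // scale1r.
have [s1|s1] := eqVneq (size f) 1%N.
  have fE : f = (f`_0)%:P by apply: size1_polyC; rewrite s1.
  have c0 : f`_0 != 0 by apply: contraNN f0 => /eqP c0; rewrite fE c0.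
  left; apply: (gprime_exp (e := e.+1) pJ hy).
  move: JH; rewrite /homogenize big_ord_recl /= big1 ?addr0.
    move=> /(gidZ (f`_0)^-1 gJ).
    by rewrite scalerA mulVf // scale1r expr0 mul1r subn0.
  by move=> i _; rewrite [f]fE coefC /= scale0r.
have /closed_rootP[r /factor_theorem[g fE]] := s1.
have g0 : g != 0 by apply: contraNN f0 => /eqP g0; rewrite fE g0 mul0r.
have sg : (size g <= e.+1)%N.
  by move: sf; rewrite fE size_Mmonic ?monicXsubC // size_XsubC addn2.
move: JH; rewrite fE mulrC homogenize_factor // => /(Jp 1%N e).
case=> [||Jx|JH]; [|exact: homogenize_homog|by right; exists r|exact: IHe JH].
by apply: rpredB => //; apply: rpredZ.
Qed.

(** Modulo [J] each variable is a multiple of [l], so a monomial reduces to its value at [v] times a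
    power of [l]. *)
Lemma evalX_mod J (v : 'I_n.+1 -> K) (l : form) (m : 'X_{1..n.+1}) : gideal J ->
    l \is 1.-homog -> (forall j, J ('X_j - v j *: l)) ->
  J ('X_[m] - (\prod_i v i ^+ m i) *: l ^+ mdeg m).
Proof.
move=> gJ hl hv; have [d dm] : exists d, mdeg m = d by exists (mdeg m).
elim: d m dm => [|d IHd] m dm.
  have -> : m = 0%MM by apply/eqP; rewrite -mdeg_eq0 dm.
  rewrite mpolyX0 mdeg0 expr0 big1 ?scale1r ?subrr; first exact: gid0 gJ.
  by move=> i _; rewrite mnm0E expr0.
have [m1 [m2 [-> d1 d2]]] := mnm_split (dm : mdeg m = (1 + d)%N).
have [j ->] : exists j, m1 = U_(j)%MM.
  by move/eqP: d1; rewrite mdeg_eq1 => /existsP[j /eqP ->]; exists j.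
rewrite mpolyXD mdegD mdeg1 d2 exprS.
have -> : \prod_i v i ^+ (U_(j) + m2)%MM i = v j * \prod_i v i ^+ m2 i.
  under eq_bigr => i _ do rewrite mnmDE exprD.
  rewrite big_split /= (bigD1 j) //= mnm1E eqxx expr1 big1 ?mulr1 // => i ij.
  by rewrite mnm1E eq_sym (negPf ij) expr0.
set c := \prod_i _.
have -> : 'X_j * 'X_[m2] - (v j * c) *: (l * l ^+ d) =
    'X_j * ('X_[m2] - c *: l ^+ d) + (c *: l ^+ d) * ('X_j - v j *: l) :> form.
  by rewrite -!mul_mpolyC mpolyCM; ring.
have hX : ('X_j : form) \is 1.-homog by rewrite dhomogX /= mdeg1.
have hld := exp_homog1 d hl.
apply: (gidD gJ (e := (1 + d)%N)).
- apply: dhomogM => //; apply: rpredB; last exact: rpredZ.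
  by rewrite dhomogX /= d2.
- by rewrite addnC; apply: dhomogM; [apply: rpredZ|apply: rpredB => //; apply: rpredZ].
- by have := IHd m2 d2; rewrite d2; apply: gidM hX.
- by apply: (gidM gJ (e := d)); [apply: rpredZ | apply: hv].
Qed.

Lemma eval_mod J (v : 'I_n.+1 -> K) (l p : form) t : gideal J ->
    l \is 1.-homog -> (forall j, J ('X_j - v j *: l)) -> p \is t.-homog ->
  J (p - p.@[v] *: l ^+ t).
Proof.
move=> gJ hl hv /dhomogP hp.
have -> : p - p.@[v] *: l ^+ t = \sum_(m <- msupp p)
    p@_m *: ('X_[m] - (\prod_i v i ^+ m i) *: l ^+ t).
  under eq_bigr => m _ do rewrite scalerBr scalerA.
  by rewrite sumrB -scaler_suml -mevalE -mpolyE.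
apply: (gid_sum (e := t)) => // m /hp /= dm; split; last first.
  by apply: gidZ => //; rewrite -dm; apply: evalX_mod.
apply/rpredZ/rpredB; first by rewrite dhomogX /= dm.
by apply: rpredZ; apply: exp_homog1.
Qed.

(* A maximal [M] is prime, and modulo [M] multiplication by some variable [l] is
   eventually surjective, so that the Hilbert function of [M] is bounded.  Hence
   [M] contains a binary form in ['X_j] and [l], and one of its linear factors. *)
Theorem projective_nullstellensatz J0 : gideal J0 -> proper_forms J0 ->
  exists2 v : 'I_n.+1 -> K, (exists i, v i != 0) & forall p, J0 p -> p.@[v] = 0.
Proof.
move=> gJ0 pJ0.
have [M [gM J0M pM Mmax]] := exists_maximal gJ0 pJ0.
have pr := maximal_gprime gM pM Mmax; have [_ M1 Mp] := pr.
have hX j : ('X_j : form) \is 1.-homog by rewrite dhomogX /= mdeg1.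
have [i Mi] : exists i, ~ M 'X_i.
  have [m dm Mm] := pM 1%N; move/eqP: dm; rewrite mdeg_eq1 => /existsP[i /eqP mE].
  by exists i; rewrite -mE.
pose l : form := 'X_i.
have [t0 ht0] := adjoin_not_proper gM (hX i) Mi Mmax.
have full s : (t0 <= 1 + s)%N -> part_adjoin M s (DHomog (hX i)) = fullv.
  move=> ts; apply/eqP; rewrite eqEsubv subvf; apply/subvP => p _.
  have gA := adjoin_gideal gM (hX i).
  have Ap : adjoin M 1 'X_i (p : form).
    apply: (gid_monomials gA _ (dhomog_is_dhomog p)) => m dm.
    have [|m1 [m2 [-> d1 d2]]] := @mnm_split n m t0 (1 + s - t0)%N; first by rewrite dm; lia.
    rewrite mpolyXD mulrC; apply: (gidM gA (e := mdeg m2)); first by rewrite dhomogX.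
    by apply: ht0; rewrite dhomogX /= d1.
  apply/part_adjoinP => //.
  case: (adjoin_homog gM (hX i) (dhomog_is_dhomog p) Ap) => [Mp'|].
    by exists (p : form), 0; split; rewrite ?mulr0 ?addr0 //; apply: dhomog_is_dhomog.
  case=> e [q [r [sE Mq hq hr pE]]].
  have es : e = s by lia.
  subst e; exists q, (DHomog hr); split=> //=.
  by rewrite mulrC.
pose cod s := (\dim {: dhomog n.+1 K s} - \dim (part M s))%N.
have codS s : (t0 <= s.+1)%N -> cod s.+1 = cod s.
  move=> ts; have := dim_part_adjoin s pr (Mi : ~ M (DHomog (hX i) : form)).
  rewrite full // /cod -add1n.
  have := dimvS (subvf (part M s)); have := dimvS (subvf (part M (1 + s))).
  move: (\dim _) (\dim _) (\dim _) (\dim _) => *; lia.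
have cod_const k : cod (t0 + k)%N = cod t0.
  by elim: k => [|k IHk]; rewrite ?addn0 // addnS codS ?IHk; lia.
(* In degree [E] the E + 1 binary monomials in x_j and [l] outnumber the codimension, which is still
   cod t0. *)
pose E := (t0 + cod t0)%N.
have codE : (cod E < E.+1)%N by rewrite cod_const /E; lia.
have lin j : exists r, M ('X_j - r *: l).
  have hk (k : 'I_E.+1) : 'X_j ^+ k * l ^+ (E - k) \is E.-homog.
    by apply: binary_monomial_homog; [rewrite -ltnS | exact: hX | exact: hX].
  have [c [k0 ck0] cM] := dependent_mod (fun k => DHomog (hk k)) codE.
  pose f := \poly_(k < E.+1) (if insub k is Some k' then c k' else 0).
  have fk (k : 'I_E.+1) : f`_k = c k by rewrite coef_poly ltn_ord valK.
  have f0 : f != 0 by apply: contraNneq ck0 => f0; rewrite -fk f0 coef0.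
  suff : M (homogenize E f 'X_j l).
    by case/(gprime_binary pr (hX j) (hX i) f0 (size_poly _ _)).
  move/(partP _ gM): cM; rewrite linear_sum /=.
  by rewrite /homogenize; congr (M _); apply: eq_bigr => k _; rewrite fk.
pose v j := projT1 (cid (lin j)).
have hv j : M ('X_j - v j *: l) by rewrite /v; case: cid.
have vi : v i != 0.
  apply/eqP => vi0; apply: Mi; have := hv i; by rewrite vi0 scale0r subr0.
exists v; first by exists i.
move=> p Jp; have [t hp] := gid_homog gJ0 Jp.
(* Modulo [M], p equals p(v) l^t; with p(v) nonzero, [l] would lie in the prime [M]. *)
apply/eqP/contraT => pv; case: Mi.
apply: (gprime_exp (e := t) pr (hX i)).
have hl := exp_homog1 t (hX i).
have Ml : M (p.@[v] *: l ^+ t).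
  have -> : p.@[v] *: l ^+ t = p + (-1) *: (p - p.@[v] *: l ^+ t).
    by rewrite scaleN1r opprB addrC subrK.
  apply: (gidD gM hp); last 2 first.
  - exact: J0M.
  - exact/(gidZ (-1) gM)/(eval_mod gM (hX i) hv hp).
  by apply: rpredZ; apply: rpredB => //; apply: rpredZ.
by have := gidZ (p.@[v])^-1 gM Ml; rewrite scalerA mulVf // scale1r.
Qed.

End BinaryForms.

(** * Closed subsets of projective space *)

Lemma wf_minimal (T : Type) (R : T -> T -> Prop) (P : T -> Prop) :
  well_founded R -> (exists x, P x) -> exists2 x, P x & forall y, R y x -> ~ P y.
Proof.
move=> wfR [x Px]; apply: contrapT => H.
elim/(well_founded_ind wfR): x Px => x IHx Px; by apply: H; exists x.
Qed.

(** Each next index minimizes [g] on the remaining tail. *)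
Lemma monotone_subsequence (g : nat -> nat) : exists2 phi : nat -> nat,
  (forall i j, i < j -> phi i < phi j)%N &
  forall i j, (i <= j)%N -> (g (phi i) <= g (phi j))%N.
Proof.
have hmin N : exists m, (N <= m)%N /\ forall k, (m <= k)%N -> (g m <= g k)%N.
  have exv : exists v, `[< exists2 m, (N <= m)%N & g m = v >].
    by exists (g N); apply/asboolP; exists N.
  case: (ex_minnP exv) => v /asboolP[m Nm gm] vmin.
  exists m; split=> // k mk; rewrite gm; apply: vmin; apply/asboolP; exists k => //.
  exact: leq_trans mk.
pose next N := projT1 (cid (hmin N)).
have nextP N : (N <= next N)%N /\ forall k, (next N <= k)%N -> (g (next N) <= g k)%N.
  by rewrite /next; case: cid.
pose phi := fix phi i := if i is i'.+1 then next (phi i').+1 else next 0%N.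
have phiS i : (phi i < phi i.+1)%N by have [] := nextP (phi i).+1.
have phi_lt : {homo phi : i j / (i < j)%N} by apply: homo_ltn => //; apply: ltn_trans.
exists phi; first by move=> i j; apply: phi_lt.
move=> i j ij.
have le : (phi i <= phi j)%N by move: ij; rewrite leq_eqVlt => /orP[/eqP -> //|/phi_lt/ltnW].
by case: i {ij} le => [|i] le; [have [_] := nextP 0%N | have [_] := nextP (phi i).+1]; apply.
Qed.

Lemma dickson n (f : nat -> 'X_{1..n}) : exists i j, (i < j)%N /\ (f i <= f j)%MM.
Proof.
have [phi phi_lt hphi] : exists2 phi : nat -> nat, (forall i j, i < j -> phi i < phi j)%N &
    forall k, k \in enum 'I_n -> forall i j, (i <= j)%N -> (f (phi i) k <= f (phi j) k)%N.
  elim: (enum 'I_n) => [|k s [phi phi_lt hphi]]; first by exists id.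
  have [psi psi_lt hpsi] := monotone_subsequence (fun i => f (phi i) k).
  exists (phi \o psi) => [i j ij|k']; first exact/phi_lt/psi_lt.
  rewrite in_cons => /orP[/eqP -> //|ks] i j ij; apply: hphi => //.
  by move: ij; rewrite leq_eqVlt => /orP[/eqP -> //|/psi_lt/ltnW].
exists (phi 0%N), (phi 1%N); split; first exact: phi_lt.
by apply/mnm_lepP => k; apply: hphi; rewrite ?mem_enum.
Qed.

Lemma meval_homog_scale (R : comNzRingType) n e (p : {mpoly R[n]}) (c : R) (v : 'I_n -> R) :
  p \is e.-homog -> p.@[fun i => c * v i] = c ^+ e * p.@[v].
Proof.
move=> /dhomogP hp; rewrite !mevalE mulr_sumr; apply: eq_big_seq => m /hp /= <-.
rewrite mdegE -prodrXr mulrCA; congr (_ * _); rewrite -big_split /=.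
by apply: eq_bigr => i _; rewrite exprMn.
Qed.

Section ProjectiveSets.
Variable n : nat.
Local Notation form := {mpoly algC[n.+1]}.
Local Notation S := (dhomog n.+1 algC).
Local Notation vec := 'rV[algC]_n.+1.
Implicit Types X Y Z : set vec.

Definition vanishing X : set form := [set p : form |
  (exists e, p \is e.-homog) /\ forall v, X v -> p.@[v ord0] = 0]%classic.

Lemma meval_scale e (p : form) (a : algC) (v : vec) : p \is e.-homog ->
  p.@[(a *: v) ord0] = a ^+ e * p.@[v ord0].
Proof.
by move=> hp; rewrite -(meval_homog_scale a _ hp); apply: meval_eq => i; rewrite mxE.
Qed.

Lemma vanishing_gideal X : gideal (vanishing X).
Proof.
split.
- by move=> p [].
- by split=> [|v _]; [exists 0%N; apply: rpred0 | rewrite meval0].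
- move=> e p q hp hq [_ vp] [_ vq]; split; first by exists e; apply: rpredD.
  by move=> v Xv; rewrite mevalD vp ?vq ?addr0.
- move=> e p q hq [[e' hp] vp]; split; first by exists (e + e')%N; apply: dhomogM.
  by move=> v Xv; rewrite mevalM vp ?mulr0.
Qed.

Lemma closed_neq0 X v : zariski_closed X -> X v -> v != 0.
Proof. by move=> [E [_ ->]] []. Qed.

Lemma closedP X v : zariski_closed X -> v != 0 ->
  X v <-> forall p, vanishing X p -> p.@[v ord0] = 0.
Proof.
move=> [E [hE XE]] v0; split=> [Xv p [_]|h]; first exact.
rewrite XE; split=> // p Ep; apply: h; split; first exact: hE.
by move=> w; rewrite XE => -[_]; apply.
Qed.

Lemma closedI_hyper X e (g : form) : zariski_closed X -> g \is e.-homog ->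
  zariski_closed [set v | X v /\ g.@[v ord0] = 0]%classic.
Proof.
move=> [E [hE ->]] hg; exists (E `|` [set g])%classic; split.
  by move=> p [/hE //| ->]; exists e.
apply/seteqP; split=> v /=.
  by case=> -[v0 hv] gv; split=> // p [/hv //| ->].
case=> v0 hv; split; first by split=> // p Ep; apply: hv; left.
by apply: hv; right.
Qed.

Lemma irreducible_gprime X : irreducible_closed X -> gprime (vanishing X).
Proof.
move=> [cX [x Xx] irr]; split; first exact: vanishing_gideal.
  by move=> [_ /(_ x Xx)]; rewrite meval1 => /eqP; rewrite oner_eq0.
move=> d e p q hp hq [_ hpq].
have [|XE|XE] := irr _ _ (closedI_hyper cX hp) (closedI_hyper cX hq).
- apply/seteqP; split=> v /=; last by case=> -[].
  move=> Xv; have /eqP := hpq v Xv; rewrite mevalM mulf_eq0 => /orP[]/eqP ?; [left|right]; done.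
- by left; split; [exists d | rewrite XE => v []].
- by right; split; [exists e | rewrite XE => v []].
Qed.

(** The projective point represented by [z], encoded as the set of all its coordinate vectors. *)
Definition line (z : vec) : set vec := [set v | v != 0 /\ exists a, v = a *: z]%classic.

Lemma proportionalP (v z : vec) : z != 0 ->
  (forall i j, z ord0 i * v ord0 j = z ord0 j * v ord0 i) -> exists a, v = a *: z.
Proof.
move=> z0 h; have [i zi] : exists i, z ord0 i != 0.
  apply: contrapT => H; case/eqP: z0; apply/rowP => i; rewrite mxE.
  by apply/eqP/contraT => zi; case: H; exists i.
exists (v ord0 i / z ord0 i); apply/rowP => j; rewrite mxE.
by rewrite mulrAC; apply: (canRL (mulfK zi)); rewrite mulrC h mulrC.
Qed.

Definition minor (z : vec) i j : form := z ord0 i *: 'X_j - z ord0 j *: 'X_i.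

Lemma minor_homog z i j : minor z i j \is 1.-homog.
Proof. by apply: rpredB; apply: rpredZ; rewrite dhomogX /= mdeg1. Qed.

Lemma minorE z i j (v : vec) : (minor z i j).@[v ord0] = z ord0 i * v ord0 j - z ord0 j * v ord0 i.
Proof. by rewrite mevalB !mevalZ !mevalXU. Qed.

Lemma line_closed z : z != 0 -> zariski_closed (line z).
Proof.
move=> z0; exists [set p | exists i j, p = minor z i j]%classic; split.
  by move=> _ [i [j ->]]; exists 1%N; apply: minor_homog.
apply/seteqP; split=> v [v0 h]; split=> //.
  case: h => a -> _ [i [j ->]]; rewrite minorE !mxE; ring.
apply: proportionalP => // i j; apply/eqP; rewrite -subr_eq0 -minorE; apply/eqP.
by apply: h; exists i, j.
Qed.

Lemma closed_scale X v a : zariski_closed X -> X v -> a != 0 -> X (a *: v).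
Proof.
move=> cX Xv a0; have v0 := closed_neq0 cX Xv.
apply/(closedP cX); first by rewrite scaler_eq0 negb_or a0.
by move=> p [[e hp] vp]; rewrite (meval_scale _ _ hp) vp ?mulr0.
Qed.

Lemma line_irreducible z : z != 0 -> irreducible_closed (line z).
Proof.
move=> z0; have zz : line z z by split=> //; exists 1; rewrite scale1r.
split; [exact: line_closed | by exists z | move=> Y Z cY cZ E].
have sub A : zariski_closed A -> (A `<=` line z)%classic -> A z -> line z = A.
  move=> cA AL Az; apply/seteqP; split=> // v [v0 [a vE]].
  rewrite vE; apply: closed_scale => //; apply: contraNneq v0 => a0.
  by rewrite vE a0 scale0r.
have [Yz|Zz] : (Y `|` Z)%classic z by rewrite -E.
  by left; apply: sub => // v Yv; rewrite E; left.
by right; apply: sub => // v Zv; rewrite E; right.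
Qed.

Definition pfinite X := exists s : seq vec, forall v, X v -> exists2 z, z \in s & line z v.

(* Take [p_k] vanishing on [Z k.+1] but not on [Z k] with minimal leading
   monomial; by minimality no [mlead p_i] divides [mlead p_j] for [i < j]. *)
Lemma closed_dcc (Z : nat -> set vec) : (forall k, zariski_closed (Z k)) ->
  ~ (forall k, (Z k.+1 `<` Z k)%classic).
Proof.
move=> cZ dec.
pose P k m := exists p : form, [/\ vanishing (Z k.+1) p, ~ vanishing (Z k) p & mlead p = m].
have exP k : exists m, P k m.
  have [sub nsub] := dec k; apply: contrapT => H; apply: nsub => v Zv.
  apply/(closedP (cZ k.+1) (closed_neq0 (cZ k) Zv)) => p vp.
  apply: contrapT => pv; apply: H; exists (mlead p), p; split=> //.
  by move=> [_ /(_ v Zv)].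
have minP k := wf_minimal (@ltom_wf n.+1) (exP k).
pose m k := projT1 (cid2 (minP k)).
have mP k : P k (m k) /\ forall m', (m' < m k)%O -> ~ P k m'.
  by rewrite /m; case: cid2.
have antiZ i j : (i <= j)%N -> (Z j `<=` Z i)%classic.
  elim: j => [|j IHj]; first by rewrite leqn0 => /eqP ->.
  rewrite leq_eqVlt => /orP[/eqP -> //|/IHj]; apply: subset_trans.
  by have [] := dec j.
(* Subtracting a multiple of such a [q] would lower the leading monomial of [p] while staying inside
   the ideal of Z k.+1 and outside that of Z k. *)
have nolead k (q : form) : vanishing (Z k) q -> q != 0 -> mlead q <> m k.
  move=> vq q0 qm; have [[p [vp nvp pm]] mmin] := mP k.
  have gk := vanishing_gideal (Z k); have gk1 := vanishing_gideal (Z k.+1).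
  have p0 : p != 0 by apply: contra_notN nvp => /eqP ->; apply: gid0 gk.
  have [[e hp] _] := vp; have [[e' hq] vq'] := vq.
  have ee : e = e' by rewrite -(mlead_dhomog p0 hp) -(mlead_dhomog q0 hq) pm qm.
  subst e'; have lq : mleadc q != 0 by rewrite mleadc_eq0.
  pose c := mleadc p / mleadc q.
  have vq1 : vanishing (Z k.+1) q.
    by split; [exists e | move=> v Zv; apply/vq'/(antiZ k k.+1)].
  have hcq : c *: q \is e.-homog by apply: rpredZ.
  pose p' := p + (- c) *: q.
  have vp' : vanishing (Z k.+1) p'.
    apply: (gidD gk1 hp) => //; last exact: gidZ.
    exact: rpredZ.
  have nvp' : ~ vanishing (Z k) p'.
    move=> bad; apply: nvp; have -> : p = p' + c *: q by rewrite /p' scaleNr subrK.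
    apply: (gidD gk (e := e)) => //; last exact: gidZ.
    by apply: rpredD => //; apply: rpredZ.
  have p'0 : p' != 0 by apply: contra_notN nvp' => /eqP ->; apply: gid0 gk.
  have : P k (mlead p') by exists p'.
  apply: mmin; rewrite lt_neqAle -{2}pm; apply/andP; split.
    apply: contraNneq p'0 => pm'; rewrite -mleadc_eq0 pm' mcoeffD mcoeffZ -pm.
    by rewrite {2}pm -qm /c mulNr divfK // subrr.
  apply: le_trans (mleadD_le _ _) _; rewrite leUx lexx /= pm -qm.
  exact: mleadZ_le.
have [i [j [ij mij]]] := dickson m.
have [[p [vp nvp pm]] _] := mP i.
have gi := vanishing_gideal (Z i).
have p0 : p != 0 by apply: contra_notN nvp => /eqP ->; apply: gid0 gi.
have X0 : 'X_[m j - m i] != 0 :> form by rewrite -msupp_eq0 msuppX.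
apply: (nolead j ('X_[m j - m i] * p)).
- apply: (gidM (vanishing_gideal _) (e := mdeg (m j - m i)%MM)); first by rewrite dhomogX.
  by have [hp vp'] := vp; split=> // v Zv; apply/vp'/(antiZ i.+1 j).
- exact: mulf_neq0.
- by rewrite mleadM // mleadXm pm submK.
Qed.

(* Otherwise, by the descending chain condition, [Y] contains an irreducible
   infinite closed set, which sits strictly between a point and [C]. *)
Lemma proper_closed_pfinite C Y : irreducible_closed C -> ~ irreducible_chain C 2 ->
  zariski_closed Y -> (Y `<=` C)%classic -> Y <> C -> pfinite Y.
Proof.
move=> irrC nochain cY YC neqYC; apply: contrapT => infY.
pose T := {Z : set vec | [/\ zariski_closed Z, (Z `<=` Y)%classic & ~ pfinite Z]}.
have step (A : T) : {B : T | (sval B `<` sval A)%classic}.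
  apply: cid; case: A => Z [cZ ZY infZ] /=.
  have [z Zz] : exists z, Z z.
    by apply: contrapT => H; apply: infZ; exists [::] => v Zv; case: H; exists v.
  have z0 := closed_neq0 cZ Zz.
  have nirr : ~ irreducible_closed Z.
    move=> irrZ; apply: nochain.
    exists (fun i => if i is i'.+1 then if i' is 0%N then Z else C else line z); split.
      have lC : (line z `<=` C)%classic.
        move=> v [v0 [a vE]]; rewrite vE; apply: closed_scale; [by case: irrC|exact/YC/ZY|].
        by apply: contraNneq v0 => a0; rewrite vE a0 scale0r.
      move=> [|[|i]] _; split=> //; first exact: line_irreducible.
      exact: subset_trans YC.
    move=> [|[|i]] //= _; split.
    - move=> v [v0 [a vE]]; rewrite vE; apply: closed_scale => //.
      by apply: contraNneq v0 => a0; rewrite vE a0 scale0r.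
    - by move=> ZL; apply: infZ; exists [:: z] => v /ZL Lv; exists z; rewrite ?mem_head.
    - exact: subset_trans YC.
    - by move=> CZ; apply: neqYC; apply/seteqP; split=> // v /CZ /ZY.
  have [A [B [cA [cB [ZE [ZA ZB]]]]]] : exists A B, zariski_closed A /\ zariski_closed B /\
      Z = (A `|` B)%classic /\ Z <> A /\ Z <> B.
    apply: contrapT => H; apply: nirr; split=> //; first by exists z.
    move=> A B cA cB ZE; apply: contrapT => /not_orP[ZA ZB].
    by apply: H; exists A, B; do !split.
  have prop D : zariski_closed D -> (D `<=` Z)%classic -> Z <> D -> ~ pfinite D ->
      exists B : T, (sval B `<` Z)%classic.
    move=> cD DZ ZD infD.
    have PD : [/\ zariski_closed D, (D `<=` Y)%classic & ~ pfinite D].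
      by split=> //; apply: subset_trans ZY.
    exists (exist _ D PD); split=> //= ZsD; apply: ZD; exact/seteqP.
  have [finA|infA] := pselect (pfinite A); last first.
    by apply: (prop A) => //; rewrite ZE => v; left.
  apply: (prop B) => //; first by rewrite ZE => v; right.
  move=> [s2 h2]; have [s1 h1] := finA; apply: infZ; exists (s1 ++ s2) => v.
  by rewrite ZE => -[/h1|/h2] [z' zs Lz]; exists z' => //; rewrite mem_cat zs ?orbT.
have PY : [/\ zariski_closed Y, (Y `<=` Y)%classic & ~ pfinite Y] by split.
have [f [_ fdec]] := dependent_choice step (exist _ Y PY).
apply: (@closed_dcc (fun k => sval (f k))) => // k; by case: (svalP (f k)).
Qed.

End ProjectiveSets.

(** * Hilbert functions and Bezout bounds *)

(** Surjectivity identifies S_(g+s) / V with S_s modulo the preimage of [V] under multiplication by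
    [l], and this preimage contains [U]. *)
Lemma closed_under_codim (K : fieldType) n g s (U : {vspace dhomog n.+1 K s})
    (V : {vspace dhomog n.+1 K (g + s)}) (l : dhomog n.+1 K g) :
    (l : {mpoly K[n.+1]}) != 0 ->
    (forall p, p \in U -> hmul l p \in V) ->
    (V + linfun (@hmul n K g s l) @: fullv = fullv)%VS ->
  (\dim {: dhomog n.+1 K (g + s)} - \dim V <= \dim {: dhomog n.+1 K s} - \dim U)%N.
Proof.
move=> l0 UV full.
have kl W : (W :&: lker (linfun (@hmul n K g s l)))%VS = 0%VS.
  by rewrite lker_hmul // capv0.
have := dimv_sum_cap V (linfun (@hmul n K g s l) @: fullv)%VS.
rewrite full (limg_dim_eq (kl fullv)) => dimE.
have nat_codim (k1 k2 v u c : nat) : (k1 + c = v + k2 -> u <= c -> u <= k2 -> k1 - v <= k2 - u)%N.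
  by lia.
apply: nat_codim dimE _ (dimvS (subvf U)).
rewrite -(limg_dim_eq (kl U)); apply/dimvS/subvP => _ /memv_imgP[p pU ->].
by rewrite memv_cap memv_img ?memvf // andbT lfunE; apply: UV.
Qed.

Lemma poly_nonroot (K : numDomainType) (p : {poly K}) : p != 0 -> exists x, ~~ root p x.
Proof.
move=> p0; pose s : seq K := [seq k%:R | k <- iota 0 (size p)].
have us : uniq s by rewrite map_inj_uniq ?iota_uniq // => i j /eqP; rewrite eqr_nat => /eqP.
have [/(max_poly_roots p0)/(_ us)|] := boolP (all (root p) s).
  by rewrite size_map size_iota ltnn.
by rewrite -has_predC => /hasP[x _ px]; exists x.
Qed.

Section Hilbert.
Variable n : nat.
Local Notation form := {mpoly algC[n.+1]}.
Local Notation S := (dhomog n.+1 algC).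
Local Notation vec := 'rV[algC]_n.+1.
Implicit Types X Y Z : set vec.

(** Take the coefficients of [l] on the moment curve (1, x, ..., x^n): each z gives a nonzero
    polynomial in x, and some x is a root of none of them. *)
Lemma avoiding_hyperplane (s : seq vec) : (forall z, z \in s -> z != 0) ->
  exists2 l : form, l \is 1.-homog & forall z, z \in s -> l.@[z ord0] != 0.
Proof.
move=> hs; pose f (z : vec) : {poly algC} := \poly_(i < n.+1) z ord0 (inord i).
have f0 z : z \in s -> f z != 0.
  move=> /hs; apply: contraNneq => fz; apply/eqP/rowP => i; rewrite mxE.
  by have := congr1 (fun q : {poly algC} => q`_i) fz; rewrite coef_poly ltn_ord inord_val coef0.
have [x hx] : exists x, ~~ root (\prod_(z <- s) f z) x.
  apply: poly_nonroot; elim: s f0 {hs} => [|z s IHs] f0; first by rewrite big_nil oner_eq0.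
  rewrite big_cons mulf_neq0 ?f0 ?mem_head // IHs // => w ws.
  by apply: f0; rewrite in_cons ws orbT.
exists (\sum_(i < n.+1) x ^+ i *: 'X_i).
  by apply: rpred_sum => i _; apply: rpredZ; rewrite dhomogX /= mdeg1.
move=> z zs; apply: contraNneq hx => lz; rewrite (big_rem z zs) rootM; apply/orP; left.
apply/rootP; rewrite horner_poly; apply: etrans lz; rewrite raddf_sum /=; apply: eq_bigr => i _.
by rewrite inord_val mevalZ mevalXU mulrC.
Qed.

Definition hilb (J : set form) t := (\dim {: S t} - \dim (part J t))%N.

Lemma hilb_adjoin J g s (G : S g) : gprime J -> ~ J G ->
  hilb J (g + s) = (hilb J s + (\dim {: S (g + s)} - \dim (part_adjoin J s G)))%N.
Proof.
have count (A js jt fs ft : nat) : (A + js = jt + fs -> js <= fs -> jt <= ft ->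
    A <= ft -> ft - jt = (fs - js) + (ft - A))%N by lia.
by move=> pJ JG; apply: count (dim_part_adjoin s pJ JG) _ _ _; apply/dimvS/subvf.
Qed.

Lemma var_homog i : ('X_i : form) \is 1.-homog.
Proof. by rewrite dhomogX /= mdeg1. Qed.

(** [q] is given by an equation because the degrees g + (k + s) and k + (g + s) index different
    types. *)
Lemma part_adjoin_mul J g k s (G : S g) (p : S (g + s)) (q : S (g + (k + s))) (l : form) :
  gideal J -> l \is k.-homog -> p \in part_adjoin J s G ->
  (q : form) = l * (p : form) -> q \in part_adjoin J (k + s) G.
Proof.
move=> gJ hl /(part_adjoinP _ _ gJ)[p' [r [Jp' hp' pE]]] qE.
apply/(part_adjoinP _ _ gJ); exists (l * p'), (DHomog (dhomogM hl (dhomog_is_dhomog r))).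
split; first exact: gidM hl Jp'.
  by have := dhomogM hl hp'; rewrite addnCA.
by rewrite qE pE /= mulrDr mulrCA.
Qed.

Lemma eventually_constant (f : nat -> nat) T : (forall k, (T <= k)%N -> (f k.+1 <= f k)%N) ->
  exists D T', (T <= T')%N /\ forall k, (T' <= k)%N -> f k = D.
Proof.
move=> dec; have exv : exists v, `[< exists2 m, (T <= m)%N & f m = v >].
  by exists (f T); apply/asboolP; exists T.
case: (ex_minnP exv) => v /asboolP[m Tm fm] vmin.
have le k : (m <= k)%N -> (f k <= v)%N.
  elim: k => [|k IHk]; first by rewrite leqn0 => /eqP m0; rewrite -fm m0.
  rewrite leq_eqVlt => /orP[/eqP <-|]; first by rewrite fm.
  by rewrite ltnS => mk; apply: leq_trans (IHk mk); apply: dec; apply: leq_trans mk.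
exists v, m; split=> // k mk; apply/eqP; rewrite eqn_leq le // vmin //.
by apply/asboolP; exists k => //; apply: leq_trans mk.
Qed.

Lemma nonvanishing_var X : zariski_closed X -> (X !=set0)%classic -> exists i, ~ vanishing X 'X_i.
Proof.
move=> cX [v Xv]; apply: contrapT => H.
case/eqP: (closed_neq0 cX Xv); apply/rowP => i; rewrite mxE.
apply: contrapT => vi; apply: H; exists i => -[_ /(_ v Xv)].
by rewrite mevalXU.
Qed.

Lemma adjoin_full J l k (p : form) : gideal J -> l \is 1.-homog ->
  p \is k.+1.-homog -> adjoin J 1 l p ->
  exists q (r : S k), [/\ J (q : form), q \is k.+1.-homog & p = q + l * r].
Proof.
move=> gJ hl hp /(adjoin_homog gJ hl hp)[Jp|[e [q' [r [eE Jq hq hr ->]]]]].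
  by exists p, 0; rewrite mulr0 addr0.
have ek : e = k by lia.
by subst e; exists q', (DHomog hr); rewrite mulrC.
Qed.

(* The Hilbert function of a hyperplane section is eventually nonincreasing: a
   second hyperplane avoids the finitely many points of the section, so that the
   Nullstellensatz applies to the ideal of both. *)
Lemma hilb_eventually_linear C : irreducible_closed C -> ~ irreducible_chain C 2 ->
  exists D T, forall k, hilb (vanishing C) (T + k) = (hilb (vanishing C) T + D * k)%N.
Proof.
move=> irr nochain; have [cC neC _] := irr.
set J := vanishing C; have pJ : gprime J := irreducible_gprime irr.
have [gJ _ _] := pJ; have [i Ji] := nonvanishing_var cC neC.
have hi := var_homog i.
have cY := closedI_hyper cC hi.
have [s hs] : pfinite [set v | C v /\ ('X_i : form).@[v ord0] = 0]%classic.
  apply: (proper_closed_pfinite irr nochain cY); first by move=> v [].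
  by move=> YC; apply: Ji; split; [exists 1%N | rewrite -YC => v []].
(* The extra vector [const_mx 1] makes [l] nonzero even if the section is empty; zero vectors in [s]
   represent no point. *)
have [l hl ls] : exists2 l : form, l \is 1.-homog &
    forall z, z \in const_mx 1 :: [seq z <- s | z != 0] -> l.@[z ord0] != 0.
  apply: avoiding_hyperplane => z; rewrite in_cons mem_filter => /orP[/eqP ->|/andP[] //].
  by apply/eqP => /rowP/(_ ord0)/eqP; rewrite !mxE oner_eq0.
pose J1 := adjoin J 1 'X_i; have gJ1 : gideal J1 := adjoin_gideal gJ hi.
pose J2 := adjoin J1 1 l; have gJ2 : gideal J2 := adjoin_gideal gJ1 hl.
have npJ2 : ~ proper_forms J2.
  move=> /(projective_nullstellensatz gJ2)[v [k vk] hv].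
  pose w : vec := \row_j v j.
  have wE p : p.@[w ord0] = p.@[v] by apply: meval_eq => j; rewrite mxE.
  have w0 : w != 0 by apply: contraNneq vk => w0; have := congr1 (fun u : vec => u ord0 k) w0; rewrite !mxE => ->.
  have Cw : C w.
    by apply/(closedP cC w0) => p Jp; rewrite wE; apply: hv; left; left.
  have Xw : ('X_i : form).@[w ord0] = 0.
    rewrite wE; apply: hv; left; right; exists 0%N, 0, 1; rewrite add0r mul1r.
    by split=> //; [apply: gid0 gJ | apply: rpred0 | apply: dhomog1].
  have lw : l.@[w ord0] = 0.
    rewrite wE; apply: hv; right; exists 0%N, 0, 1; rewrite add0r mul1r.
    by split=> //; [apply: gid0 gJ1 | apply: rpred0 | apply: dhomog1].
  have [z zs [_ [c wz]]] := hs w (conj Cw Xw).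
  have [c0|c0] := eqVneq c 0; first by case/eqP: w0; rewrite wz c0 scale0r.
  have z0 : z != 0 by apply: contraNneq w0 => z0; rewrite wz z0 scaler0.
  have := ls z; rewrite in_cons mem_filter z0 zs orbT => /(_ isT); apply/negP; rewrite negbK.
  by move: lw; rewrite wz (meval_scale _ _ hl) expr1 => /eqP; rewrite mulf_eq0 (negPf c0).
have [T hT] : exists T, forall p, p \is T.-homog -> J2 p.
  apply: contrapT => H; apply: npJ2 => t; apply: contrapT => H'; apply: H.
  exists t => p hp; apply: gid_monomials hp => // m dm; apply: contrapT => Hm.
  by apply: H'; exists m.
have hT' t p : (T <= t)%N -> p \is t.-homog -> J2 p.
  move=> Tt hp; apply: gid_monomials hp => // m dm.
  have [|m1 [m2 [-> d1 d2]]] := @mnm_split n m T (t - T)%N; first by rewrite dm; lia.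
  rewrite mpolyXD mulrC; apply: (gidM gJ2 (e := mdeg m2)); first by rewrite dhomogX.
  by apply: hT; rewrite dhomogX /= d1.
pose X : S 1 := DHomog hi; pose L : S 1 := DHomog hl.
have JX : ~ J (X : form) by [].
have l0 : (L : form) != 0.
  by apply: contraNneq (ls (const_mx 1) (mem_head _ _)) => /= ->; rewrite meval0.
(* The Hilbert function of the hyperplane section in degree k + 1, which is the first difference at
   k of that of [C]. *)
pose c k := (\dim {: S (1 + k)} - \dim (part_adjoin J k X))%N.
have cS k : (T <= k)%N -> (c k.+1 <= c k)%N.
  move=> Tk; apply: (@closed_under_codim _ n 1 (1 + k) (part_adjoin J k X)
      (part_adjoin J (1 + k) X) L l0).
    by move=> p pU; apply: (part_adjoin_mul gJ hl pU).
  apply/eqP; rewrite eqEsubv subvf; apply/subvP => p _.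
  have Jp : J2 (p : form) by apply: hT' (dhomog_is_dhomog p); lia.
  have [q [r [Jq hq pE]]] := adjoin_full gJ1 hl (dhomog_is_dhomog p) Jp.
  have [q' [r' [Jq' hq' qE]]] := adjoin_full gJ hi hq Jq.
  have -> : p = DHomog hq + linfun (@hmul n _ 1 (1 + k) L) r.
    by apply: val_inj; rewrite lfunE.
  apply: memv_add; last exact/memv_img/memvf.
  by apply/part_adjoinP => //; exists q', r'.
have [D [T' [TT' cD]]] := eventually_constant cS.
exists D, T'; elim=> [|k IHk]; first by rewrite addn0 muln0 addn0.
rewrite addnS -(add1n (T' + k)) (hilb_adjoin (T' + k) pJ JX) IHk.
have -> : (\dim {: S (1 + (T' + k))} - \dim (part_adjoin J (T' + k) X) = D)%N.
  by apply: cD; apply: leq_addr.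
by rewrite mulnS addnA addnAC.
Qed.

End Hilbert.

(** * Hilbert functions of curves: slope, Bezout bound, lower bound *)

Section Curves.
Variable n : nat.
Local Notation form := {mpoly algC[n.+1]}.
Local Notation S := (dhomog n.+1 algC).
Local Notation vec := 'rV[algC]_n.+1.
Implicit Types X Y Z C : set vec.

Lemma irreducible_chain_le C k r : (k <= r)%N -> irreducible_chain C r -> irreducible_chain C k.
Proof.
move=> kr [Z [h1 h2]]; exists Z; split=> i ik; [apply: h1|apply: h2]; exact: leq_trans kr.
Qed.

(** The slope is the leading coefficient of the Hilbert polynomial unless it is 0, a case that
    [curve_slope] excludes when [C] has two points. The r in [has_degree] is at most 1, so r! =
    1. *)
Lemma curve_hilb_linear C d : irreducible_curve C d -> exists D T,
  (forall k, hilb (vanishing C) (T + k) = hilb (vanishing C) T + D * k)%N /\ (D = 0%N \/ D = d).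
Proof.
move=> [irr [_ nochain] [r [P [[chr _] [t0 hP] lcP]]]].
have r1 : (r <= 1)%N.
  by rewrite leqNgt; apply/negP => r2; apply: nochain; apply: irreducible_chain_le chr.
have {}lcP : lead_coef P = d%:R by move: lcP; case: r r1 {chr} => [|[|]] //; rewrite mul1r.
have [D [T hT]] := hilb_eventually_linear irr nochain.
exists D, T; split=> //; have [->|D0] := eqVneq D 0%N; [by left | right].
have gJ := vanishing_gideal C.
have PE t : (t0 <= t)%N -> P.[t%:R] = (hilb (vanishing C) t)%:R.
  move=> /hP[U hU ->].
  have -> : U = part (vanishing C) t.
    apply/vspaceP => p; apply/idP/idP => [/hU Up|/(partP _ gJ)[_ Jp]].
      by apply/(partP _ gJ); split=> //; exists t; apply: dhomog_is_dhomog.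
    exact/hU.
  by rewrite natrB //; apply/dimvS/subvf.
pose Q : {poly rat} := D%:R *: 'X + ((hilb (vanishing C) T)%:R - D%:R * T%:R)%:P.
have PQ : P = Q.
  apply/eqP; rewrite -subr_eq0; apply/contraT => nz.
  pose s : seq rat := [seq (T + t0 + k)%:R | k <- iota 0 (size (P - Q))].
  have us : uniq s.
    rewrite map_inj_uniq ?iota_uniq // => i j /eqP; rewrite eqr_nat eqn_add2l => /eqP //.
  have rs : all (root (P - Q)) s.
    apply/allP => _ /mapP[k _ ->]; rewrite rootE hornerD hornerN PE; last by lia.
    rewrite -addnA hT /Q hornerD hornerZ hornerX hornerC !natrD natrM !natrD.
    by apply/eqP; ring.
  by have := max_poly_roots nz rs us; rewrite size_map size_iota ltnn.
have D0' : D%:R != 0 :> rat by rewrite pnatr_eq0.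
have szQ : size Q = 2%N.
  rewrite /Q size_polyDl size_scale ?size_polyX //.
  exact: leq_ltn_trans (size_polyC_leq1 _) _.
move: lcP; rewrite PQ lead_coefE szQ /Q coefD coefZ coefX coefC mulr1 addr0.
by move/eqP; rewrite eqr_nat => /eqP.
Qed.

Definition pdistinct (s : seq vec) :=
  uniq s /\ {in s &, forall z w : vec, (exists c, z = c *: w) -> z = w}.

Lemma prod_homog1 (I : Type) (s : seq I) (F : I -> form) :
  (forall i, F i \is 1.-homog) -> \prod_(i <- s) F i \is (size s).-homog.
Proof.
move=> hF; elim: s => [|i s IHs]; first by rewrite big_nil; apply: dhomog1.
by rewrite big_cons -[size _]add1n; apply: dhomogM.
Qed.

(** One linear form for each other point, vanishing there but not at [z], padded to degree t by a
    linear form nonzero at [z]. *)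
Lemma separating_form (s : seq vec) (z : vec) t : (forall w, w \in s -> w != 0) ->
    pdistinct s -> z \in s -> (size s <= t.+1)%N ->
  exists p : S t, (p : form).@[z ord0] != 0 /\
     forall w, w \in s -> w != z -> (p : form).@[w ord0] = 0.
Proof.
move=> s0 [us ds] zs szt.
have sep (w : vec) : exists l : form, l \is 1.-homog /\
    (w \in s -> w != z -> l.@[z ord0] != 0 /\ l.@[w ord0] = 0).
  have [/andP[ws wz]|] := boolP ((w \in s) && (w != z)); last first.
    move=> H; exists 0; split; first exact: rpred0.
    by move=> ws wz; rewrite ws wz in H.
  have [i [j ij]] : exists i j, (minor w i j).@[z ord0] != 0.
    apply: contrapT => H; case/eqP: wz; apply/esym; apply: ds => //.
    apply: proportionalP; first exact: s0.
    move=> i j; apply/eqP; rewrite -subr_eq0 -minorE; apply/contraT => ij.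
    by case: H; exists i, j.
  exists (minor w i j); split; first exact: minor_homog.
  by move=> _ _; split=> //; rewrite minorE mulrC subrr.
pose l w := projT1 (cid (sep w)).
have lP w : l w \is 1.-homog /\ (w \in s -> w != z -> (l w).@[z ord0] != 0 /\ (l w).@[w ord0] = 0).
  by rewrite /l; case: cid.
have [m hm mz] : exists2 m : form, m \is 1.-homog & m.@[z ord0] != 0.
  have [|m hm mz] := @avoiding_hyperplane n [:: z]; last by exists m => //; apply: mz; rewrite mem_head.
  by move=> w; rewrite inE => /eqP ->; apply: s0.
have hp : (\prod_(w <- rem z s) l w) * m ^+ (t - size (rem z s)) \is t.-homog.
  have := dhomogM (prod_homog1 (rem z s) (fun w => (lP w).1)) (exp_homog1 (t - size (rem z s)) hm).
  rewrite subnKC // size_rem // -ltnS prednK //.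
  by case: (s) zs.
exists (DHomog hp); split=> [|w ws wz] /=.
  rewrite mevalM rmorphXn mulf_neq0 ?expf_neq0 // rmorph_prod /=.
  rewrite prodf_seq_neq0; apply/allP => w; rewrite mem_rem_uniq // inE => /andP[wz ws].
  by have [_ /(_ ws wz)[]] := lP w.
have wr : w \in rem z s by rewrite mem_rem_uniq // inE wz.
rewrite (big_rem w) //= !mevalM; have [_ /(_ ws wz)[_ ->]] := lP w.
by rewrite !mul0r.
Qed.

(** The separating forms show that the points impose independent conditions. *)
Lemma points_codim (s : seq vec) t (U : {vspace S t}) : (forall w, w \in s -> w != 0) ->
    pdistinct s -> (size s <= t.+1)%N ->
    (forall p z, p \in U -> z \in s -> (p : form).@[z ord0] = 0) ->
  (size s <= \dim {: S t} - \dim U)%N.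
Proof.
move=> s0 ds szt hU; rewrite leqNgt; apply/negP => lt.
have zs (i : 'I_(size s)) : nth 0 s i \in s by apply: mem_nth.
pose p i := projT1 (cid (separating_form s0 ds (zs i) szt)).
have pP (i : 'I_(size s)) : (p i : form).@[(nth 0 s i) ord0] != 0 /\
    forall w, w \in s -> w != nth 0 s i -> (p i : form).@[w ord0] = 0.
  by rewrite /p; case: cid.
have [c [i ci] cU] := dependent_mod p lt.
have := hU _ _ cU (zs i); rewrite linear_sum /= raddf_sum /= (bigD1 i) //= big1 ?addr0.
  by move/eqP; rewrite mevalZ mulf_eq0 (negPf ci); have [/negPf -> _] := pP i.
move=> j ji; rewrite mevalZ; have [_ ->] := pP j; rewrite ?mulr0 //.
by have [us _] := ds; rewrite nth_uniq // eq_sym.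
Qed.

(** In high degree the ideal (J, G) has codimension D g, the growth of the Hilbert function over g
    steps, and the common zeros impose independent conditions on it. *)
Lemma hilb_bezout C D T g (G : form) (s : seq vec) : irreducible_closed C ->
    (forall k, hilb (vanishing C) (T + k) = hilb (vanishing C) T + D * k)%N ->
    G \is g.-homog -> ~ vanishing C G ->
    (forall z, z \in s -> C z /\ G.@[z ord0] = 0) -> pdistinct s ->
  (size s <= D * g)%N.
Proof.
move=> irr hT hG JG hs ds; have pJ := irreducible_gprime irr.
have [cC _ _] := irr; have gJ := vanishing_gideal C.
have s0 z : z \in s -> z != 0 by move=> /hs[/(closed_neq0 cC)].
pose k := (T + size s)%N.
have h := hilb_adjoin k pJ (JG : ~ vanishing C (DHomog hG : S g)).
have -> : (D * g = \dim {: S (g + k)} - \dim (part_adjoin (vanishing C) k (DHomog hG)))%N.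
  have hgk : hilb (vanishing C) (g + k) = (hilb (vanishing C) T + D * (size s + g))%N.
    by rewrite -hT; congr hilb; rewrite /k; lia.
  move: h; rewrite hgk {1}/k hT mulnDr addnA => /eqP.
  by rewrite eqn_add2l => /eqP.
apply: points_codim => //; first by rewrite /k; lia.
move=> p z /(part_adjoinP _ _ gJ)[q [r [[_ Jq] _ ->]]] /hs[Cz Gz].
by rewrite mevalD mevalM /= Gz mul0r addr0 Jq.
Qed.

(* A linear form through [z] but not [w] has a zero on [C], so [D] is not 0. *)
Lemma curve_slope C D T (z w : vec) : irreducible_closed C ->
    (forall k, hilb (vanishing C) (T + k) = hilb (vanishing C) T + D * k)%N ->
    C z -> C w -> ~ (exists c, w = c *: z) -> (0 < D)%N.
Proof.
move=> irr hT Cz Cw nprop; have [cC _ _] := irr.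
have z0 := closed_neq0 cC Cz.
have [i [j ij]] : exists i j, (minor z i j).@[w ord0] != 0.
  apply: contrapT => H; apply: nprop; apply: proportionalP => // i j.
  apply/eqP; rewrite -subr_eq0 -minorE; apply/contraT => ij.
  by case: H; exists i, j.
have := @hilb_bezout C D T 1 (minor z i j) [:: z] irr hT (minor_homog _ _ _).
rewrite muln1; apply; last by split=> // u v; rewrite !inE => /eqP -> /eqP ->.
- by case=> _ /(_ w Cw) /eqP; apply/negP.
- by move=> u; rewrite inE => /eqP ->; split=> //; rewrite minorE mulrC subrr.
Qed.

(* If the first difference were below [d] at some [k >= d - 1], it would stay
   below [d] forever by Macaulay's bound. *)
Lemma hilb_lower C d T : irreducible_closed C ->
    (forall k, hilb (vanishing C) (T + k) = hilb (vanishing C) T + d * k)%N ->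
  forall t, (d * (t - d) <= hilb (vanishing C) t)%N.
Proof.
move=> irr hT; have [cC neC _] := irr; have pJ := irreducible_gprime irr.
have gJ := vanishing_gideal C.
have [i Ji] := nonvanishing_var cC neC.
set J := vanishing C in hT pJ gJ Ji *.
pose X : S 1 := DHomog (var_homog i).
pose c k := (\dim {: S (1 + k)} - \dim (part_adjoin J k X))%N.
have hS k : hilb J k.+1 = (hilb J k + c k)%N.
  exact: (hilb_adjoin k pJ (Ji : ~ J (X : form))).
have cS k : (c k <= k.+1)%N -> (c k.+1 <= c k)%N.
  move=> ck; apply: (@codim_antitone n _ (1 + k) (part_adjoin J k X)
     (part_adjoin J (1 + k) X) _ ck) => p q j pU qE.
  exact: (part_adjoin_mul gJ (var_homog j) pU qE).
have cT k : c (T + k)%N = d.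
  have := hS (T + k)%N; rewrite -addnS !hT mulnS => /eqP.
  by rewrite [(d + _)%N]addnC addnA eqn_add2l => /eqP.
have cd k : (d <= k.+1)%N -> (d <= c k)%N.
  move=> dk; rewrite leqNgt; apply/negP => lt.
  have dec m : (c (k + m) < d)%N.
    elim: m => [|m IHm]; first by rewrite addn0.
    rewrite addnS; apply: (leq_ltn_trans _ IHm); apply: cS; lia.
  by have := dec T; rewrite addnC cT ltnn.
move=> t; have [td|dt] := leqP t d; first by rewrite (eqP (td : (t - d == 0)%N)) muln0.
rewrite -[X in hilb J X](subnKC (ltnW dt)); elim: (t - d)%N => [|k IHk].
  by rewrite muln0.
rewrite addnS hS mulnS addnC; apply: leq_add => //; apply: cd.
by rewrite -addnS leq_addr.
Qed.

(** Take monomials that lead no form of the ideal: a nontrivial combination has one of them as its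
    leading monomial. *)
Lemma standard_monomials C t h : (h <= hilb (vanishing C) t)%N ->
  exists mon : 'I_h -> 'X_{1..n.+1}, [/\ injective mon, forall i, mdeg (mon i) = t &
    forall c : 'I_h -> algC, (exists i, c i != 0) ->
      ~ vanishing C (\sum_i c i *: 'X_[mon i])].
Proof.
rewrite /hilb -card_stds; set U := part _ _; set A := _ :\: _ => hA.
pose mon (i : 'I_h) : 'X_{1..n.+1} := bmnm (enum_val (widen_ord hA i)).
have mon_inj : injective mon.
  by move=> i j /val_inj /enum_val_inj /(congr1 val) /= ?; apply: val_inj.
have monA i : enum_val (widen_ord hA i) \in A by apply: enum_valP.
have hmon i : mdeg (mon i) = t by have := monA i; rewrite !finset.inE => /andP[_ /eqP].
have gJ := vanishing_gideal C.
exists mon; split=> // c [i0 ci0] Jp; set p := \sum_i _ in Jp.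
have pE m : p@_m = \sum_i c i * (mon i == m)%:R.
  by rewrite raddf_sum /=; apply: eq_bigr => i _; rewrite mcoeffZ mcoeffX.
have pmon i : p@_(mon i) = c i.
  rewrite pE (bigD1 i) //= eqxx mulr1 big1 ?addr0 // => j ji.
  by rewrite (inj_eq mon_inj) (negPf ji) mulr0.
have p0 : p != 0 by apply: contraNneq ci0 => p0; rewrite -pmon p0 mcoeff0.
have hp : p \is t.-homog by apply: rpred_sum => i _; apply: rpredZ; rewrite dhomogX /= hmon.
have [i li] : exists i, mon i = mlead p.
  apply: contrapT => H; move: p0; rewrite -mleadc_eq0 pE big1 ?eqxx // => i _.
  by case: eqP => [E|_]; [case: H; exists i | rewrite mulr0].
have := monA i; rewrite finset.inE => /andP[+ _]; rewrite finset.inE => /asboolP; apply.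
by exists (DHomog hp); [apply/(partP _ gJ) | split].
Qed.

End Curves.

(** * A small prime not dividing a given integer *)

(** With m = (c + 1)^2 and r >= 2 m, the last r - m factors of r! give r! >= m^(r - m) >= (c +
    1)^r. *)
Lemma expn_lt_fact c r : (2 * c.+1 ^ 2 <= r)%N -> (c ^ r < r`!)%N.
Proof.
pose m := (c.+1 ^ 2)%N => hr.
have mfact k : (m ^ k <= (m + k)`!)%N.
  elim: k => [|k IHk]; first by rewrite expn0 addn0 fact_gt0.
  rewrite addnS factS expnS; apply: leq_mul IHk; lia.
have mr : (2 * m <= r)%N by [].
have := mfact (r - m)%N; rewrite subnKC; last by lia.
apply: leq_trans; rewrite /m -expnM.
have m0 : (0 < m)%N by rewrite expn_gt0.
apply: (@leq_trans (c.+1 ^ r)); first by rewrite ltn_exp2r //; lia.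
by apply: leq_pexp2l => //; lia.
Qed.

Lemma square_part m : (0 < m)%N -> exists k s : nat,
  [/\ (0 < k)%N, m = (s * k ^ 2)%N & forall p, prime p -> ~~ (p ^ 2 %| s)%N].
Proof.
elim: m {-2}m (leqnn m) => [|M IHM] m mM m0; first by lia.
have [[p [pp pm]]|H] := pselect (exists p, prime p /\ (p ^ 2 %| m)%N); last first.
  exists 1%N, m; split=> // [|p pp]; first by rewrite exp1n muln1.
  by apply/negP => pm; apply: H; exists p.
have p1 := prime_gt1 pp.
case/dvdnP: pm => m' mE.
have m'0 : (0 < m')%N by case: m' mE => // mE; rewrite mE in m0.
have [|k [s [k0 m'E hs]]] := IHM m' _ m'0.
  have : (4 <= p ^ 2)%N by rewrite -[4%N]/(2 ^ 2)%N leq_exp2r.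
  by nia.
exists (p * k)%N, s; split=> //; first by rewrite muln_gt0 k0 andbT; lia.
by rewrite mE m'E expnMn; lia.
Qed.

Lemma squarefree_prod s : (0 < s)%N -> (forall p, prime p -> ~~ (p ^ 2 %| s)%N) ->
  s = (\prod_(p <- primes s) p)%N.
Proof.
move=> s0 sf; rewrite {1}(prod_prime_decomp s0) prime_decompE big_map.
apply: eq_big_seq => p; rewrite mem_primes => /and3P[pp _ ps] /=.
suff -> : logn p s = 1%N by rewrite expn1.
apply/eqP; rewrite eqn_leq -[(0 < _)%N](pfactor_dvdn 1) // expn1 ps andbT leqNgt.
by apply: contraNN (sf p pp); rewrite pfactor_dvdn.
Qed.

Lemma sorted_nth_ge (s : seq nat) : sorted ltn s -> all (leq 1) s ->
  forall i, (i < size s)%N -> (i.+1 <= nth 0 s i)%N.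
Proof.
move=> ss s1; elim=> [|i IHi] hi; first by have /allP := s1; apply; apply: mem_nth.
apply: leq_ltn_trans (IHi (ltnW hi)) _.
by have := sorted_ltn_nth ltn_trans 0%N ss; apply; rewrite ?inE //= ltnW.
Qed.

Lemma fact_le_primes v : (0 < v)%N -> ((size (primes v))`! <= v)%N.
Proof.
move=> v0; rewrite {2}(prod_prime_decomp v0) prime_decompE big_map.
apply: (@leq_trans (\prod_(p <- primes v) p)%N); last first.
  rewrite [X in (X <= _)%N]big_seq [X in (_ <= X)%N]big_seq; apply: leq_prod => p.
  rewrite mem_primes => /and3P[pp _ pv] /=.
  rewrite -[X in (X <= _)%N]expn1 leq_exp2l ?prime_gt1 //.
  by rewrite -(pfactor_dvdn 1) // expn1.
have h i := @sorted_nth_ge (primes v) (sorted_primes v) _ i.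
rewrite (big_nth 0%N) big_mkord fact_prod big_add1 big_mkord; apply: leq_prod => i _.
apply: h => //; apply/allP => p; rewrite mem_primes => /andP[pp _]; exact: prime_gt0.
Qed.

(* Erdos: each [m <= L] is [s * k ^ 2] with [s] a product of distinct primes,
   so [L <= 2 ^ r * sqrt L] where [r] is the number of primes up to [L]. *)
Lemma card_primes_ge v L : (0 < v)%N ->
  (forall p, prime p -> (p <= L)%N -> (p %| v)%N) -> (L <= 4 ^ size (primes v))%N.
Proof.
move=> v0 hv; set r := size _.
have [->//|L0] := posnP L.
have exK : exists k, (k ^ 2 <= L)%N by exists 0%N.
have ubK k : (k ^ 2 <= L)%N -> (k <= L)%N by apply: leq_trans; case: k => // k; lia.
case: (ex_maxnP exK ubK) => K KL LK.
pose f (bk : (r.-tuple bool) * 'I_K) : nat :=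
  ((\prod_(p <- mask bk.1 (primes v)) p) * bk.2.+1 ^ 2)%N.
have sub : {subset iota 1 L <= [seq f bk | bk <- enum {: r.-tuple bool * 'I_K}]}.
  move=> m; rewrite mem_iota add1n ltnS => /andP[m0 mL].
  have [k [s [k0 mE sf]]] := square_part m0.
  have s0 : (0 < s)%N by case: s mE {sf} => // mE; rewrite mE in m0.
  have kK : (k.-1 < K)%N.
    rewrite prednK //; apply: LK; apply: leq_trans mL; rewrite mE.
    by rewrite leq_pmull.
  have sz : size [seq p \in primes s | p <- primes v] == r by rewrite size_map.
  apply/mapP; exists (Tuple sz, Ordinal kK); first by rewrite mem_enum.
  rewrite /f /= prednK // -filter_mask {1}mE {1}(squarefree_prod s0 sf).
  congr (_ * _)%N; congr bigop.
  apply: (@irr_sorted_eq _ ltn); [exact: ltn_trans|exact: ltnn|exact: sorted_primes| |].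
    exact/sorted_filter/sorted_primes/ltn_trans.
  move=> p; rewrite mem_filter; apply/idP/idP => [ps|/andP[]//]; rewrite ps /=.
  move: ps; rewrite !mem_primes => /and3P[pp _ ps]; rewrite pp v0 /= hv //.
  apply: leq_trans mL; apply: dvdn_leq => //.
  by rewrite mE dvdn_mulr.
have := uniq_leq_size (iota_uniq _ _) sub.
rewrite size_iota size_map -cardE card_prod card_tuple card_bool card_ord => h.
have h2 : (L * L <= 4 ^ r * L)%N.
  apply: leq_trans (leq_mul h h) _.
  have -> : (2 ^ r * K * (2 ^ r * K) = 4 ^ r * K ^ 2)%N.
    by rewrite -[4%N]/(2 * 2)%N expnMn -mulnn mulnACA.
  by rewrite leq_mul2l KL orbT.
by move: h2; rewrite leq_pmul2r.
Qed.

(** Otherwise v has r distinct prime factors with L <= 4^r, so that r! <= v <= L^K <= (4^K)^r. This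
    fails for large r, and a large L forces r to be large. *)
Lemma small_nondivisor K : exists L0 : nat, forall L v, (L0 <= L)%N -> (0 < v)%N ->
  (v <= L ^ K)%N -> exists p, [/\ prime p, (p <= L)%N & ~~ (p %| v)%N].
Proof.
pose c := (4 ^ K)%N; exists (4 ^ (2 * c.+1 ^ 2)).+1 => L v L0L v0 vL.
apply: contrapT => H.
have hv p : prime p -> (p <= L)%N -> (p %| v)%N.
  by move=> pp pL; apply/negPn/negP => pv; apply: H; exists p.
have h1 := card_primes_ge v0 hv; set r := size _ in h1.
have hr : (2 * c.+1 ^ 2 <= r)%N.
  by rewrite -(@leq_exp2l 4) //; apply: leq_trans h1; apply: ltnW.
have := expn_lt_fact hr; rewrite ltnNge => /negP; apply.
apply: leq_trans (fact_le_primes v0) _; apply: (leq_trans vL).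
by rewrite /c -expnM mulnC expnM; case: (K) => // k; rewrite leq_exp2r.
Qed.

(** * Siegel's lemma *)

Lemma pigeonhole (A B : finType) (f : A -> B) (D : {set B}) :
  (forall a, f a \in D) -> (#|D| < #|A|)%N -> exists a b, a != b /\ f a = f b.
Proof.
move=> fD ltDA; have : ~~ injectiveb f.
  apply: contraTN ltDA => /injectiveP finj; rewrite -leqNgt -(fintype.card_image finj).
  by apply: subset_leq_card; apply/fintype.subsetP => _ /fintype.imageP[a _ ->].
by case/injectivePn => a [b ab fab]; exists a, b.
Qed.

(* Pigeonhole on the equations of a maximal independent set of rows, of which
   there are fewer than [s]. *)
Lemma siegel m s E (A : 'M[int]_(m, s)) :
    (forall i j, `|A i j| <= E%:Z) ->
    (exists2 c : 'cV[algC]_s, c != 0 & map_mx intr A *m c = 0) ->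
  exists x : 'cV[int]_s, [/\ x != 0, A *m x = 0 &
    forall j, `|x j ord0| <= ((2 * s * E).+1 ^ s)%:Z].
Proof.
move=> AE [c c0 Ac]; pose M : 'M[algC]_(m, s) := map_mx intr A.
pose r := \rank M; pose H := ((2 * s * E).+1 ^ s)%N.
have lt_rs : (r < s)%N.
  rewrite ltn_neqAle rank_leq_col andbT; apply: contraNN c0 => fullM.
  have /row_fullP[B BM] : row_full M by [].
  by rewrite -[c]mul1mx -BM -mulmxA Ac mulmx0.
have H0 : (0 < H)%N by rewrite expn_gt0.
(* Only r < s rows serve as equations, so the bound does not depend on the number m of rows. [K]
   bounds the entries of A u for u in the box [0, H]^s. *)
pose f := maxrankfun M; pose K := (s * H * E)%N.
pose vec (u : {ffun 'I_s -> 'I_H.+1}) : 'cV[int]_s := \col_j (u j : nat)%:Z.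
have vecE u i : `|(A *m vec u) i ord0| <= K%:Z.
  rewrite mxE; apply: le_trans (ler_norm_sum _ _ _) _.
  have -> : K%:Z = \sum_(j < s) (E * H)%:Z.
    by rewrite sumr_const card_ord -mulr_natl natz -PoszM /K; congr Posz; lia.
  apply: ler_sum => j _; rewrite normrM PoszM; apply: ler_pM => //.
  by rewrite mxE ger0_norm // lez_nat -ltnS.
pose g u : {ffun 'I_r -> 'I_(2 * K).+1} :=
  [ffun i => inord (absz ((A *m vec u) (f i) ord0 + K%:Z))].
have [||u [v [uv guv]]] := @pigeonhole _ _ g [set: _]; first by move=> u; rewrite finset.in_setT.
  (* (2 K + 1)^r <= ((2 s E + 1) H)^r <= H^(r + 1) <= H^s < (H + 1)^s. *)
  rewrite cardsT !card_ffun !card_ord.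
  apply: (@leq_ltn_trans (H ^ s)); last by rewrite ltn_exp2r //; lia.
  apply: (@leq_trans (((2 * s * E).+1 * H) ^ r)).
    case: (r) => // r'; rewrite leq_exp2r // /K; move: H0; case: (H) => // h _; nia.
  rewrite expnMn; apply: (@leq_trans (H * H ^ r)).
    by rewrite leq_mul2r; apply/orP; right; apply: leq_pexp2l => //; apply: ltnW.
  by rewrite -expnS leq_pexp2l.
pose x := vec u - vec v.
have Afx i : (A *m x) (f i) ord0 = 0.
  have := congr1 (fun h : {ffun 'I_r -> 'I_(2 * K).+1} => (h i : nat)) guv.
  have -> : (A *m x) (f i) ord0 = (A *m vec u) (f i) ord0 - (A *m vec v) (f i) ord0.
    by rewrite /x mulmxBr [LHS]mxE [X in _ + X]mxE.
  have := vecE u (f i); have := vecE v (f i); rewrite !ffunE.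
  set a := (A *m vec u) _ _; set b := (A *m vec v) _ _ => hb ha.
  by rewrite !inordK; lia.
have x0 : x != 0.
  apply: contraNneq uv => /eqP; rewrite subr_eq0 => /eqP /colP E'.
  by apply/eqP/ffunP => j; apply/val_inj; have := E' j; rewrite !mxE => -[].
exists x; split=> // [|j]; last first.
  have dist_le (a b c' : nat) : (a <= c')%N -> (b <= c')%N -> `|a%:Z - b%:Z| <= c'%:Z by lia.
  by rewrite /x !mxE; apply: dist_le; rewrite -ltnS.
have Bx : rowsub f M *m map_mx intr x = 0.
  apply/matrixP => i j; rewrite ord1 [RHS]mxE.
  transitivity (((A *m x) (f i) ord0)%:~R : algC); last by rewrite Afx.
  by rewrite !mxE rmorph_sum; apply: eq_bigr => k _; rewrite !mxE rmorphM.
have /submxP[D MD] : (M <= rowsub f M)%MS by rewrite eq_maxrowsub.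
have : map_mx (intr : int -> algC) (A *m x) = 0.
  by rewrite map_mxM -/M MD -mulmxA Bx mulmx0.
move=> /matrixP Ax; apply/matrixP => i j; have := Ax i j; rewrite !mxE => /eqP.
by rewrite intr_eq0 => /eqP.
Qed.

(** * Local parametrization by Hensel's lemma *)

Lemma PoszX (m k : nat) : (m ^ k)%N%:Z = m%:Z ^+ k.
Proof. by elim: k => // k IHk; rewrite expnS exprS PoszM IHk. Qed.

Section Congruences.
Variable d : int.
Implicit Types x y z t : int.

Definition cong x y := (d %| x - y)%Z.

Lemma congxx x : cong x x. Proof. by rewrite /cong subrr dvdz0. Qed.

Lemma cong_sym x y : cong x y -> cong y x.
Proof. by rewrite /cong -opprB rpredN. Qed.

Lemma cong_trans y x z : cong x y -> cong y z -> cong x z.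
Proof. by move=> h1 h2; rewrite /cong -(subrKA y) rpredD. Qed.

Lemma congD x y z t : cong x y -> cong z t -> cong (x + z) (y + t).
Proof. by move=> h1 h2; rewrite /cong opprD addrACA rpredD. Qed.

Lemma congM x y z t : cong x y -> cong z t -> cong (x * z) (y * t).
Proof.
move=> h1 h2; rewrite /cong; have -> : x * z - y * t = (x - y) * z + y * (z - t) by ring.
by rewrite rpredD ?(dvdz_mulr _ h1) ?(dvdz_mull _ h2).
Qed.

Lemma congX x y k : cong x y -> cong (x ^+ k) (y ^+ k).
Proof.
by move=> h; elim: k => [|k IHk]; [exact: congxx | rewrite !exprS; apply: congM].
Qed.

Lemma cong_dvd x y : cong x y -> (d %| x)%Z = (d %| y)%Z.
Proof.
move=> h; apply/idP/idP => h'; first by have := rpredB h' h; rewrite subKr.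
by have := rpredD h h'; rewrite subrK.
Qed.

End Congruences.

Section FormsOverZ.
Variable n : nat.
Local Notation form := {mpoly int[n]}.
Implicit Types (F : form) (v w : 'I_n -> int).

Definition supported (R : nzRingType) (A : pred 'I_n) (G : {mpoly R[n]}) :=
  forall m, m \in msupp G -> forall i, m i != 0%N -> A i.

Lemma meval_cong d A F v w : supported A F -> (forall i, A i -> cong d (v i) (w i)) ->
  cong d F.@[v] F.@[w].
Proof.
move=> sF vw; rewrite !mevalE big_seq [X in cong d _ X]big_seq.
apply: (big_ind2 (cong d)); [exact: congxx | by move=> *; apply: congD | move=> m mF].
apply: congM; first exact: congxx.
apply: (big_ind2 (cong d)); [exact: congxx | by move=> *; apply: congM | move=> i _].
have [->|mi] := eqVneq (m i) 0%N; first by rewrite !expr0 congxx.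
by apply/congX/vw/(sF m mF).
Qed.

Lemma supported_mderiv (R : nzRingType) A (G : {mpoly R[n]}) j :
  supported A G -> supported A G^`M(j).
Proof.
move=> sG m; rewrite mcoeff_msupp mcoeff_deriv => mG i mi.
apply: (sG (m + U_(j))%MM); last by rewrite mnmDE addn_eq0 negb_and mi.
by rewrite mcoeff_msupp; apply: contraNneq mG => ->; rewrite mul0rn.
Qed.

(** The expansion holds for constants and variables and is stable under sums and products, so the
    remainder is an integer, with no factorial in a denominator. *)
Lemma meval_taylor F j v s : exists r,
  F.@[fun i => v i + (i == j)%:R * s] = F.@[v] + s * F^`M(j).@[v] + s ^+ 2 * r.
Proof.
pose v' (i : 'I_n) : int := v i + (i == j)%:R * s.
pose P (G : form) := exists r, G.@[v'] = G.@[v] + s * G^`M(j).@[v] + s ^+ 2 * r.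
have PD G H : P G -> P H -> P (G + H).
  move=> [r rE] [r' r'E]; exists (r + r').
  by rewrite mderivD !mevalD rE r'E; ring.
have PM G H : P G -> P H -> P (G * H).
  move=> [r rE] [r' r'E]; exists (G^`M(j).@[v] * H^`M(j).@[v] +
    (G.@[v] + s * G^`M(j).@[v]) * r' + r * (H.@[v] + s * H^`M(j).@[v]) + s ^+ 2 * r * r').
  by rewrite mderivM mevalD !mevalM rE r'E; ring.
have PC c : P c%:MP by exists 0; rewrite mderivC meval0 !mevalC; ring.
have PX i : P 'X_i.
  exists 0; rewrite mderivX mevalZ !mevalXU /v' mnm1E eq_sym.
  case: eqP => [->|_]; last by rewrite !mul0r; ring.
  have -> : (U_(i) - U_(i) = 0 :> 'X_{1..n})%MM by apply/mnmP => k; rewrite mnmBE subnn mnm0E.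
  by rewrite mpolyX0 meval1; ring.
have PXm (m : 'X_{1..n}) : P 'X_[m].
  rewrite mpolyXE_id; apply: big_ind => [|G H|i _]; [|exact: PM|].
    by rewrite -mpolyC1.
  by elim: (m i) => [|k IHk]; [rewrite expr0 -mpolyC1 | rewrite exprS; apply: PM].
suff : P F by [].
elim/mpolyind: F => [|c m G _ _ PG]; first by rewrite -(mpolyC0).
by apply: PD => //; rewrite -mul_mpolyC; apply: PM.
Qed.

Lemma monomial_bound v (m : 'X_{1..n}) N :
  (forall i, `|v i| <= N%:Z) -> `|('X_[m]).@[v]| <= (N ^ mdeg m)%N%:Z.
Proof.
move=> vN; rewrite mevalX normr_prod PoszX mdegE -prodrXr.
by apply: ler_prod => j _; rewrite normr_ge0 normrX /= lerXn2r ?nnegrE.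
Qed.

End FormsOverZ.

Section LocalParametrization.
Variables (n : nat) (i0 i1 : 'I_n) (p k h : nat) (F : 'I_n -> {mpoly int[n]}).
Hypothesis k_gt0 : (0 < k)%N.
Hypothesis suppF : forall j, supported (pred3 i0 i1 j) (F j).

Local Notation q := (p%:Z ^+ k).
Local Notation Q := (q ^+ h).

(* [y] lies on all the plane projections [F j = 0], at points where the
   [j]-th partial derivative is a [p]-adic unit; [i0] is the coordinate set to 1
   and [i1] is the local parameter. *)
Definition smooth_point (y : 'I_n -> int) := [/\ cong Q (y i0) 1,
  forall j, j != i0 -> j != i1 -> (F j).@[y] = 0 &
  forall j, j != i0 -> j != i1 -> coprimez (F j)^`M(j).@[y] p%:Z].

Definition same_class (y z : 'I_n -> int) :=
  cong q (y i1) (z i1) /\ forall j, cong p%:Z (y j) (z j).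

Lemma p_dvd_q : (p%:Z %| q)%Z.
Proof. exact: (@dvdz_exp2l p%:Z 1 k). Qed.

Lemma coprimez_cong d x y : cong d x y -> coprimez x d -> coprimez y d.
Proof.
move=> /dvdzP[z xy] /coprimezP[[u v] /= E]; apply/coprimezP.
have {}xy : x = y + z * d by rewrite -xy addrC subrK.
by exists (u, u * z + v) => /=; rewrite -E xy; ring.
Qed.

Hypothesis h_gt0 : (0 < h)%N.

Lemma cong_q x y : cong Q x y -> cong q x y.
Proof. by apply: dvdz_trans; exact: (@dvdz_exp2l q 1 h). Qed.

(** Replace coordinate j of y by z j and expand in it: y j - z j times a number congruent modulo p
    to the unit derivative at [z] equals - F_j(v), which q divides because v and z agree modulo q on
    the variables of F_j. *)
Lemma hensel_unique y z j : smooth_point y -> smooth_point z -> same_class y z ->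
  cong q (y j) (z j).
Proof.
move=> [y0 Fy _] [z0 Fz dFz] [yz1 yz].
have yz0 : cong q (y i0) (z i0).
  by apply: cong_trans (cong_q y0) _; apply/cong_sym/cong_q.
have [->//|ji0] := eqVneq j i0; have [->//|ji1] := eqVneq j i1.
pose v i := if i == j then z j else y i.
have [r rE] := meval_taylor (F j) j v (y j - z j).
have yE : (F j).@[fun i => v i + (i == j)%:R * (y j - z j)] = 0.
  rewrite -(Fy j ji0 ji1); apply: meval_eq => i; rewrite /v.
  by case: eqP => [->|_]; rewrite ?mul1r ?mul0r ?addr0 // addrC subrK.
have vz : forall i, pred3 i0 i1 j i -> cong q (v i) (z i).
  move=> i; rewrite /v => /or3P[]/eqP ->; rewrite ?(eq_sym _ j) ?(negPf ji0) ?(negPf ji1) ?eqxx //.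
  exact: congxx.
have qF : (q %| (F j).@[v])%Z.
  by rewrite (cong_dvd (meval_cong (@suppF j) vz)) Fz // dvdz0.
have qdF : cong p%:Z (F j)^`M(j).@[v] (F j)^`M(j).@[z].
  by apply: dvdz_trans p_dvd_q _; apply: meval_cong vz; apply: supported_mderiv.
have qM : (q %| (y j - z j) * ((F j)^`M(j).@[v] + (y j - z j) * r))%Z.
  have -> : (y j - z j) * ((F j)^`M(j).@[v] + (y j - z j) * r) = - (F j).@[v].
    by move: rE; rewrite yE => rE; apply/eqP; rewrite -addr_eq0 [X in _ == X]rE; apply/eqP; ring.
  by rewrite rpredN.
move: qM; rewrite Gauss_dvdzl //.
apply: coprimezXl; rewrite coprimez_sym.
apply: coprimez_cong (dFz j ji0 ji1); apply: cong_sym; rewrite -[X in cong _ _ X]addr0.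
by apply: congD qdF _; rewrite /cong subr0; apply: dvdz_mulr; apply: yz.
Qed.

Lemma coprimez_inv x d : coprimez x d -> exists u, cong d (u * x) 1.
Proof.
move=> /coprimezP[[u v] /= <-]; exists u; rewrite /cong opprD addNKr rpredN.
exact: dvdz_mull.
Qed.

Lemma hornerE_mmap m (g : 'I_m -> {poly int}) (G : {mpoly int[m]}) t :
  (mmap polyC g G).[t] = G.@[fun i => (g i).[t]].
Proof.
elim/mpolyind: G => [|c mm G _ _ IHG]; first by rewrite raddf0 horner0 meval0.
rewrite mmapD hornerD mevalD IHG mmapZ hornerM hornerC mevalZ; congr (_ * _ + _).
rewrite mmapX mevalX /mmap1 horner_prod; apply: eq_bigr => i _.
by rewrite horner_exp.
Qed.

(* Newton iteration, over polynomials in the parameter: each step gains one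
   power of [q]. *)
Lemma hensel_parametrization z j : smooth_point z -> j != i0 -> j != i1 ->
  exists g : {poly int}, forall y, smooth_point y -> same_class y z ->
    cong Q (y j) g.[y i1 - z i1].
Proof.
move=> sz ji0 ji1; have [z0 Fz dFz] := sz.
have qp : coprimez (F j)^`M(j).@[z] q by apply: coprimezXr; apply: dFz.
have [u uE] := coprimez_inv qp.
suff [g hg] : exists g : {poly int}, forall y, smooth_point y -> same_class y z ->
    (q ^+ h.-1.+1 %| y j - g.[y i1 - z i1])%Z.
  by exists g => y sy yz; have := hg y sy yz; rewrite prednK.
have : (h.-1 < h)%N by rewrite prednK.
elim: (h.-1) => [|m IHm] mh.
  exists (z j)%:P => y sy yz; rewrite hornerC expr1.
  exact: hensel_unique.
have [g hg] := IHm (ltnW mh).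
(* The parametrized point, with 0 in the coordinates absent from [F j]. One fixed inverse [u] of the
   derivative at [z] serves all steps, which is enough for linear convergence. *)
pose Y i : {poly int} := if i == i0 then 1 else if i == i1 then 'X + (z i1)%:P
  else if i == j then g else 0.
exists (g - u%:P * mmap polyC Y (F j)) => y sy yz.
have [y0 Fy dFy] := sy; have := hg y sy yz.
set t := y i1 - z i1; rewrite hornerD hornerN hornerM hornerC hornerE_mmap.
set c := g.[t] => qs; pose s := y j - c.
pose v i := if i == j then c else y i.
have [r rE] := meval_taylor (F j) j v s.
have {}rE : 0 = (F j).@[v] + s * (F j)^`M(j).@[v] + s ^+ 2 * r.
  rewrite -rE -(Fy j ji0 ji1); apply: meval_eq => i; rewrite /v /s.
  by case: eqP => [->|_]; rewrite ?mul1r ?mul0r ?addr0 // addrC subrK.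
have yz0 : cong q (y i0) (z i0).
  by apply: cong_trans (cong_q y0) _; apply/cong_sym/cong_q.
have qs1 : (q %| s)%Z by apply: dvdz_trans qs; exact: (@dvdz_exp2l q 1 m.+1).
have vz : forall i, pred3 i0 i1 j i -> cong q (v i) (z i).
  move=> i; rewrite /v => /or3P[]/eqP ->; rewrite ?(eq_sym _ j) ?(negPf ji0) ?(negPf ji1) ?eqxx //.
    by case: yz.
  apply: cong_trans (hensel_unique j sy sz yz).
  by rewrite /cong -opprB rpredN.
have dv : cong q ((F j)^`M(j).@[v]) ((F j)^`M(j).@[z]).
  by apply: meval_cong vz; apply: supported_mderiv.
have Yv : cong Q (F j).@[fun i => (Y i).[t]] (F j).@[v].
  apply: (meval_cong (@suppF j)) => i; rewrite /Y /v => /or3P[]/eqP ->.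
  - by rewrite eqxx hornerC (eq_sym _ j) (negPf ji0); apply: cong_sym.
  - have [->|_] := eqVneq i1 i0.
      by rewrite hornerC (eq_sym _ j) (negPf ji0); apply: cong_sym.
    by rewrite /= eqxx (eq_sym _ j) (negPf ji1) hornerD hornerX hornerC subrK congxx.
  - by rewrite (negPf ji0) (negPf ji1) eqxx congxx.
have mQ : (q ^+ m.+2 %| Q)%Z by apply: dvdz_exp2l.
have ud : (q %| 1 - u * (F j)^`M(j).@[v])%Z.
  rewrite -[1 - _]opprB rpredN; apply: cong_trans uE.
  exact: congM (congxx _ _) dv.
(* The new error consists of a substitution error divisible by Q, a linear term that gains a factor
   q as [u] inverts the derivative modulo q, and a term quadratic in [s]. *)
have -> : y j - (c - u * (F j).@[fun i => (Y i).[t]]) =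
   u * ((F j).@[fun i => (Y i).[t]] - (F j).@[v]) +
   (s * (1 - u * (F j)^`M(j).@[v]) - u * s ^+ 2 * r).
  have -> : (F j).@[v] = - (s * (F j)^`M(j).@[v] + s ^+ 2 * r).
    by apply/eqP; rewrite -addr_eq0 addrA; apply/eqP.
  by rewrite /s; ring.
apply: rpredD; first by apply/dvdz_mull/(dvdz_trans mQ).
apply: rpredB; first by rewrite exprSr; apply: dvdz_mul.
by apply/dvdz_mulr/dvdz_mull; rewrite expr2 exprSr; apply: dvdz_mul.
Qed.

Lemma local_parametrization z : smooth_point z ->
  exists g : 'I_n -> {poly int}, forall y, smooth_point y -> same_class y z ->
    forall j, cong Q (y j) (g j).[y i1 - z i1].
Proof.
move=> sz.
have hg j : exists g : {poly int}, forall y, smooth_point y -> same_class y z ->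
    cong Q (y j) g.[y i1 - z i1].
  have [->|ji0] := eqVneq j i0; first by exists 1 => y [y0 _ _] _; rewrite hornerC.
  have [->|ji1] := eqVneq j i1; last exact: hensel_parametrization.
  by exists ('X + (z i1)%:P) => y _ _; rewrite hornerD hornerX hornerC subrK congxx.
exists (fun j => projT1 (cid (hg j))) => y sy yz j.
by case: cid => g /= ->.
Qed.

End LocalParametrization.

(** * The auxiliary form of a residue class *)

(** The exponents add up to h (h + 1) / 2; squaring avoids the halving. *)
Lemma triangular_expn (q h : nat) : ((\prod_(k < h) q ^ (h - k)) ^ 2 = q ^ (h * h.+1))%N.
Proof.
elim: h => [|h IHh]; first by rewrite big_ord0 exp1n.
rewrite big_ord_recl /= subn0 expnMn.
have -> : (\prod_(i < h) q ^ (h.+1 - bump 0 i) = \prod_(k < h) q ^ (h - k))%N.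
  by apply: eq_bigr => i _; rewrite /bump /= add1n subSS.
by rewrite IHh -expnM -expnD; congr (q ^ _)%N; lia.
Qed.

(* There are [q ^ (h (h + 1) / 2)] systems of residues of the first [h]
   coefficients modulo [q ^ h], ..., [q], against [H ^ h] combinations. *)
Lemma small_coefficient_relation h q (Psi : 'I_h -> {poly int}) : (0 < h)%N -> (0 < q)%N ->
  exists c : 'I_h -> int, [/\ exists i, c i != 0,
    forall i, `|c i| ^+ 2 <= (q ^ h.+1)%N%:Z &
    forall k, (k < h)%N -> ((q ^ (h - k))%N %| (\sum_i (c i)%:P * Psi i)`_k)%Z].
Proof.
move=> h0 q0.
(* With the least H such that H^2 > q^(h + 1), the combinations outnumber the residue systems, while
   differences of coefficients are at most H - 1, whose square is at most q^(h + 1). *)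
have exH : exists H, (q ^ h.+1 < H ^ 2)%N.
  by exists (q ^ h.+1).+1; rewrite -mulnn; nia.
case: (ex_minnP exH) => H qH Hmin.
have H0 : (0 < H)%N by case: H qH {Hmin}.
have Hp : (H.-1 ^ 2 <= q ^ h.+1)%N.
  by rewrite leqNgt; apply/negP => /Hmin; rewrite leqNgt prednK // leqnn.
have q0' (k : 'I_h) : (0 < q ^ (h - k))%N by rewrite expn_gt0 q0.
have q0Z (k : 'I_h) : 0 < (q ^ (h - k))%N%:Z by rewrite ltz_nat.
pose val_ (u : {ffun 'I_h -> 'I_H}) : {poly int} := \sum_i ((u i : nat)%:Z)%:P * Psi i.
have lt_mod (k : 'I_h) (a : int) : (absz (a %% (q ^ (h - k))%N)%Z < q ^ (h - k))%N.
  have := ltz_pmod a (q0Z k); have := modz_ge0 a (lt0r_neq0 (q0Z k)); lia.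
pose g (u : {ffun 'I_h -> 'I_H}) : {dffun forall k : 'I_h, 'I_(q ^ (h - k))} :=
  [ffun k : 'I_h => Ordinal (lt_mod k (val_ u)`_k)].
have [||u [v [uv guv]]] := @pigeonhole _ _ g [set: _]; first by move=> u; rewrite finset.in_setT.
  rewrite cardsT card_dep_ffun card_ffun !card_ord foldrE big_map big_enum /=.
  under eq_bigr => k _ do rewrite card_ord.
  rewrite -(@ltn_exp2r _ _ 2) // triangular_expn mulnC expnM.
  by rewrite -[X in (_ < X)%N]expnM [X in (_ < H ^ X)%N]mulnC expnM ltn_exp2r.
exists (fun i => (u i : nat)%:Z - (v i : nat)%:Z); split.
- apply: contrapT => H'; case/eqP: uv; apply/ffunP => i; apply/val_inj/eqP.
  rewrite -eqz_nat -subr_eq0; apply/contraT => ui.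
  by case: H'; exists i.
- move=> i; have := ltn_ord (u i); have := ltn_ord (v i).
  move: (nat_of_ord (u i)) (nat_of_ord (v i)) => a b aH bH.
  apply: (@le_trans _ _ ((H.-1 ^ 2)%N%:Z)); last by rewrite lez_nat.
  rewrite PoszX lerXn2r ?nnegrE //; lia.
- move=> k kh; have := congr1 (fun w : {dffun forall k : 'I_h, 'I_(q ^ (h - k))} =>
    nat_of_ord (w (Ordinal kh))) guv.
  rewrite !ffunE /= => E.
  have -> : \sum_i ((u i : nat)%:Z - (v i : nat)%:Z)%:P * Psi i = val_ u - val_ v.
    by rewrite /val_ -sumrB; apply: eq_bigr => i _; rewrite polyCB mulrBl.
  rewrite coefB -eqz_mod_dvd; apply/eqP.
  have e0 a : (0 <= a %% (q ^ (h - k))%N)%Z by apply: modz_ge0; apply: lt0r_neq0 (q0Z (Ordinal kh)).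
  by have := e0 (val_ u)`_k; have := e0 (val_ v)`_k; lia.
Qed.

Lemma horner_dvd (q : int) h (P : {poly int}) t : (q %| t)%Z ->
  (forall k, (k < h)%N -> (q ^+ (h - k) %| P`_k)%Z) -> (q ^+ h %| P.[t])%Z.
Proof.
move=> qt qP; rewrite horner_coef; apply: rpred_sum => k _.
have qtk : (q ^+ k %| t ^+ k)%Z by case/dvdzP: qt => z ->; rewrite exprMn dvdz_mull.
have [kh|hk] := ltnP k h; last by apply/dvdz_mull/(dvdz_trans _ qtk)/dvdz_exp2l.
by rewrite -(subnK (ltnW kh)) exprD; apply: dvdz_mul => //; apply: qP.
Qed.

(** On the class the form is, modulo q^h, a polynomial in the parameter, so q^h divides G(w x) = w^t
    G(x) and hence G(x). But G(x)^2 <= h^2 N^(2 t) q^(h + 1) < q^(2 h). The unit [w] normalizes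
    coordinate i0, while the size bound is used on x itself. *)
Lemma class_auxiliary_form n (i0 i1 : 'I_n) p k h (F : 'I_n -> {mpoly int[n]}) z t N
    (mon : 'I_h -> 'X_{1..n}) :
    (0 < p)%N -> (0 < k)%N -> (forall j, supported (pred3 i0 i1 j) (F j)) -> (0 < h)%N ->
    smooth_point i0 i1 p k h F z -> (forall i, mdeg (mon i) = t) ->
    (h ^ 2 * N ^ (2 * t) < (p ^ k) ^ h.-1)%N ->
  exists2 c : 'I_h -> int, (exists i, c i != 0) &
    forall (x : 'I_n -> int) w, (forall i, `|x i| <= N%:Z) -> coprimez w p%:Z ->
      smooth_point i0 i1 p k h F (fun i => w * x i) ->
      same_class i1 p k (fun i => w * x i) z ->
      (\sum_i c i *: 'X_[mon i]).@[x] = 0.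
Proof.
move=> p0 k0 suppF h0 sz hmon hN.
have [g hg] := local_parametrization k0 suppF h0 sz.
pose Psi i : {poly int} := mmap polyC g 'X_[mon i].
have q0 : (0 < p ^ k)%N by rewrite expn_gt0 p0.
have [c [c0 cH cq]] := small_coefficient_relation Psi h0 q0.
exists c => // x w xN cw sx xz.
set G := \sum_i _; pose y i := w * x i; pose Q := (p%:Z ^+ k) ^+ h.
have hG : G \is t.-homog.
  by apply: rpred_sum => i _; apply: rpredZ; rewrite dhomogX /= hmon.
have Gyx : G.@[y] = w ^+ t * G.@[x] by exact: meval_homog_scale.
have QGy : (Q %| G.@[y])%Z.
  have : cong Q G.@[y] G.@[fun j => (g j).[y i1 - z i1]].
    by apply: (@meval_cong _ _ predT) => // j _; apply: hg.
  move=> /cong_dvd ->; rewrite -hornerE_mmap; apply: horner_dvd; first by case: xz.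
  have <- : \sum_i (c i)%:P * Psi i = mmap polyC g G.
    rewrite /G raddf_sum /=; apply: eq_bigr => i _.
    by rewrite -mul_mpolyC rmorphM /= mmapC.
  by move=> m mh; have := cq m mh; rewrite !PoszX.
have cwQ : coprimez Q (w ^+ t).
  by do 2!apply: coprimezXl; rewrite coprimez_sym; apply: coprimezXl.
have QGx : (Q %| G.@[x])%Z by move: QGy; rewrite Gyx Gauss_dvdzr.
have Gx2 : `|G.@[x]| ^+ 2 < Q ^+ 2.
  have [H HE] : exists H : nat, H = \max_i `|c i|%N by exists (\max_i `|c i|%N).
  have cHi i : (`|c i| <= H)%N by rewrite HE; exact: (@leq_bigmax _ (fun i => `|c i|%N) i).
  have HH : (H ^ 2 <= (p ^ k) ^ h.+1)%N.
    rewrite HE; have [i ->] : exists i, \max_i `|c i|%N = `|c i|%N.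
      have hI : (0 < #|'I_h|)%N by rewrite card_ord.
      by have [i E] := bigop.eq_bigmax (fun i => `|c i|%N) hI; exists i.
    by rewrite -lez_nat [X in X <= _]PoszX abszE; apply: cH.
  have Gle : (absz G.@[x] <= h * (H * N ^ t))%N.
    rewrite -lez_nat abszE /G raddf_sum /=.
    apply: le_trans (ler_norm_sum _ _ _) _.
    have -> : (h * (H * N ^ t))%N%:Z = \sum_(i < h) (H * N ^ t)%N%:Z.
      by rewrite sumr_const card_ord -mulr_natl natz -PoszM.
    apply: ler_sum => i _; rewrite mevalZ normrM PoszM; apply: ler_pM => //.
      by rewrite -abszE lez_nat.
    by rewrite -(hmon i); apply: monomial_bound.
  have -> : Q ^+ 2 = (((p ^ k) ^ h) ^ 2)%N%:Z by rewrite !PoszX.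
  rewrite -abszE -PoszX ltz_nat; apply: (@leq_ltn_trans ((h * (H * N ^ t)) ^ 2)).
    by rewrite leq_exp2r.
  apply: (@leq_ltn_trans (((p ^ k) ^ h.+1) * (h ^ 2 * N ^ (2 * t)))).
    rewrite !expnMn mulnCA leq_mul // [(2 * t)%N]mulnC expnM.
    exact: leqnn.
  have -> : (((p ^ k) ^ h) ^ 2 = (p ^ k) ^ h.+1 * (p ^ k) ^ h.-1)%N.
    rewrite -expnM -expnD; congr (_ ^ _)%N.
    by rewrite addSnnS prednK // muln2 addnn.
  by rewrite ltn_pmul2l // expn_gt0 q0.
apply/eqP/contraT => Gx0.
move: Gx2; rewrite ltNge; apply: contraNT => _.
have Q0 : 0 <= Q by rewrite !exprn_ge0.
rewrite lerXn2r ?nnegrE // -[Q]ger0_norm // -!abszE lez_nat.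
by apply: dvdn_leq; rewrite ?absz_gt0.
Qed.

(** * Plane forms vanishing on the curve *)

Section CurveForms.
Variables (n : nat) (C : set 'rV[algC]_n.+1) (d T : nat).
Local Notation form := {mpoly algC[n.+1]}.
Local Notation S := (dhomog n.+1 algC).
Local Notation vec := 'rV[algC]_n.+1.
Local Notation J := (vanishing C).
Hypothesis irrC : irreducible_closed C.
Hypothesis hilbC : forall k, (hilb J (T + k) = hilb J T + d * k)%N.
Hypothesis d_gt0 : (0 < d)%N.

Let closedC : zariski_closed C. Proof. by case: irrC. Qed.
Let primeC : gprime J. Proof. exact: irreducible_gprime. Qed.
Let gidealC : gideal J. Proof. exact: vanishing_gideal. Qed.

Lemma hilb_le_size (s : seq vec) t : (forall v, C v -> exists2 z, z \in s & line z v) ->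
  (hilb J t <= size s)%N.
Proof.
move=> cov; pose f (r : S t) : 'rV[algC]_(size s) := \row_i (r : form).@[(nth 0 s i) ord0].
have f_lin : linear f.
  by move=> a r1 r2; apply/rowP => i; rewrite !mxE /= mevalD mevalZ.
pose fl : {linear S t -> 'rV[algC]_(size s)} :=
  HB.pack f (GRing.isLinear.Build algC (S t) 'rV[algC]_(size s) _ f f_lin).
have kJ : (lker (linfun fl) <= part J t)%VS.
  apply/subvP => r; rewrite memv_ker lfunE => /eqP/rowP fr.
  apply/(partP _ gidealC); split; first by exists t; apply: dhomog_is_dhomog.
  move=> v /cov[z zs [_ [a ->]]]; rewrite (meval_scale _ _ (dhomog_is_dhomog r)).
  have zi : (index z s < size s)%N by rewrite index_mem.
  by have := fr (Ordinal zi); rewrite !mxE /= nth_index // => ->; rewrite mulr0.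
have := limg_ker_dim (linfun fl) fullv; rewrite capfv => dimE.
have : (\dim (linfun fl @: fullv) <= size s)%N.
  by rewrite (leq_trans (dimvS (subvf _))) // dimvf /dim /= mul1n.
have := dimvS kJ; move: dimE; rewrite /hilb => <-.
move: (\dim (lker _)) (\dim (part _ _)) (\dim (limg _)) => a b c ab cs.
by rewrite leq_subLR; apply: leq_add.
Qed.

(** Finitely many points would bound the Hilbert function, which has positive slope. *)
Lemma many_points N : exists s : seq vec, [/\ size s = N, pdistinct s & forall z, z \in s -> C z].
Proof.
elim: N => [|N [s [sN [us ds] sC]]]; first by exists [::].
have [v Cv hv] : exists2 v, C v & forall z, z \in s -> ~ line z v.
  apply: contrapT => H.
  have cov v : C v -> exists2 z, z \in s & line z v.
    move=> Cv; apply: contrapT => H'; apply: H; exists v => // z zs Lz.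
    by apply: H'; exists z.
  have := hilb_le_size (T + N.+1)%N cov; rewrite hilbC sN.
  have := leq_pmull N.+1 d_gt0; lia.
have v0 := closed_neq0 closedC Cv.
exists (v :: s); split; first by rewrite /= sN.
  split.
    rewrite /= us andbT; apply/negP => vs; apply: (hv v vs).
    by split=> //; exists 1; rewrite scale1r.
  move=> z w; rewrite !in_cons => /orP[/eqP ->|zs] /orP[/eqP ->|ws] // [c E].
  - by case: (hv w ws); split=> //; exists c.
  - case: (hv z zs); split=> //; exists c^-1; rewrite E scalerA mulVf ?scale1r //.
    apply: contraNneq (closed_neq0 closedC (sC z zs)) => c0.
    by rewrite E c0 scale0r.
  - by apply: ds => //; exists c.
by move=> z; rewrite in_cons => /orP[/eqP -> //|/sC].
Qed.

(** Make the combination vanish at d t + 1 points of [C]; by Bezout it vanishes on all of [C]. *)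
Lemma vanishing_combination t M (mon : 'I_M -> 'X_{1..n.+1}) :
    (forall i, mdeg (mon i) = t) -> (d * t < M.-1)%N ->
  exists2 c : 'I_M -> algC, (exists i, c i != 0) & J (\sum_i c i *: 'X_[mon i]).
Proof.
move=> hmon hM; have [s [sN ds sC]] := many_points (d * t).+1.
pose w i : 'rV[algC]_(size s) := \row_k ('X_[mon i] : form).@[(nth 0 s k) ord0].
have [|c c0 cU] := @dependent_mod algC _ 0%VS M w.
  by rewrite dimv0 subn0 dimvf /dim /= mul1n sN; lia.
exists c => //; set G := \sum_i _.
have hG : G \is t.-homog.
  by apply: rpred_sum => i _; apply: rpredZ; rewrite dhomogX /= hmon.
apply: contrapT => JG.
have := hilb_bezout (s := s) irrC hilbC hG JG; rewrite sN ltnn => /(_ _ ds) H.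
apply/notF/H => z zs; split; first exact: sC.
have zi : (index z s < size s)%N by rewrite index_mem.
move: cU; rewrite memv0 => /eqP/rowP/(_ (Ordinal zi)); rewrite summxE mxE => E.
rewrite -[RHS]E raddf_sum; apply: eq_bigr => i _.
by rewrite !mxE /= nth_index // mevalZ.
Qed.

Variables (i0 i1 : 'I_n.+1).
Hypothesis Ji0 : ~ J 'X_i0.
Hypothesis Ji1 : forall r, ~ J ('X_i1 - r *: 'X_i0).

Lemma i1_neq_i0 : i1 != i0.
Proof.
apply/eqP => E; apply: (Ji1 (r := 1)); rewrite E scale1r subrr.
exact: gid0 gidealC.
Qed.

(** Such a form would split into linear factors, one of them in the prime ideal of [C], against the
    choice of i0 and i1. *)
Lemma binary_not_vanishing e (G : form) : G \is e.-homog -> G != 0 ->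
  supported (pred2 i0 i1) G -> ~ J G.
Proof.
clear hilbC d_gt0; move=> /dhomogP hG G0 sG JG.
pose m k := (U_(i1) *+ k + U_(i0) *+ (e - k))%MM : 'X_{1..n.+1}.
pose f : {poly algC} := \poly_(k < e.+1) G@_(m k).
have i10 := i1_neq_i0.
have mE mm : mm \in msupp G -> (mm i1 <= e)%N /\ mm = m (mm i1).
  move=> mG; have := hG mm mG; rewrite /= mdegE (bigD1 i1) //= (bigD1 i0) 1?eq_sym //=.
  rewrite big1 ?addn0 => [dm|i /andP[i_1 i_0]]; last first.
    apply/eqP/contraT => /(sG mm mG i) /orP[] /eqP E.
      by rewrite E eqxx in i_0.
    by rewrite E eqxx in i_1.
  have le1 : (mm i1 <= e)%N by rewrite -dm leq_addr.
  split=> //; apply/mnmP => i; rewrite /m mnmDE !mulmnE !mnm1E.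
  have [<-|ni1] := eqVneq i1 i; first by rewrite eq_sym (negPf i10) mul1n mul0n addn0.
  have [<-|ni0] := eqVneq i0 i; first by rewrite mul0n mul1n add0n; lia.
  rewrite !mul0n addn0; apply/eqP/contraT => /(sG mm mG i) /orP[] /eqP E.
    by rewrite E eqxx in ni0.
  by rewrite E eqxx in ni1.
have GE : G = homogenize e f 'X_i1 'X_i0.
  apply/mpolyP => mm; rewrite /homogenize raddf_sum /=.
  have XE k : 'X_i1 ^+ k * 'X_i0 ^+ (e - k) = 'X_[m k] :> form.
    by rewrite /m mpolyXD !mpolyXn.
  have [mG|mG] := boolP (mm \in msupp G).
    have [le1 mmE] := mE mm mG; have lt1 : (mm i1 < e.+1)%N by [].
    rewrite (bigD1 (Ordinal lt1)) //= XE mcoeffZ mcoeffX -mmE eqxx mulr1.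
    rewrite coef_poly lt1 -mmE big1 ?addr0 // => k kn.
    rewrite XE mcoeffZ mcoeffX; case: eqP => [E|]; last by rewrite mulr0.
    case/negP: kn; apply/eqP/val_inj => /=; rewrite -E /m mnmDE !mulmnE !mnm1E.
    by rewrite eqxx eq_sym (negPf i10) mul1n mul0n addn0.
  rewrite (memN_msupp_eq0 mG) big1 // => k _.
  rewrite XE mcoeffZ mcoeffX coef_poly ltn_ord; case: eqP => [E|]; last by rewrite mulr0.
  by rewrite E (memN_msupp_eq0 mG) mul0r.
have f0 : f != 0.
  apply: contraNneq G0 => f0; rewrite GE f0 /homogenize big1 // => k _.
  by rewrite coef0 scale0r.
move: JG; rewrite GE => /(gprime_binary primeC (var_homog i1) (var_homog i0) f0 (size_poly _ _)).
by case=> // -[r /Ji1].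
Qed.

Definition plane_degree j e := exists G : form, [/\ G \is e.-homog, G != 0,
  supported (pred3 i0 i1 j) G & J G].

(* The [(2 d + 1) ^ 2] monomials with [x_i1]- and [x_j]-degree at most [2 d]
   outnumber [4 d ^ 2 + 1] points of [C], which detect [J] in degree [4 d]. *)
Lemma exists_plane_degree j : j != i0 -> j != i1 -> plane_degree j (4 * d).
Proof.
move=> ji0 ji1; pose D := (2 * d).+1; have i10 := i1_neq_i0.
pose mm (ab : 'I_D * 'I_D) : 'X_{1..n.+1} :=
  (U_(i1) *+ ab.1 + U_(j) *+ ab.2 + U_(i0) *+ (4 * d - ab.1 - ab.2))%MM.
pose mon (k : 'I_#|{: 'I_D * 'I_D}|) := mm (enum_val k).
have mmd ab : mdeg (mm ab) = (4 * d)%N.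
  rewrite /mm !mdegD !mdegMn !mdeg1 !mul1n.
  have := ltn_ord ab.1; have := ltn_ord ab.2; rewrite /D; lia.
have mm_inj : injective mm.
  move=> [a b] [a' b'] /mnmP E; have := E i1; have := E j.
  rewrite !mnmDE !mulmnE !mnm1E !eqxx ![i1 == j]eq_sym (negPf ji1).
  rewrite ![i0 == _]eq_sym (negPf ji0) (negPf i10) !mul1n !mul0n !addn0 !add0n /=.
  by move=> /val_inj -> /val_inj ->.
have [||c [k0 ck] Jc] := @vanishing_combination (4 * d) _ mon; first by move=> k; apply: mmd.
  by rewrite card_prod card_ord /D; nia.
have monc k : (\sum_i c i *: 'X_[mon i] : form)@_(mon k) = c k.
  rewrite raddf_sum (bigD1 k) //= mcoeffZ mcoeffX eqxx mulr1 big1 ?addr0 // => i ik.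
  rewrite mcoeffZ mcoeffX (inj_eq mm_inj) (inj_eq enum_val_inj) (negPf ik) mulr0 //.
exists (\sum_i c i *: 'X_[mon i]); split=> //.
- by apply: rpred_sum => i _; apply: rpredZ; rewrite dhomogX /= mmd.
- by apply: contraNneq ck => E; rewrite -monc E mcoeff0.
- move=> m; rewrite mcoeff_msupp raddf_sum /= => mG i mi.
  have [k mE] : exists k, mon k = m.
    apply: contrapT => H; case/eqP: mG; rewrite big1 // => k _.
    by rewrite mcoeffZ mcoeffX; case: eqP => [E|]; [case: H; exists k | rewrite mulr0].
  move: mi; rewrite -mE /mon /mm !mnmDE !mulmnE !mnm1E /=.
  rewrite ![_ == i]eq_sym; case: (i == i1); rewrite ?orbT //=.
  case: (i == j); rewrite ?orbT //=; by case: (i == i0).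
Qed.

Lemma minimal_plane_degree j : j != i0 -> j != i1 -> exists e, [/\ (e <= 4 * d)%N,
  plane_degree j e & forall e', plane_degree j e' -> (e <= e')%N].
Proof.
move=> ji0 ji1; have exe : exists e, `[< plane_degree j e >].
  by exists (4 * d)%N; apply/asboolP; apply: exists_plane_degree.
case: (ex_minnP exe) => e /asboolP pe mine; exists e; split=> //.
  exact/mine/asboolP/exists_plane_degree.
by move=> e' pe'; apply/mine/asboolP.
Qed.

End CurveForms.

(** * Integer points and forms with integer coefficients *)

Section IntegerPoints.
Variable n : nat.
Implicit Types (G : {mpoly int[n.+1]}) (x y : 'rV[int]_n.+1).

Lemma map_intr_monomial (c : int) (m : 'X_{1..n.+1}) :
  map_mpoly (intr : int -> algC) (c *: 'X_[m]) = c%:~R *: 'X_[m].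
Proof.
apply/mpolyP => m'; rewrite mcoeff_map_mpoly !mcoeffZ !mcoeffX.
by case: eqP => _; rewrite ?mulr1 ?mulr0.
Qed.

Lemma meval_int_point G x :
  (map_mpoly (intr : int -> algC) G).@[(int_point x) ord0] = (G.@[x ord0])%:~R.
Proof.
elim/mpolyind: G => [|c m G _ _ IHG]; first by rewrite raddf0 !meval0.
rewrite raddfD /= !mevalD IHG rmorphD map_intr_monomial !mevalZ !mevalX rmorphM rmorph_prod /=.
by congr (_ * _ + _); apply: eq_bigr => i _; rewrite mxE rmorphXn.
Qed.

Lemma msupp_map_intr G m :
  (m \in msupp (map_mpoly (intr : int -> algC) G)) = (m \in msupp G).
Proof. by rewrite !mcoeff_msupp mcoeff_map_mpoly intr_eq0. Qed.

Lemma map_intr_homog G e : G \is e.-homog -> map_mpoly (intr : int -> algC) G \is e.-homog.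
Proof. by move=> hG; apply/dhomogP => m; rewrite msupp_map_intr; apply/dhomogP. Qed.

Lemma mderiv_map_intr G j :
  (map_mpoly (intr : int -> algC) G)^`M(j) = map_mpoly intr G^`M(j).
Proof. by apply/mpolyP => m; rewrite mcoeff_deriv !mcoeff_map_mpoly mcoeff_deriv raddfMn. Qed.

Lemma mderiv_homog (R : nzRingType) m (P : {mpoly R[m]}) e j :
  P \is e.-homog -> P^`M(j) \is e.-1.-homog.
Proof.
move=> /dhomogP hP; apply/dhomogP => mm; rewrite mcoeff_msupp mcoeff_deriv => c0.
have : (mm + U_(j))%MM \in msupp P.
  by rewrite mcoeff_msupp; apply: contraNneq c0 => ->; rewrite mul0rn.
by move/hP => /= <-; rewrite mdegD mdeg1 addn1.
Qed.

(** Taking gcds over j in x_i y_j = x_j y_i gives |x_i| = |y_i|; the first nonzero coordinate fixes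
    the sign. *)
Lemma Zprim_proportional x y : Zprim x -> Zprim y ->
  (exists c, int_point x = c *: int_point y) -> x = y.
Proof.
move=> [x0 gx px] [y0 gy py] [c cE].
have xy i j : x ord0 i * y ord0 j = x ord0 j * y ord0 i.
  apply: (@intr_inj algC); rewrite !rmorphM /=.
  have E k : (x ord0 k)%:~R = c * (y ord0 k)%:~R :> algC.
    by have := congr1 (fun v : 'rV[algC]_n.+1 => v ord0 k) cE; rewrite !mxE.
  by rewrite !E; ring.
have gcd_mul (a : int) (v : 'rV[int]_n.+1) :
    \big[gcdz/0]_(i < n.+1) (a * v ord0 i) = `|a| * \big[gcdz/0]_(i < n.+1) v ord0 i.
  elim/big_rec2: _ => [|i u w _ ->]; first by rewrite mulr0.
  by rewrite -(abszE a) mulz_gcdr /gcdz !abszM absz_nat.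
have norm i : `|x ord0 i| = `|y ord0 i|.
  rewrite -[LHS]mulr1 -gy -gcd_mul -[RHS]mulr1 -gx -gcd_mul.
  by apply: eq_bigr => j _; rewrite xy mulrC.
have [i xi imin] : exists2 i, x ord0 i != 0 &
    forall j : 'I_n.+1, (j < i)%N -> x ord0 j = 0.
  have exi : exists i, x ord0 i != 0.
    apply: contrapT => H; case/eqP: x0; apply/rowP => i; rewrite mxE.
    by apply/eqP/contraT => xi; case: H; exists i.
  have [i0 xi0] := exi.
  have [i xi imin] := @arg_minnP _ i0 (fun i => x ord0 i != 0) (fun i => i : nat) xi0.
  exists i => // j ji; apply/eqP/contraT => xj.
  by have := imin j xj; rewrite leqNgt ji.
have y_eq0 j : x ord0 j = 0 -> y ord0 j = 0.
  by move=> xj; apply/eqP; rewrite -normr_eq0 -norm xj normr0.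
have yi : y ord0 i != 0 by rewrite -normr_eq0 -norm normr_eq0.
have xi0 := px i xi imin.
have yi0 := py i yi (fun j ji => y_eq0 j (imin j ji)).
have xyi : x ord0 i = y ord0 i.
  by have := norm i; rewrite !gtr0_norm.
apply/rowP => j; have /eqP := xy i j.
by rewrite xyi [X in _ == X]mulrC (inj_eq (mulfI yi)) => /eqP.
Qed.

Lemma Zprim_pdistinct (s : seq 'rV[int]_n.+1) : uniq s ->
  (forall x, x \in s -> Zprim x) -> pdistinct [seq int_point x | x <- s].
Proof.
move=> us sZ; split.
  rewrite map_inj_in_uniq // => x y xs ys E.
  by apply: Zprim_proportional; [exact: sZ|exact: sZ|exists 1; rewrite scale1r].
move=> _ _ /mapP[x xs ->] /mapP[y ys ->] E; congr int_point.
by apply: Zprim_proportional; [exact: sZ|exact: sZ|].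
Qed.

Lemma max_height_le x N : (max_height x <= N)%N -> forall i, `|x ord0 i| <= N%:Z.
Proof.
move=> xN i; rewrite -abszE lez_nat; apply: leq_trans xN.
exact: (@leq_bigmax _ (fun i => `|x ord0 i|%N) i).
Qed.

End IntegerPoints.

Section SmallForms.
Variables (n : nat) (C : set 'rV[algC]_n.+1) (d T : nat).
Local Notation J := (vanishing C).
Local Notation intm := (map_mpoly (intr : int -> algC)).
Hypothesis irrC : irreducible_closed C.
Hypothesis hilbC : forall k, (hilb J (T + k) = hilb J T + d * k)%N.
Hypothesis d_gt0 : (0 < d)%N.
Variables (N : nat) (s : seq 'rV[int]_n.+1).
Hypothesis N_gt0 : (0 < N)%N.
Hypothesis us : uniq s.
Hypothesis sP : forall x, x \in s ->
  [/\ Zprim x, C (int_point x) & forall i, `|x ord0 i| <= N%:Z].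

Lemma integer_bezout (r : seq 'rV[int]_n.+1) g (G : {mpoly algC[n.+1]}) :
    uniq r -> {subset r <= s} -> G \is g.-homog -> ~ J G ->
    (forall x, x \in r -> G.@[(int_point x) ord0] = 0) ->
  (size r <= d * g)%N.
Proof.
move=> ur rs hG JG hr; rewrite -(size_map (@int_point n.+1)).
apply: (hilb_bezout irrC hilbC hG JG); last first.
  by apply: Zprim_pdistinct => // x /rs/sP[].
by move=> _ /mapP[x xr ->]; split; [case/rs/sP: xr | exact: hr].
Qed.

Variables (i0 i1 : 'I_n.+1).
Hypothesis Ji0 : ~ J 'X_i0.
Hypothesis Ji1 : forall r, ~ J ('X_i1 - r *: 'X_i0).
Hypothesis s_large : (d * (4 * d) < size s)%N.

Definition mon_count := #|{: 'X_{1..n.+1 < (4 * d).+1}}|.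
(** Number of terms, times Siegel's bound for [mon_count] unknowns and entries up to N^(4 d), times
    a bound for the derivative of a monomial of degree at most 4 d. *)
Definition deriv_bound :=
  (mon_count * ((2 * mon_count * N ^ (4 * d)).+1 ^ mon_count * (4 * d * N ^ (4 * d))))%N.

Lemma size_msupp_le e (P : {mpoly algC[n.+1]}) : P \is e.-homog -> (e <= 4 * d)%N ->
  (size (msupp P) <= mon_count)%N.
Proof.
move=> /dhomogP hP e4; rewrite /mon_count cardE -(size_map (@bmnm n.+1 (4 * d).+1)).
apply: uniq_leq_size; first exact: msupp_uniq.
move=> m /hP /= dm; have lt : (mdeg m < (4 * d).+1)%N by rewrite dm.
by apply/mapP; exists (BMultinom lt); rewrite ?mem_enum.
Qed.

(** The coefficients of a plane equation [P] of least degree solve the integer system of vanishing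
    at [s], so Siegel's lemma gives a small integer solution on the monomials of [P]. Its form
    vanishes at more than 4 d^2 points and so, by Bezout, on [C]. *)
Lemma integer_plane_form j : j != i0 -> j != i1 -> exists e (G : {mpoly int[n.+1]}),
  [/\ (e <= 4 * d)%N /\ G \is e.-homog, supported (pred3 i0 i1 j) G,
   forall x, x \in s -> G.@[x ord0] = 0, ~ J (intm G^`M(j)) &
   forall x, x \in s -> `|(G^`M(j)).@[x ord0]| <= deriv_bound%:Z].
Proof.
move=> ji0 ji1.
have [e [e4 [P [hP P0 sP3 JP]] emin]] := minimal_plane_degree irrC hilbC d_gt0 Ji1 ji0 ji1.
pose k := size (msupp P); pose mon (i : 'I_k) := nth 0%MM (msupp P) i.
have monP i : mon i \in msupp P by apply: mem_nth.
have mon_inj : injective mon.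
  by move=> i i' /eqP; rewrite nth_uniq ?msupp_uniq // => /eqP /val_inj.
have dmon i : mdeg (mon i) = e by move/dhomogP: hP => /(_ _ (monP i)).
have kM : (k <= mon_count)%N by apply: size_msupp_le hP e4.
pose A : 'M[int]_(size s, k) := \matrix_(a, i) ('X_[mon i]).@[(nth 0 s a) ord0].
have snth (a : 'I_(size s)) : nth 0 s a \in s by apply: mem_nth.
have AN a i : `|A a i| <= (N ^ (4 * d))%N%:Z.
  rewrite mxE; have [_ _ hx] := sP (snth a).
  apply: le_trans (monomial_bound _ hx) _.
  by rewrite lez_nat dmon leq_pexp2l.
have PE : P = \sum_(i < k) P@_(mon i) *: 'X_[mon i].
  by rewrite [LHS]mpolyE (big_nth 0%MM) big_mkord.
have [|c [c0 Ac cb]] := siegel AN.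
  exists (\col_i P@_(mon i)).
    have k0 : (0 < k)%N by rewrite /k lt0n size_eq0 msupp_eq0.
    apply/eqP => /colP/(_ (Ordinal k0)); rewrite !mxE => /eqP.
    by rewrite -[_ == 0]negbK -mcoeff_msupp monP.
  apply/colP => a; rewrite !mxE.
  have [_ Cx _] := sP (snth a); case: JP => _ /(_ _ Cx) Px0; apply: etrans Px0.
  rewrite [in RHS]PE [RHS]raddf_sum /=; apply: eq_bigr => i _.
  rewrite !mxE mevalZ mulrC; congr (_ * _).
  rewrite -meval_int_point; congr meval.
  by apply/mpolyP => m; rewrite mcoeff_map_mpoly !mcoeffX; case: eqP.
pose G : {mpoly int[n.+1]} := \sum_(i < k) c i ord0 *: 'X_[mon i].
have Gmon i : G@_(mon i) = c i ord0.
  rewrite raddf_sum (bigD1 i) //= mcoeffZ mcoeffX eqxx mulr1 big1 ?addr0 // => i' ii'.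
  by rewrite mcoeffZ mcoeffX (inj_eq mon_inj) (negPf ii') mulr0.
have G0 : G != 0.
  apply: contraNneq c0 => G0; apply/eqP/colP => i.
  by rewrite -Gmon G0 mcoeff0 mxE.
have hG : G \is e.-homog.
  by apply: rpred_sum => i _; apply: rpredZ; rewrite dhomogX /= dmon.
have suppG m : m \in msupp G -> m \in msupp P.
  rewrite mcoeff_msupp raddf_sum /= => mG; apply/contraT => mP; case/eqP: mG.
  rewrite big1 // => i _; rewrite mcoeffZ mcoeffX.
  by case: eqP => [E|_]; [rewrite -E monP in mP | rewrite mulr0].
have sG : supported (pred3 i0 i1 j) G by move=> m /suppG; apply: sP3.
have Gs x : x \in s -> G.@[x ord0] = 0.
  move=> xs; have xi : (index x s < size s)%N by rewrite index_mem.
  move/colP: Ac => /(_ (Ordinal xi)); rewrite !mxE => E; rewrite -[RHS]E.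
  rewrite raddf_sum; apply: eq_bigr => i _ /=.
  by rewrite mevalZ !mxE nth_index // mulrC.
have hGC := map_intr_homog hG.
have GC0 : intm G != 0.
  rewrite -msupp_eq0; apply: contraNneq G0 => E; rewrite -msupp_eq0.
  by case: (msupp G) (msupp_map_intr G) => // m r /(_ m); rewrite E mem_head.
have sGC : supported (pred3 i0 i1 j) (intm G).
  by move=> m; rewrite msupp_map_intr; apply: sG.
have JG : J (intm G).
  apply: contrapT => JG; have := integer_bezout us (fun x => id) hGC JG.
  have vs x : x \in s -> (intm G).@[(int_point x) ord0] = 0.
    by move=> xs; rewrite meval_int_point Gs.
  move=> /(_ vs); apply/negP; rewrite -ltnNge.
  by apply: leq_ltn_trans s_large; rewrite leq_mul2l e4 orbT.
exists e, G; split=> //.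
  rewrite -mderiv_map_intr => JdG.
  (* A nonzero derivative in the ideal would be a plane equation of smaller degree; a zero one would
     leave a form in x_i0 and x_i1 alone. *)
  have [dG0|dG0] := eqVneq ((intm G)^`M(j)) 0; last first.
    have dpe : plane_degree C i0 i1 j e.-1.
      exists (intm G)^`M(j); split=> //; first exact: mderiv_homog.
      exact: supported_mderiv.
    have := emin _ dpe.
    have [e0|] := posnP e; last by move=> e0; rewrite leqNgt prednK // leqnn.
    case/eqP: dG0; apply/mpolyP => m; rewrite mcoeff_deriv mcoeff0.
    suff -> : (intm G)@_(m + U_(j)) = 0 by rewrite mul0rn.
    move/dhomogP: hGC => hGC'; apply: memN_msupp_eq0; apply/negP => /hGC' /=.
    by rewrite mdegD mdeg1 e0 addn1.
  have s2 : supported (pred2 i0 i1) (intm G).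
    move=> m mG i mi; have := sGC m mG i mi; rewrite /= orbA => /orP[//|/eqP ij].
    have U_le : (U_(j) <= m)%MM.
      by apply/mnm_lepP => a; rewrite mnm1E; case: eqP => // <-; rewrite lt0n -ij.
    have := congr1 (fun q : {mpoly algC[n.+1]} => q@_(m - U_(j))) dG0.
    rewrite mcoeff_deriv mcoeff0 submK // => /eqP; rewrite mulrn_eq0 /=.
    by move: mG; rewrite mcoeff_msupp => /negPf ->.
  exact: (binary_not_vanishing irrC Ji0 Ji1 hGC GC0 s2 JG).
move=> x xs; have [_ _ hx] := sP xs.
rewrite /G (linear_sum (mderiv j)) raddf_sum /=; apply: le_trans (ler_norm_sum _ _ _) _.
pose Bd := ((2 * mon_count * N ^ (4 * d)).+1 ^ mon_count * (4 * d * N ^ (4 * d)))%N.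
apply: (@le_trans _ _ (\sum_(i < k) Bd%:Z)); last first.
  rewrite sumr_const card_ord -mulr_natl natz -PoszM lez_nat /deriv_bound -/Bd.
  by rewrite leq_mul2r kM orbT.
apply: ler_sum => i _; rewrite mderivZ mderivX mevalZ normrM /Bd PoszM; apply: ler_pM => //.
  apply: le_trans (cb i) _; rewrite lez_nat.
  apply: (@leq_trans ((2 * k * N ^ (4 * d)).+1 ^ mon_count)); first exact: leq_pexp2l.
  have mc0 : (0 < mon_count)%N.
    by apply: leq_trans kM; apply: leq_ltn_trans (ltn_ord i).
  by rewrite leq_exp2r // ltnS leq_mul2r leq_mul2l kM !orbT.
rewrite mevalZ normrM PoszM; apply: ler_pM => //.
  rewrite normr_nat natz lez_nat; apply: leq_trans e4; rewrite -(dmon i).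
  by rewrite mdegE (bigD1 j) //= leq_addr.
apply: le_trans (monomial_bound _ hx) _; rewrite lez_nat leq_pexp2l //.
apply: leq_trans e4; rewrite -(dmon i) !mdegE; apply: leq_sum => a _.
by rewrite mnmBE leq_subr.
Qed.

End SmallForms.

(** * Counting residue classes *)

Lemma size_le_fibers (A : eqType) (K : finType) (key : A -> K) (s : seq A) b :
  (forall x, (size [seq a <- s | key a == x] <= b)%N) -> (size s <= #|K| * b)%N.
Proof.
move=> hb; rewrite -sum1_size (partition_big key xpredT) //= -sum_nat_const.
by apply: leq_sum => x _; rewrite sum1_count -size_filter.
Qed.

(** Residues for different moduli are stored in one ordinal type, so that the class keys of all
    primes have the same type. *)
Lemma modz_inord_cong M D (x y : int) : (0 < D)%N -> (D <= M.+1)%N ->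
  inord (absz (x %% D%:Z)%Z) = inord (absz (y %% D%:Z)%Z) :> 'I_M.+1 -> cong D%:Z x y.
Proof.
move=> D0 DM /(congr1 val) /=.
have D0' : D%:Z != 0 by rewrite eqz_nat -lt0n.
have lt a : (absz (a %% D%:Z)%Z < M.+1)%N.
  by apply: leq_trans DM; rewrite -ltz_nat gez0_abs ?modz_ge0 // ltz_pmod.
rewrite !inordK // => E; rewrite /cong -eqz_mod_dvd; apply/eqP.
by rewrite -(gez0_abs (modz_ge0 x D0')) E gez0_abs ?modz_ge0.
Qed.

Section Count.
Variables (n : nat) (C : set 'rV[algC]_n.+1) (d T : nat).
Local Notation J := (vanishing C).
Local Notation intm := (map_mpoly (intr : int -> algC)).
Hypothesis irrC : irreducible_closed C.
Hypothesis hilbC : forall k, (hilb J (T + k) = hilb J T + d * k)%N.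
Hypothesis d_gt0 : (0 < d)%N.
Variables (N : nat) (s : seq 'rV[int]_n.+1).
Hypothesis N_gt0 : (0 < N)%N.
Hypothesis us : uniq s.
Hypothesis sP : forall x, x \in s ->
  [/\ Zprim x, C (int_point x) & forall i, `|x ord0 i| <= N%:Z].
Variables (i0 i1 : 'I_n.+1).
Hypothesis Ji0 : ~ J 'X_i0.
Hypothesis Ji1 : forall r, ~ J ('X_i1 - r *: 'X_i0).
Hypothesis s_large : (d * (4 * d) < size s)%N.
Variables (h t L r : nat).
Hypothesis h_gt1 : (1 < h)%N.
Hypothesis hilb_t : (h <= hilb J t)%N.
Hypothesis hL : forall v, (0 < v)%N -> (v <= N * deriv_bound n d N ^ n.+1)%N ->
  exists p, [/\ prime p, (p <= L)%N & ~~ (p %| v)%N].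
Hypothesis hr : forall m, (m ^ h.-1 <= h ^ 2 * N ^ (2 * t))%N -> (m <= r)%N.

Let other j := (j != i0) && (j != i1).

(** Bezout for each factor; the lemma is applied with partial derivatives as [F]. *)
Lemma count_bad (F : 'I_n.+1 -> {mpoly int[n.+1]}) (e : 'I_n.+1 -> nat) :
    (forall j, other j -> [/\ (e j <= 4 * d)%N, F j \is (e j).-homog & ~ J (intm (F j))]) ->
  (size [seq x : 'rV[int]_n.+1 <- s | (x ord0 i0 * \prod_(j | other j) (F j).@[x ord0] == 0)%R]
     <= d + n.+1 * (d * (4 * d)))%N.
Proof.
move=> hF.
have h0 : (size [seq x : 'rV[int]_n.+1 <- s | (x ord0 i0 == 0)%R] <= d)%N.
  rewrite -[X in (_ <= X)%N]muln1.
  apply: (integer_bezout irrC hilbC sP (filter_uniq _ us) _ (var_homog i0) Ji0).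
    by move=> x; rewrite mem_filter => /andP[].
  by move=> x; rewrite mem_filter mevalXU mxE => /andP[/eqP -> _].
have hj j : other j -> (size [seq x : 'rV[int]_n.+1 <- s | ((F j).@[x ord0] == 0)%R] <= d * (4 * d))%N.
  move=> /hF[ej hG JG]; apply: (@leq_trans (d * e j)); last by rewrite leq_mul2l ej orbT.
  apply: (integer_bezout irrC hilbC sP (filter_uniq _ us) _ (map_intr_homog hG) JG).
    by move=> x; rewrite mem_filter => /andP[].
  by move=> x; rewrite mem_filter meval_int_point => /andP[/eqP -> _].
have -> : (n.+1 * (d * (4 * d)) = \sum_(j < n.+1) d * (4 * d))%N.
  by rewrite sum_nat_const card_ord.
apply: (@leq_trans (size [seq x : 'rV[int]_n.+1 <- s | (x ord0 i0 == 0)%R] +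
   \sum_(j | other j) size [seq x : 'rV[int]_n.+1 <- s | ((F j).@[x ord0] == 0)%R])); last first.
  apply: leq_add => //; rewrite big_mkcond; apply: leq_sum => j _.
  by case: ifP => // oj; apply: hj.
have count_sum (P : pred 'rV[int]_n.+1) : size [seq x <- s | P x] = (\sum_(x <- s) P x)%N.
  by rewrite size_filter -sum1_count big_mkcond; apply: eq_bigr => x _; case: (P x).
rewrite !count_sum; under [X in (_ <= _ + X)%N]eq_bigr => j _ do rewrite count_sum.
rewrite exchange_big -big_split /=.
apply: leq_sum => x _; rewrite mulf_eq0; case: eqP => //= _.
by case: prodf_eq0 => // -[j oj Fj]; rewrite (bigD1 j) //= Fj.
Qed.

(** For the least such k, p^(k - 1) is not past the threshold, so it is at most [r]. *)
Lemma exponent_exists p : (1 < p)%N -> exists k, [/\ (0 < k)%N,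
  (h ^ 2 * N ^ (2 * t) < (p ^ k) ^ h.-1)%N & (p ^ k <= p * r)%N].
Proof.
move=> p1; have exk : exists k, (h ^ 2 * N ^ (2 * t) < (p ^ k) ^ h.-1)%N.
  exists (h ^ 2 * N ^ (2 * t))%N; set M := (_ * _)%N.
  apply: (@leq_trans (p ^ M)); first exact: ltn_expl.
  rewrite -[X in (X <= _)%N]expn1 leq_pexp2l ?expn_gt0 ?(ltnW p1) //.
  by rewrite -ltnS prednK // ltnW.
case: (ex_minnP exk) => k hk kmin; exists k.
have k0 : (0 < k)%N.
  rewrite lt0n; apply: contraTneq hk => ->; rewrite expn0 exp1n -leqNgt.
  by rewrite muln_gt0 !expn_gt0 N_gt0 (ltnW h_gt1).
split=> //; rewrite -(prednK k0) expnS leq_mul2l; apply/orP; right; apply: hr.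
by rewrite leqNgt; apply/negP => /kmin; rewrite leqNgt prednK // leqnn.
Qed.

(* [w x] rescales [x] so that its coordinate [i0] is 1 modulo [q ^ h]; the class
   of [x] is the prime [p] with the parameter modulo [q = p ^ k] and all
   coordinates modulo [p]. *)
Lemma count_good (F : 'I_n.+1 -> {mpoly int[n.+1]}) (e : 'I_n.+1 -> nat)
    (s' : seq 'rV[int]_n.+1) : uniq s' -> {subset s' <= s} ->
    (forall j, supported (pred3 i0 i1 j) (F j)) ->
    (forall j, other j -> F j \is (e j).-homog /\
       forall x, x \in s -> (F j).@[x ord0] = 0) ->
    (forall x, x \in s' -> exists p, [/\ prime p, (p <= L)%N,
       coprimez (x ord0 i0) p%:Z &
       forall j, other j -> coprimez (F j)^`M(j).@[x ord0] p%:Z]) ->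
  (size s' <= L.+1 * (L * r).+1 * L.+1 ^ n.+1 * (d * t))%N.
Proof.
move=> us' s's sF hF hp.
(* The choices of p, k and w become total functions, with dummy values elsewhere. The exponent k is
   a function of the prime alone, so points with the same p share q. *)
have hp' x : exists p, x \in s' -> [/\ prime p, (p <= L)%N,
    coprimez (x ord0 i0) p%:Z &
    forall j, other j -> coprimez (F j)^`M(j).@[x ord0] p%:Z].
  by have [/hp[p ?]|] := boolP (x \in s'); [exists p | exists 0%N].
pose p x := projT1 (cid (hp' x)); have pP x : x \in s' -> [/\ prime (p x), (p x <= L)%N,
    coprimez (x ord0 i0) (p x)%:Z &
    forall j, other j -> coprimez (F j)^`M(j).@[x ord0] (p x)%:Z].
  exact: projT2 (cid (hp' x)).
have hk' q : exists k, (1 < q)%N -> [/\ (0 < k)%N,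
    (h ^ 2 * N ^ (2 * t) < (q ^ k) ^ h.-1)%N & (q ^ k <= q * r)%N].
  have [/exponent_exists[k ?]|] := ltnP 1 q; first by exists k.
  by exists 0%N.
pose k q := projT1 (cid (hk' q)); have kP q : (1 < q)%N -> [/\ (0 < k q)%N,
    (h ^ 2 * N ^ (2 * t) < (q ^ k q) ^ h.-1)%N & (q ^ k q <= q * r)%N].
  exact: projT2 (cid (hk' q)).
have hw' x : exists w, x \in s' -> cong (((p x)%:Z ^+ k (p x)) ^+ h) (w * x ord0 i0) 1.
  have [xs|] := boolP (x \in s'); last by exists 0.
  have [_ _ cx _] := pP x xs.
  have [w hw] := coprimez_inv (coprimezXr h (coprimezXr (k (p x)) cx)).
  by exists w.
pose w x := projT1 (cid (hw' x)); have wP x : x \in s' -> cong (((p x)%:Z ^+ k (p x)) ^+ h) (w x * x ord0 i0) 1.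
  exact: projT2 (cid (hw' x)).
pose y x i := w x * x ord0 i.
pose key x : 'I_L.+1 * 'I_(L * r).+1 * {ffun 'I_n.+1 -> 'I_L.+1} :=
  (inord (p x), inord (absz (y x i1 %% (p x ^ k (p x))%N%:Z)%Z),
   [ffun j => inord (absz (y x j %% (p x)%:Z)%Z)]).
have cardK : #|{: 'I_L.+1 * 'I_(L * r).+1 * {ffun 'I_n.+1 -> 'I_L.+1}}| =
    (L.+1 * (L * r).+1 * L.+1 ^ n.+1)%N.
  by rewrite !card_prod card_ffun !card_ord.
have h0 := ltnW h_gt1.
have coprime_w x : x \in s' -> coprimez (w x) (p x)%:Z.
  move=> xs; have [pp _ _ _] := pP x xs; have [k0 _ _] := kP _ (prime_gt1 pp).
  have cQ : cong (p x)%:Z 1 (w x * x ord0 i0).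
    apply: cong_sym; apply: dvdz_trans (wP x xs); rewrite -exprM.
    by apply: (@dvdz_exp2l _ 1); rewrite muln_gt0 k0.
  have : coprimez 1 (p x)%:Z by rewrite coprimezE /= coprime1n.
  by move=> /(coprimez_cong cQ); rewrite coprimezMl => /andP[].
have smooth x : x \in s' -> smooth_point i0 i1 (p x) (k (p x)) h F (y x).
  move=> xs; have [_ _ _ cF] := pP x xs; split; first exact: wP.
    move=> j ji0 ji1; have oj : other j by rewrite /other ji0.
    have [hG hG0] := hF j oj.
    by rewrite (meval_homog_scale _ _ hG) hG0 ?mulr0 //; apply: s's.
  move=> j ji0 ji1; have oj : other j by rewrite /other ji0.
  have [hG _] := hF j oj.
  rewrite (meval_homog_scale _ _ (mderiv_homog j hG)) coprimezMl.
  by rewrite cF // andbT; apply: coprimezXl; apply: coprime_w.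
rewrite -cardK; apply: (size_le_fibers (key := key)) => kappa.
set fib := [seq a <- s' | key a == kappa].
(* A nonempty class is parametrized around any of its points; its auxiliary form combines standard
   monomials, so it is outside the ideal and has at most d t zeros on [C]. *)
have [->//|[z zf]] : fib = [::] \/ exists z, z \in fib.
  case: (fib) => [|z f]; first by left.
  by right; exists z; rewrite mem_head.
have zs : z \in s' by move: zf; rewrite mem_filter => /andP[].
have [pp pL cz cFz] := pP z zs; have [k0 hk kr] := kP _ (prime_gt1 pp).
have [mon [_ hmon monJ]] := standard_monomials hilb_t.
have [c [ic ci] hc] := class_auxiliary_form (prime_gt0 pp) k0 sF h0 (smooth z zs) hmon hk.
pose G := \sum_i c i *: 'X_[mon i] : {mpoly int[n.+1]}.
have GE : intm G = \sum_i (c i)%:~R *: 'X_[mon i].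
  by rewrite raddf_sum; apply: eq_bigr => i _; rewrite /= map_intr_monomial.
have JG : ~ J (intm G).
  by rewrite GE; apply: monJ; exists ic; rewrite intr_eq0.
have hG : intm G \is t.-homog.
  by rewrite GE; apply: rpred_sum => i _; apply: rpredZ; rewrite dhomogX /= hmon.
apply: (integer_bezout irrC hilbC sP _ _ hG JG); first exact: filter_uniq.
  by move=> x; rewrite mem_filter => /andP[_ /s's].
move=> x; rewrite mem_filter meval_int_point => /andP[/eqP xk xs].
have zk : key z = kappa by move: zf; rewrite mem_filter => /andP[/eqP].
have /andP[/andP[/eqP E1 /eqP E2] /eqP E3] : key x == key z by rewrite xk zk.
have [ppx pLx _ _] := pP x xs.
have pxz : p x = p z by have := congr1 val E1; rewrite /= !inordK.
have [_ _ hx] := sP (s's _ xs).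
suff -> : G.@[x ord0] = 0 by [].
apply: (hc _ (w x)) => //.
- by rewrite -pxz; apply: coprime_w.
- by have := smooth x xs; rewrite pxz.
- split.
    rewrite -PoszX; apply: (@modz_inord_cong (L * r)); first by rewrite expn_gt0 prime_gt0.
      by apply: leq_trans kr _; apply: leqW; rewrite leq_mul2r pL orbT.
    by move: E2; rewrite /key /= pxz.
  move=> j; apply: (@modz_inord_cong L); [exact: prime_gt0 | exact: leqW |].
  by have := congr1 (fun f : {ffun 'I_n.+1 -> 'I_L.+1} => f j) E3; rewrite /key /= !ffunE pxz.
Qed.

Lemma curve_count : (size s <= (d + n.+1 * (d * (4 * d))) +
  L.+1 * (L * r).+1 * L.+1 ^ n.+1 * (d * t))%N.
Proof.
have hF j : exists eG : nat * {mpoly int[n.+1]}, supported (pred3 i0 i1 j) eG.2 /\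
    (other j -> [/\ (eG.1 <= 4 * d)%N /\ eG.2 \is eG.1.-homog,
       forall x, x \in s -> eG.2.@[x ord0] = 0, ~ J (intm eG.2^`M(j)) &
       forall x, x \in s -> `|(eG.2^`M(j)).@[x ord0]| <= (deriv_bound n d N)%:Z]).
  have [/andP[ji0 ji1]|nj] := boolP (other j); last first.
    by exists (0%N, 0); split=> [m|]; rewrite ?msupp0 // (negPf nj).
  have [e [G [h1 h2 h3 h4 h5]]] :=
    integer_plane_form irrC hilbC d_gt0 N_gt0 us sP Ji0 Ji1 s_large ji0 ji1.
  by exists (e, G).
pose e j := (projT1 (cid (hF j))).1; pose F j := (projT1 (cid (hF j))).2.
have sF j : supported (pred3 i0 i1 j) (F j) by have [] := projT2 (cid (hF j)).
have FP j : other j -> [/\ (e j <= 4 * d)%N /\ F j \is (e j).-homog,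
       forall x, x \in s -> (F j).@[x ord0] = 0, ~ J (intm (F j)^`M(j)) &
       forall x, x \in s -> `|((F j)^`M(j)).@[x ord0]| <= (deriv_bound n d N)%:Z].
  by have [_] := projT2 (cid (hF j)).
pose v (x : 'rV[int]_n.+1) := x ord0 i0 * \prod_(j | other j) ((F j)^`M(j)).@[x ord0].
rewrite -(count_predC (fun x => v x == 0)) -!size_filter; apply: leq_add.
  apply: (@count_bad (fun j => (F j)^`M(j)) (fun j => (e j).-1)) => j /FP[[e4 hG] _ JG _].
  by split=> //; [apply: leq_trans (leq_pred _) e4 | apply: mderiv_homog].
apply: (@count_good F e) => //.
- exact: filter_uniq.
- by move=> x; rewrite mem_filter => /andP[].
- by move=> j /FP[[_ hG] Gs _ _].
move=> x; rewrite mem_filter /= => /andP[v0 xs].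
have D0 : (0 < deriv_bound n d N)%N.
  rewrite /deriv_bound !muln_gt0 !expn_gt0 N_gt0 d_gt0 /=.
  rewrite andbT; apply/card_gt0P; have lt : (mdeg (0%MM : 'X_{1..n.+1}) < (4 * d).+1)%N by rewrite mdeg0.
  by exists (BMultinom lt).
have vN : (absz (v x) <= N * deriv_bound n d N ^ n.+1)%N.
  rewrite -lez_nat abszE /v normrM PoszM; apply: ler_pM => //.
    by have [_ _] := sP xs; apply.
  have -> : (deriv_bound n d N ^ n.+1)%N%:Z = \prod_(j < n.+1) (deriv_bound n d N)%:Z.
    by rewrite prodr_const card_ord PoszX.
  (* The product is padded to all n + 1 indices by factors 1, each at most [deriv_bound]. *)
  rewrite normr_prod big_mkcond /=; apply: ler_prod => j _.
  case: ifP => [/FP[_ _ _ hb]|_]; first by rewrite normr_ge0 hb.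
  by rewrite ler01 lez_nat.
have vx0 : (0 < absz (v x))%N by rewrite absz_gt0.
have [p [pp pL pv]] := hL vx0 vN.
have cop a : (absz a %| absz (v x))%N -> coprimez a p%:Z.
  move=> av; rewrite coprimezE coprime_sym /= prime_coprime //.
  by apply: contraNN pv => /dvdn_trans; apply.
exists p; split=> //.
  by apply: cop; rewrite /v abszM dvdn_mulr.
by move=> j oj; apply: cop; rewrite /v (bigD1 j) //= !abszM mulnCA dvdn_mulr.
Qed.

End Count.

(** * The curve bound *)

(** If every x_j were a constant multiple of x_i0 on [C], then [C] would be a single point. *)
Lemma independent_coordinates n (C : set 'rV[algC]_n.+1) (z w : 'rV[algC]_n.+1) :
    zariski_closed C -> C z -> C w -> ~ (exists c, w = c *: z) ->
  exists i0 i1, ~ vanishing C 'X_i0 /\ forall r, ~ vanishing C ('X_i1 - r *: 'X_i0).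
Proof.
move=> cC Cz Cw nprop; have [|i0 Ji0] := nonvanishing_var cC; first by exists z.
exists i0; apply: contrapT => H.
have dep j : exists r, vanishing C ('X_j - r *: 'X_i0).
  apply: contrapT => H'; apply: H; exists j; split=> // r Jr.
  by apply: H'; exists r.
have coord v j r : C v -> vanishing C ('X_j - r *: 'X_i0) -> v ord0 j = r * v ord0 i0.
  move=> Cv [_ /(_ v Cv)]; rewrite mevalB mevalZ !mevalXU => /eqP.
  by rewrite subr_eq0 => /eqP.
have zi0 : z ord0 i0 != 0.
  apply: contraNneq (closed_neq0 cC Cz) => zi0; apply/eqP/rowP => j.
  by have [r Jr] := dep j; rewrite (coord z j r Cz Jr) zi0 mulr0 mxE.
apply: nprop; exists (w ord0 i0 / z ord0 i0); apply/rowP => j; have [r Jr] := dep j.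
by rewrite mxE (coord z j r Cz Jr) (coord w j r Cw Jr) mulrCA divfK.
Qed.

Lemma irreducible_curve_count n (C : set 'rV[algC]_n.+1) d t N (s : seq 'rV[int]_n.+1) L r :
    irreducible_curve C d -> (0 < d)%N -> (1 < d * (t - d))%N -> (0 < N)%N -> uniq s ->
    (forall x, x \in s -> [/\ Zprim x, C (int_point x) & forall i, `|x ord0 i| <= N%:Z]) ->
    (forall v, (0 < v)%N -> (v <= N * deriv_bound n d N ^ n.+1)%N ->
       exists p, [/\ prime p, (p <= L)%N & ~~ (p %| v)%N]) ->
    (forall m, (m ^ (d * (t - d)).-1 <= (d * (t - d)) ^ 2 * N ^ (2 * t))%N -> (m <= r)%N) ->
  (size s <= (d + n.+1 * (d * (4 * d))) + L.+1 * (L * r).+1 * L.+1 ^ n.+1 * (d * t))%N.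
Proof.
move=> curveC d0 h1 N0 us sP hL hr; have [irrC _ _] := curveC.
have [cC _ _] := irrC.
(* If all points of [C] are proportional, [s] has at most one element; otherwise two distinct points
   force the slope to be d. *)
have [[z [w [Cz Cw nprop]]]|allprop] :=
    pselect (exists z w, [/\ C z, C w & ~ exists c, w = c *: z]); last first.
  apply: leq_trans (leq_addr _ _); apply: leq_trans (leq_addr _ _); apply: leq_trans d0.
  case: s us sP => [|x [|y s]] //= /andP[xy _] sP.
  case/negP: xy; suff -> : x = y by rewrite mem_head.
  have [[Zx Cx _] [Zy Cy _]] : [/\ Zprim x, C (int_point x) & forall i, `|x ord0 i| <= N%:Z]
     /\ [/\ Zprim y, C (int_point y) & forall i, `|y ord0 i| <= N%:Z].
    by split; apply: sP; rewrite ?in_cons ?eqxx ?orbT.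
  apply: Zprim_proportional => //; apply: contrapT => nprop; apply: allprop.
  by exists (int_point y), (int_point x).
have [D [T [hilbC D0d]]] := curve_hilb_linear curveC.
have D0 := curve_slope irrC hilbC Cz Cw nprop.
have {D0d} Dd : D = d by case: D0d D0 => ->.
subst D; have [i0 [i1 [Ji0 Ji1]]] := independent_coordinates cC Cz Cw nprop.
have [small|large] := leqP (size s) (d * (4 * d)).
  apply: leq_trans (leq_addr _ _); apply: leq_trans (leq_addl _ _).
  by apply: leq_trans small _; rewrite leq_pmull.
exact: (curve_count irrC hilbC d0 N0 us sP Ji0 Ji1 large h1 (hilb_lower irrC hilbC t) hL hr).
Qed.

(** The exponent depends only on n and d, so primes up to a small power of N suffice in
    [small_nondivisor]. *)
Lemma deriv_bound_polynomial n d : (0 < d)%N -> exists A E, forall N, (0 < N)%N ->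
  (N * deriv_bound n d N ^ n.+1 <= A * N ^ E)%N.
Proof.
move=> d0; set mc := mon_count n d.
exists ((mc * ((2 * mc).+1 ^ mc * (4 * d))) ^ n.+1)%N, (1 + (4 * d * mc + 4 * d) * n.+1)%N.
move=> N N0; rewrite expnD expn1 mulnCA leq_mul2l; apply/orP; right.
rewrite expnM -expnMn leq_exp2r // /deriv_bound -/mc.
have hX : ((2 * mc * N ^ (4 * d)).+1 ^ mc <= (2 * mc).+1 ^ mc * N ^ (4 * d * mc))%N.
  have [->|mc0] := posnP mc; first by rewrite !(muln0, expn0).
  rewrite [in X in (_ <= X)%N]expnM -expnMn leq_exp2r //.
  by rewrite [X in (_ <= X)%N]mulSn addnC -addn1 leq_add2l expn_gt0 N0.
have swap (a X Y c P P1 : nat) : (X <= Y * P1 -> a * (X * (c * P)) <= a * (Y * c) * (P1 * P))%N.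
  move=> XY; have -> : (a * (Y * c) * (P1 * P) = a * (Y * P1 * (c * P)))%N by lia.
  by rewrite leq_mul2l leq_mul2r XY !orbT.
by rewrite expnD; apply: swap.
Qed.

Lemma finite_bounded_vectors n N :
  finite_set [set x : 'rV[int]_n | (max_height x <= N)%N]%classic.
Proof.
pose f (g : {ffun 'I_n -> 'I_(2 * N).+1}) : 'rV[int]_n := \row_i ((g i)%:Z - N%:Z).
apply: (@sub_finite_set _ _ (f @` [set: {ffun 'I_n -> 'I_(2 * N).+1}])%classic); last first.
  exact/finite_image/finite_finset.
move=> x /= hx; exists [ffun i => inord (absz (x ord0 i + N%:Z))] => //.
apply/rowP => i; rewrite mxE ffunE.
have : (`|x ord0 i| <= N)%N.
  by apply: leq_trans hx; exact: (@leq_bigmax _ (fun i => `|x ord0 i|%N) i).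
move: (x ord0 i) => a aN; rewrite inordK; lia.
Qed.

Section RealEstimates.
Variable R : realType.
Implicit Types eps B x : R.

(* For [t = u + d] the left-hand side is [2 t / (h - 1)], [h = d (t - d)]. *)
Lemma exponent_choice d eps : (0 < d)%N -> 0 < eps -> exists2 u : nat, (1 < u)%N &
  2 * (u + d)%:R / (d * u).-1%:R <= 2 / d%:R + eps.
Proof.
(* Since 2 / d <= 2 and d u >= u, it is enough that 2 d + 2 + eps <= u eps. *)
move=> d0 eps0; pose y : R := (2 * d%:R + 2 + eps) / eps.
have y0 : 0 <= y.
  apply: divr_ge0; last exact: ltW.
  by apply: addr_ge0; [apply: addr_ge0; rewrite ?mulr_ge0 ?ler0n | exact: ltW].
pose u := (Num.truncn y).+2; exists u => //.
have d0R : 0 < d%:R :> R by rewrite ltr0n.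
have d1R : 1 <= d%:R :> R by rewrite ler1n.
have yu : y <= u%:R.
  have /andP[_ /ltW h] := truncn_itv y0.
  by apply: le_trans h _; rewrite ler_nat /u.
have du1 : (1 < d * u)%N by rewrite (@leq_trans (1 * u)) // leq_mul2r d0 orbT.
have E : (d * u).-1%:R = d%:R * u%:R - 1 :> R.
  by rewrite -subn1 natrB ?natrM // ltnW.
have du0 : 0 < d%:R * u%:R - 1 :> R by rewrite -E ltr0n -subn1 subn_gt0.
rewrite E ler_pdivrMr // natrD.
have h1 : 2 * d%:R + 2 + eps <= u%:R * eps by rewrite -ler_pdivrMr.
have h2 : u%:R * eps <= d%:R * u%:R * eps.
  by rewrite ler_pM2r // ler_peMl ?ler0n.
have h3 : 2 / d%:R <= 2 :> R by rewrite ler_pdivrMr // ler_peMr.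
have h4 : 2 / d%:R * (d%:R * u%:R) = 2 * u%:R :> R by rewrite mulrA divfK ?lt0r_neq0.
have -> : (2 / d%:R + eps) * (d%:R * u%:R - 1) =
  2 / d%:R * (d%:R * u%:R) - 2 / d%:R + d%:R * u%:R * eps - eps by ring.
rewrite h4; lra.
Qed.


End RealEstimates.

Unset Implicit Arguments.

Local Open Scope classical_set_scope.
Local Open Scope ring_scope.

Theorem theorem5 (R : realType) (d : nat) (eps : R)
  (hd : (1 <= d)%N) (heps : 0 < eps) :
  exists c : R,
    forall (C : set 'rV[algC]_4) (hC : @irreducible_curve 3 C d)
           (B : R) (hB : 1 <= B),
      let pts : set 'rV[int]_4 :=
        [set x : 'rV[int]_4 | [/\ @Zprim 4 x, C (int_point x) & (max_height x)%:R <= B]] in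
      finite_set pts /\
      (#|` fset_set pts|)%:R <= c * B `^ (2 / d%:R + eps).
Proof.
have eps2 : 0 < eps / 2 by rewrite divr_gt0.
have [u u1 hu] := exponent_choice hd eps2.
pose t := (u + d)%N; have htd : (t - d = u)%N by rewrite addnK.
pose h := (d * (t - d))%N.
have h1 : (1 < h)%N by rewrite /h htd; apply: leq_trans u1 _; rewrite leq_pmull.
have [A [E hAE]] := @deriv_bound_polynomial 3 d hd.
(* Six factors of size N^(1/M) may cost at most N^(eps/2). *)
pose M := (Num.truncn (12 / eps)).+1.
(* L^(1 + M E) >= A N^E as soon as L >= A and L^M >= N. *)
have [L0 hL0] := small_nondivisor (1 + M * E).
pose a1 : R := (L0 + A + 3)%:R.
pose c2 : nat := (d + 4 * (d * (4 * d)))%N.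
exists (c2%:R + (d * t)%:R * a1 ^+ 6 * ((h ^ 2)%:R + 1)) => C hC B hB pts.
pose N := Num.truncn B.
have B0 : 0 <= B by apply: le_trans hB.
have /andP[NB BN] := truncn_itv B0; rewrite -/N in NB BN.
have N0 : (0 < N)%N.
  by rewrite -ltnS -(@ltr_nat R); apply: le_lt_trans BN.
have N1 : 1 <= N%:R :> R by rewrite ler1n.
have ptsN x : pts x -> (max_height x <= N)%N.
  by move=> [_ _ xB]; rewrite -ltnS -(@ltr_nat R); apply: le_lt_trans BN.
have fin : finite_set pts.
  by apply: sub_finite_set (finite_bounded_vectors 4 N) => x /ptsN.
split=> //.
pose s := enum_fset (fset_set pts).
have sP x : x \in s -> pts x.
  by move=> xs; have : x \in fset_set pts by []; rewrite in_fset_set // inE.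
pose e1 : R := M%:R^-1; pose e2 : R := 2 * t%:R / h.-1%:R.
have NR0 : 0 <= N%:R :> R by rewrite ler0n.
have M0 : 0 < M%:R :> R by rewrite ltr0n.
pose l := (Num.truncn (N%:R `^ e1)).+1.
have Nl : (N <= l ^ M)%N.
  have /andP[_ hl] := truncn_itv (powR_ge0 N%:R e1).
  rewrite -(@ler_nat R) natrX.
  have -> : N%:R = (N%:R `^ e1) ^+ M :> R.
    by rewrite -powR_mulrn ?powR_ge0 // -powRrM /e1 mulVf ?lt0r_neq0 // powRr1.
  by rewrite lerXn2r ?nnegrE ?powR_ge0 // ltW.
pose L := (L0 + A + l)%N.
(* The root of order h - 1 of h^2 is crudely bounded by h^2 itself. *)
pose X : R := (h ^ 2)%:R * N%:R `^ e2; pose r := Num.truncn X.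
have X0 : 0 <= X by rewrite mulr_ge0 ?powR_ge0.
have h'0 : 0 < h.-1%:R :> R by rewrite ltr0n -subn1 subn_gt0.
have hr m : (m ^ h.-1 <= h ^ 2 * N ^ (2 * t))%N -> (m <= r)%N.
  move=> hm; rewrite /r truncn_ge_nat // leNgt; apply/negP => Xm.
  move: hm; rewrite leqNgt => /negP; apply; rewrite -(@ltr_nat R) natrX.
  apply: (@le_lt_trans _ _ (X ^+ h.-1)); last first.
    by rewrite ltrXn2r ?nnegrE // -lt0n -subn1 subn_gt0.
  rewrite /X exprMn -[(N%:R `^ e2) ^+ _]powR_mulrn ?powR_ge0 // -powRrM.
  rewrite /e2 divfK ?lt0r_neq0 // -natrM powR_mulrn // natrM !natrX.
  rewrite ler_wpM2r ?exprn_ge0 // -natrX ler_eXnr //.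
    by rewrite -subn1 subn_gt0.
  by rewrite ler1n expn_gt0 (ltnW h1).
have hL v : (0 < v)%N -> (v <= N * deriv_bound 3 d N ^ 4)%N ->
    exists p, [/\ prime p, (p <= L)%N & ~~ (p %| v)%N].
  move=> v0 hv; apply: (hL0 L v _ v0); first by rewrite /L -addnA leq_addr.
  apply: leq_trans hv _; apply: leq_trans (hAE N N0) _.
  rewrite expnD expn1 expnM leq_mul //.
    by rewrite /L addnAC leq_addl.
  have [->//|E0] := posnP E; rewrite leq_exp2r //; apply: leq_trans Nl _.
  by rewrite leq_exp2r // leq_addl.
have sP' x : x \in s -> [/\ Zprim x, C (int_point x) & forall i, `|x ord0 i| <= N%:Z].
  move=> /sP px; have [Zx Cx _] := px; split=> //.
  exact/max_height_le/ptsN.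
have us : uniq s by exact: fset_uniq.
have cnt := @irreducible_curve_count 3 C d t N s L r hC hd h1 N0 us sP' hL hr.
have Ne1 : 1 <= N%:R `^ e1.
  by rewrite -[X in X <= _](powRr0 N%:R) ler_powR // invr_ge0 ltW.
have Ne2 : 1 <= N%:R `^ e2.
  by rewrite -[X in X <= _](powRr0 N%:R) ler_powR // divr_ge0 // ?mulr_ge0 // ltW.
have La : L.+1%:R <= a1 * N%:R `^ e1.
  have /andP[hl _] := truncn_itv (powR_ge0 N%:R e1).
  have -> : L.+1%:R = (L0 + A + 2)%:R + (Num.truncn (N%:R `^ e1))%:R :> R.
    by rewrite -natrD /L /l addn2 !addSn !addnS.
  rewrite /a1; have -> : (L0 + A + 3)%:R = (L0 + A + 2)%:R + 1 :> R.
    by rewrite natr1 !addnS.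
  by rewrite mulrDl mul1r lerD // ler_peMr.
have rX : r.+1%:R <= ((h ^ 2)%:R + 1) * N%:R `^ e2.
  have /andP[hX _] := truncn_itv X0.
  by rewrite -natr1 mulrDl mul1r lerD.
have expo : 6 * e1 + e2 <= 2 / d%:R + eps.
  have he2 : e2 <= 2 / d%:R + eps / 2 by rewrite /e2 /h htd.
  have he1 : 6 * e1 <= eps / 2.
    rewrite /e1 ler_pdivrMr //.
    have y0 : 0 <= 12 / eps by rewrite divr_ge0 // ltW.
    have /andP[_ /ltW hM] := truncn_itv y0.
    have : 12 <= M%:R * eps by rewrite -ler_pdivrMr.
    lra.
  have -> : 2 / d%:R + eps = eps / 2 + (2 / d%:R + eps / 2) by field; rewrite pnatr_eq0 -lt0n.
  exact: lerD.
have NB' : N%:R `^ (6 * e1 + e2) <= B `^ (2 / d%:R + eps).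
  apply: (@le_trans _ _ (N%:R `^ (2 / d%:R + eps))); first by rewrite ler_powR.
  rewrite ge0_ler_powR // ?nnegrE //.
  by rewrite addr_ge0 ?divr_ge0 // ltW.
have NE1 : 1 <= N%:R `^ (6 * e1 + e2).
  rewrite -[X in X <= _](powRr0 N%:R) ler_powR // addr_ge0 //.
    by rewrite mulr_ge0 // invr_ge0 ltW.
  by rewrite divr_ge0 // ?mulr_ge0 // ltW.
apply: (@le_trans _ _ ((c2%:R + (d * t)%:R * a1 ^+ 6 * ((h ^ 2)%:R + 1)) * N%:R `^ (6 * e1 + e2))); last first.
  rewrite ler_wpM2l // addr_ge0 // mulr_ge0 ?addr_ge0 // mulr_ge0 // exprn_ge0 //.
apply: (@le_trans _ _ (c2%:R + L.+1%:R ^+ 6 * r.+1%:R * (d * t)%:R)).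
  rewrite -natrX -!natrM -natrD ler_nat; apply: leq_trans cnt _.
  rewrite leq_add2l leq_mul2r; apply/orP; right.
  (* Six factors L + 1: one for the prime, one from q <= p r, four for the coordinates modulo p. *)
  apply: (@leq_trans (L.+1 * (L.+1 * r.+1) * L.+1 ^ 4)).
    by rewrite leq_mul2r leq_mul2l ltn_mul ?orbT.
  by rewrite mulnA mulnAC mulnn -expnD.
rewrite mulrDl lerD //; first by rewrite ler_peMr.
have -> : N%:R `^ (6 * e1 + e2) = (N%:R `^ e1) ^+ 6 * N%:R `^ e2.
  rewrite powRD; last by rewrite pnatr_eq0 (gtn_eqF N0) implybT.
  by rewrite (mulrC 6 e1) powRrM powR_mulrn ?powR_ge0.
apply: (@le_trans _ _ ((a1 * N%:R `^ e1) ^+ 6 * (((h ^ 2)%:R + 1) * N%:R `^ e2) * (d * t)%:R)).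
  rewrite ler_wpM2r // ler_pM ?exprn_ge0 //.
  by rewrite lerXn2r ?nnegrE // mulr_ge0 ?powR_ge0 // /a1 ler0n.
by rewrite exprMn le_eqVlt; apply/orP; left; apply/eqP; ring.
Qed.
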